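(* Let $\mathcal{M}_{0,4}=\mathbb{C}\setminus\{0,1\}$, regarded as a real $2$-dimensional analytic manifold. Let $Z\subset \mathcal{M}_{0,4}\times\mathbb{R}$ be the set of pairs $(\lambda,a)$ such that the Dunkl connection $\nabla^{\mathrm{D}}_{\lambda,a}$ (defined in the context) preserves a non-zero Hermitian form. Then $Z$ is a proper analytic subset of $\mathcal{M}_{0,4}\times\mathbb{R}$: locally $Z$ is the zero set of real analytic functions which are not identically zero. In particular $Z$ is closed and has Lebesgue measure zero.
   Context: Work on $\mathbb{C}^2$ with linear coordinates $z,w$ and standard Hermitian inner product $\langle v,w\rangle=v_1\bar w_1+v_2\bar w_2$. A Hermitian $2\times 2$ matrix $H$ defines the Hermitian form $\langle v,w\rangle_H=\langle Hv,w\rangle$. For $\lambda\in\mathbb{C}\setminus\{0,1\}$ consider the four lines $L_1=\{z=0\}$, $L_2=\{w=0\}$, $L_3=\{w=z\}$, $L_4=\{z=\lambda w\}$ with defining linear forms $\ell_1=z$, $\ell_2=w$, $\ell_3=w-z$, $\ell_4=z-\lambda w$. Let $H(\lambda)$ be the unique positive definite Hermitian matrix with $\det H(\lambda)=1$ such that $\sum_{i=1}^4 P_i$ is a scalar multiple of the identity, where $P_i$ is the orthogonal projection onto the $\langle\cdot,\cdot\rangle_{H(\lambda)}$-orthogonal complement of $L_i$ (such an $H(\lambda)$ exists and is unique). Let $A_i(\lambda)$ denote the matrix of this orthogonal projection onto $L_i^{\perp}$ with respect to $H(\lambda)$. For $a\in\mathbb{R}$, $\nabla^{\mathrm{D}}_{\lambda,a}$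 is the connection on the tangent bundle of $\mathbb{C}^2\setminus\bigcup_i L_i$ which in the frame $\partial_z,\partial_w$ is $$\nabla^{\mathrm{D}}_{\lambda,a}=d-a\sum_{i=1}^4 A_i(\lambda)\frac{d\ell_i}{\ell_i}.$$ It is flat. A connection ''preserves a non-zero Hermitian form'' if there is a non-zero (possibly degenerate, possibly indefinite) Hermitian form on the tangent bundle of $\mathbb{C}^2\setminus\bigcup_iL_i$ that is parallel for the connection; equivalently, a non-zero Hermitian form on $T_{x_0}\mathbb{C}^2$ (for a base point $x_0$ off the lines) invariant under the holonomy group. *)

(* Defs.v *)
From HB Require Import structures.
From mathcomp Require Import all_boot all_order all_algebra.
From mathcomp Require Import all_classical all_reals all_analysis.
From mathcomp Require Import complex.
Set Implicit Arguments. Unset Strict Implicit. Unset Printing Implicit Defensive.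
Import Order.TTheory GRing.Theory Num.Theory.
Import numFieldNormedType.Exports.
Local Open Scope ring_scope.
Local Open Scope classical_set_scope.
Local Open Scope complex_scope.

Definition ctr (R : realType) (m n : nat) (M : 'M[R[i]]_(m, n)) : 'M[R[i]]_(n, m) :=
  (map_mx (@conjc R) M)^T.

Definition hform (R : realType) (H : 'M[R[i]]_2) (v w : 'cV[R[i]]_2) : R[i] :=
  (ctr w *m (H *m v)) ord0 ord0.

Definition hermitian (R : realType) (H : 'M[R[i]]_2) : Prop := ctr H = H.

Definition posdef (R : realType) (H : 'M[R[i]]_2) : Prop :=
  hermitian H /\ forall v : 'cV[R[i]]_2, v != 0 -> 0 < hform H v v.

Definition zco (R : realType) (v : 'cV[R[i]]_2) : R[i] := v ord0 ord0.
Definition wco (R : realType) (v : 'cV[R[i]]_2) : R[i] := v ord_max ord0.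

Definition ell (R : realType) (lam : R[i]) (i : 'I_4) (v : 'cV[R[i]]_2) : R[i] :=
  match val i with
  | 0 => zco v
  | 1 => wco v
  | 2 => wco v - zco v
  | _ => zco v - lam * wco v
  end.

Definition line (R : realType) (lam : R[i]) (i : 'I_4) : set 'cV[R[i]]_2 :=
  [set v | ell lam i v = 0].

Definition orthc (R : realType) (H : 'M[R[i]]_2) (S : set 'cV[R[i]]_2) :
  set 'cV[R[i]]_2 := [set v | forall u, S u -> hform H v u = 0].

Definition is_orthproj (R : realType) (H : 'M[R[i]]_2) (W : set 'cV[R[i]]_2)
  (P : 'M[R[i]]_2) : Prop :=
  forall v : 'cV[R[i]]_2, W (P *m v) /\ forall u, W u -> hform H (v - P *m v) u = 0.

Definition orthproj (R : realType) (H : 'M[R[i]]_2) (W : set 'cV[R[i]]_2) :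
  'M[R[i]]_2 := xget 0 (is_orthproj H W).

Definition projL (R : realType) (lam : R[i]) (H : 'M[R[i]]_2) (i : 'I_4) :
  'M[R[i]]_2 := orthproj H (orthc H (line lam i)).

Definition is_Hlam (R : realType) (lam : R[i]) (H : 'M[R[i]]_2) : Prop :=
  posdef H /\ \det H = 1 /\
  exists c : R[i], \sum_(i < 4) projL lam H i = c%:M.

(* H(lam): the (unique, by the context) matrix with the above property *)
Definition Hlam (R : realType) (lam : R[i]) : 'M[R[i]]_2 :=
  xget 1%:M (is_Hlam lam).

Definition Amat (R : realType) (lam : R[i]) (i : 'I_4) : 'M[R[i]]_2 :=
  projL lam (Hlam lam) i.

Definition Ucomp (R : realType) (lam : R[i]) : set 'cV[R[i]]_2 :=
  [set x | forall i, ell lam i x != 0].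

(* connection matrix: nabla^D_{lam,a} = d - Omega with
   Omega_x(v) = a * sum_i A_i(lam) dl_i(v)/l_i(x)  (dl_i(v) = l_i(v), l_i linear),
   v a (real) tangent vector at x, viewed as a vector of C^2 *)
Definition Omega (R : realType) (lam : R[i]) (a : R) (x v : 'cV[R[i]]_2) :
  'M[R[i]]_2 :=
  \sum_(i < 4) ((a%:C * ell lam i v / ell lam i x) *: Amat lam i).

(* covariant derivative, along v at x, of the constant section X
   (constant coefficients in the frame d/dz, d/dw) *)
Definition nablaD (R : realType) (lam : R[i]) (a : R) (x v X : 'cV[R[i]]_2) :
  'cV[R[i]]_2 := - (Omega lam a x v *m X).

Definition has_dderiv (R : realType) (f : 'cV[R[i]]_2 -> R[i]) (x v : 'cV[R[i]]_2)
  (L : R[i]) : Prop :=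
  (complex.Re ((f (x + t%:C *: v) - f x) / t%:C) @[t --> (0 : R)^']
     --> (complex.Re L : R)) /\
  (complex.Im ((f (x + t%:C *: v) - f x) / t%:C) @[t --> (0 : R)^']
     --> (complex.Im L : R)).

(* h (a field of matrices, h(x)(X,Y) = <X,Y>_{h(x)}) is a Hermitian form on the
   tangent bundle of the complement which is parallel for nabla^D_{lam,a}:
   v(h(X,Y)) = h(nabla_v X, Y) + h(X, nabla_v Y) for the frame sections *)
Definition parallel_hform (R : realType) (lam : R[i]) (a : R)
  (h : 'cV[R[i]]_2 -> 'M[R[i]]_2) : Prop :=
  (forall x, Ucomp lam x -> hermitian (h x)) /\
  forall x v X Y : 'cV[R[i]]_2, Ucomp lam x ->
    has_dderiv (fun y => hform (h y) X Y) x v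
      (hform (h x) (nablaD lam a x v X) Y + hform (h x) X (nablaD lam a x v Y)).

Definition preserves_hform (R : realType) (lam : R[i]) (a : R) : Prop :=
  exists h : 'cV[R[i]]_2 -> 'M[R[i]]_2,
    parallel_hform lam a h /\ exists x, Ucomp lam x /\ h x != 0.

Definition lamof (R : realType) (p : (R * R) * R) : R[i] := p.1.1 +i* p.1.2.

Definition M04R (R : realType) : set ((R * R) * R) :=
  [set p | lamof p != 0 /\ lamof p != 1].

Definition Zset (R : realType) : set ((R * R) * R) :=
  [set p | M04R p /\ preserves_hform (lamof p) p.2].

Definition pterm (R : realType) (c : nat -> nat -> nat -> R) (p q : (R * R) * R)
  (i j k : nat) : R :=
  c i j k * (q.1.1 - p.1.1) ^+ i * (q.1.2 - p.1.2) ^+ j * (q.2 - p.2) ^+ k.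

Definition psum (R : realType) (c : nat -> nat -> nat -> R) (p q : (R * R) * R)
  (N : nat) : R :=
  \sum_(i < N.+1) \sum_(j < N.+1) \sum_(k < N.+1 | (i + j + k <= N)%N)
    pterm c p q i j k.

Definition pabssum (R : realType) (c : nat -> nat -> nat -> R) (p q : (R * R) * R)
  (N : nat) : R :=
  \sum_(i < N.+1) \sum_(j < N.+1) \sum_(k < N.+1 | (i + j + k <= N)%N)
    `|pterm c p q i j k|.

Definition analytic_at (R : realType) (f : (R * R) * R -> R) (p : (R * R) * R) :
  Prop :=
  exists2 r : R, 0 < r & exists c : nat -> nat -> nat -> R,
    forall q, ball p r q ->
      (psum c p q N @[N --> \oo] --> f q) /\
      (exists M : R, forall N, pabssum c p q N <= M).

Definition analytic_on (R : realType) (U : set ((R * R) * R))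
  (f : (R * R) * R -> R) : Prop :=
  forall p, U p -> analytic_at f p.

(* Main.v *)
Require Import Defs.
From HB Require Import structures.
From mathcomp Require Import all_boot all_order all_algebra.
From mathcomp Require Import all_classical all_reals all_analysis.
From mathcomp Require Import complex.
From mathcomp Require Import ring lra zify.
Set Implicit Arguments. Unset Strict Implicit. Unset Printing Implicit Defensive.
Import Order.TTheory GRing.Theory Num.Theory.
Import numFieldNormedType.Exports.
Local Open Scope ring_scope.
Local Open Scope classical_set_scope.
Local Open Scope complex_scope.

(* By homogeneity (sum_i A_i = 2) a parallel Hermitian form is determined by its restriction h to
   the slice w = 1, where h' = - (C^* h + h C) for the Fuchsian system C = sum_j B_j / (z - s_j)
   with poles s = (0, 1, lam) and residues a A_1, a A_3, a A_4.  Solving this system by power series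
   along finitely many segments that pass above or below each pole turns the existence of h into
   finitely many linear conditions X_i^* g X_i = Y_i^* g Y_i on the value g of h at a base point.
   The A_i have a closed form in lam, |lam| and |1 - lam|, hence X_i and Y_i are real analytic in
   (lam, a), and locally Z is the zero set of the Gram determinant of these conditions.
   At a = 3/2 and lam = - mu with mu slightly larger than 1, pulling h back along two circles in a
   frame for which the system has constant direction forces h = 0, so Z is not everything there.
   Isolated zeros in one variable then propagate non-membership along coordinate lines, which gives
   density of the complement and, by Fubini, measure zero. *)

(** * Power series in three real variables *)

(** The pole [lam] moves with the parameter, so analytic dependence needs paths that stay fixed
    while [(lam, a)] varies and a number of discs chosen beforehand. This is why transport is a
    finite product of power series, with bounds in a weighted l1 norm that are explicit enough to
    survive recursion. The conditions on [g] involve adjoints, so they are real analytic and not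
    holomorphic in [lam]. The value [a = 3/2] comes from the double cover
    [rho^2 = z (z - 1) (z + mu)]: each residue is [a] times a rank one projection, with exponents
    [0] and [3/2], which become integers on the cover. A gauge change then makes the system constant
    along the invariant differential [dz / rho] of this elliptic curve, with a matrix of square
    [mu - 1]. The two circles give a real and an imaginary period. For [mu > 1] the flow is
    hyperbolic along the real period and elliptic along the imaginary one; [mu] close to [1] keeps
    the rotation angle of the latter well below a full turn, so no nonzero form survives both. *)

Lemma cvgn_eps (R : realType) (u : nat -> R) (l : R) :
  (u n @[n --> \oo] --> l) <->
  (forall e, 0 < e -> exists N, forall n, (N <= n)%N -> `|u n - l| <= e).
Proof.
split=> [/cvgrPdist_le h e e0|h].
  have [N _ hN] := h e e0; exists N => n Nn.
  by rewrite distrC; exact: hN.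
apply/cvgrPdist_le => e e0; have [N hN] := h e e0.
by exists N => // n Nn /=; rewrite distrC; exact: hN.
Qed.

Lemma cvgn_unique (R : realType) (u : nat -> R) (l l' : R) :
  (u n @[n --> \oo] --> l) -> (u n @[n --> \oo] --> l') -> l = l'.
Proof. by move=> h h'; exact: (cvg_unique _ h h'). Qed.

Lemma cvgn_le (R : realType) (u : nat -> R) (l M : R) :
  (u n @[n --> \oo] --> l) -> (forall n, u n <= M) -> l <= M.
Proof.
move=> h hM; rewrite -(cvg_lim _ h)//; apply: limr_le; first by apply/cvg_ex; exists l.
by apply: nearW.
Qed.

Lemma cvgn_normr_le (R : realType) (u : nat -> R) (l M : R) :
  (u n @[n --> \oo] --> l) -> (forall n, `|u n| <= M) -> `|l| <= M.
Proof. by move=> h; apply: cvgn_le; apply: cvg_norm. Qed.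

Lemma cvgn_sum (R : realType) (I : Type) (r : seq I) (P : pred I)
    (u : I -> nat -> R) (v : I -> R) :
  (forall i, P i -> u i n @[n --> \oo] --> v i) ->
  (\sum_(i <- r | P i) u i n) @[n --> \oo] --> \sum_(i <- r | P i) v i.
Proof.
move=> h; elim: r => [|a r IH].
  by under eq_fun do rewrite big_nil; rewrite big_nil; exact: cvg_cst.
under eq_fun do rewrite big_cons; rewrite big_cons; case: ifP => // Pa.
by apply: cvgD => //; exact: h.
Qed.

Lemma cvgn_bounded_sum (R : realType) (a : nat -> R) (m : nat -> R) (M : R) :
  (forall n, `|a n| <= m n) -> (forall N, \sum_(n < N) m n <= M) ->
  exists l : R, (\sum_(n < N) a n) @[N --> \oo] --> l.
Proof.
move=> am hM.
have : cvgn (series a).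
  apply: normed_cvg; apply: nondecreasing_is_cvgn.
    apply/nondecreasing_seqP => n /=; rewrite /series /= big_nat_recr//= lerDl//.
  exists M => _ [n _ <-]; rewrite /normed_series_of seriesEord /=.
  by apply: le_trans (hM n); apply: ler_sum => i _.
by move=> /cvg_ex[l hl]; exists l; move: hl; rewrite seriesEord.
Qed.

(** [psum] and [pabssum] are instances of [tsum] by conversion; [dsum] is the layer of total degree
    [N], so that a triple series can be handled as an ordinary series over the degree. *)
Definition tsum (R : realType) (g : nat -> nat -> nat -> R) (N : nat) : R :=
  \sum_(i < N.+1) \sum_(j < N.+1) \sum_(k < N.+1 | (i + j + k <= N)%N) g i j k.

Definition dsum (R : realType) (g : nat -> nat -> nat -> R) (N : nat) : R :=
  \sum_(i < N.+1) \sum_(j < N.+1) \sum_(k < N.+1 | (i + j + k == N)%N) g i j k.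

Section TripleSums.
Variable R : realType.
Implicit Types (g : nat -> nat -> nat -> R).

Lemma tsumS g N : tsum g N.+1 = tsum g N + dsum g N.+1.
Proof.
rewrite /tsum /dsum.
transitivity ((\sum_(i < N.+2) \sum_(j < N.+2) \sum_(k < N.+2 | (i + j + k <= N)%N) g i j k)
   + \sum_(i < N.+2) \sum_(j < N.+2) \sum_(k < N.+2 | (i + j + k == N.+1)%N) g i j k).
  rewrite -big_split; apply: eq_bigr => i _; rewrite -big_split; apply: eq_bigr => j _ /=.
  rewrite (bigID (fun k : 'I_N.+2 => (i + j + k <= N)%N)) /=; congr (_ + _); apply: eq_bigl => k; lia.
congr (_ + _).
rewrite big_ord_recr /= [X in _ + X]big1 ?addr0; last first.
  by move=> j _; rewrite big_pred0// => k; lia.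
apply: eq_bigr => i _; rewrite big_ord_recr /= [X in _ + X]big_pred0 ?addr0; last first.
  by move=> k; lia.
apply: eq_bigr => j _; rewrite big_mkcond big_ord_recr /= ifF ?addr0; last lia.
by rewrite [RHS]big_mkcond.
Qed.

Lemma tsum_dsum g N : tsum g N = \sum_(n < N.+1) dsum g n.
Proof.
elim: N => [|N IH]; last by rewrite tsumS IH [RHS]big_ord_recr.
by rewrite big_ord1; do 2 (apply: eq_bigr => ? _); apply: eq_bigl => k; rewrite leqn0.
Qed.

Lemma eq_tsum g g' N : (forall i j k, g i j k = g' i j k) -> tsum g N = tsum g' N.
Proof. by move=> h; do 3 (apply: eq_bigr => ? _). Qed.

Lemma tsumD g g' N : tsum (fun i j k => g i j k + g' i j k) N = tsum g N + tsum g' N.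
Proof.
by rewrite /tsum -big_split; apply: eq_bigr => i _; rewrite -big_split; apply: eq_bigr => j _;
  rewrite -big_split.
Qed.

Lemma tsumZ a g N : tsum (fun i j k => a * g i j k) N = a * tsum g N.
Proof.
by rewrite /tsum mulr_sumr; apply: eq_bigr => i _; rewrite mulr_sumr; apply: eq_bigr => j _;
  rewrite mulr_sumr.
Qed.

Lemma tsum_sum (I : Type) (r : seq I) (g : I -> nat -> nat -> nat -> R) N :
  tsum (fun i j k => \sum_(n <- r) g n i j k) N = \sum_(n <- r) tsum (g n) N.
Proof.
elim: r => [|n r IH].
  by rewrite big_nil /tsum; do 3 (apply: big1 => ? _); rewrite big_nil.
by rewrite big_cons -IH -tsumD; apply: eq_tsum => i j k; rewrite big_cons.
Qed.

Lemma ler_tsum g g' N : (forall i j k, g i j k <= g' i j k) -> tsum g N <= tsum g' N.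
Proof. by move=> h; do 3 (apply: ler_sum => ? _). Qed.

Lemma tsum_ge0 g N : (forall i j k, 0 <= g i j k) -> 0 <= tsum g N.
Proof. by move=> h; do 3 (apply: sumr_ge0 => ? _). Qed.

Lemma ler_norm_tsum g N : `|tsum g N| <= tsum (fun i j k => `|g i j k|) N.
Proof.
rewrite /tsum; apply: le_trans (ler_norm_sum _ _ _) _; apply: ler_sum => i _.
apply: le_trans (ler_norm_sum _ _ _) _; apply: ler_sum => j _.
exact: ler_norm_sum.
Qed.

Lemma tsum_cvg (g : nat -> nat -> nat -> nat -> R) g' N :
  (forall i j k, g n i j k @[n --> \oo] --> g' i j k) ->
  tsum (g n) N @[n --> \oo] --> tsum g' N.
Proof. by move=> h; do 3 (apply: cvgn_sum => ? _). Qed.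

Lemma ler_tsum_coef g N i j k : (forall i j k, 0 <= g i j k) -> (i + j + k <= N)%N ->
  g i j k <= tsum g N.
Proof.
move=> g0 le; rewrite /tsum.
have iN : (i < N.+1)%N by lia.
have jN : (j < N.+1)%N by lia.
have kN : (k < N.+1)%N by lia.
rewrite (bigD1 (Ordinal iN))//= (bigD1 (Ordinal jN))//= (bigD1 (Ordinal kN))//=.
by rewrite -!addrA lerDl !addr_ge0//; repeat (apply: sumr_ge0 => ? _).
Qed.

Lemma tsum_const0 g N : (forall i j k, (0 < i + j + k)%N -> g i j k = 0) ->
  tsum g N = g 0%N 0%N 0%N.
Proof.
move=> h; rewrite /tsum big_ord_recl big_ord_recl /= big_mkcond big_ord_recl /=.
rewrite !big1 ?addr0// => i _; last by case: ifP => // _; apply: h.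
  by rewrite big1// => j _; rewrite big1// => k _; apply: h; rewrite /bump /=; lia.
by rewrite big1// => j _; apply: h; rewrite /bump /=; lia.
Qed.

End TripleSums.

(** [M] bounds the coefficients in the l1 norm with weight [r] to the total degree. This norm is
    submultiplicative and dominates the sup norm on the box, so series, products and fixed points
    are controlled by numbers alone. *)
Definition An (R : realType) (p : (R * R) * R) (r : R) (f : (R * R) * R -> R) (M : R) :=
  exists c : nat -> nat -> nat -> R,
    (forall N, tsum (fun i j k => `|c i j k| * r ^+ (i + j + k)) N <= M) /\
    (forall q, ball p r q -> psum c p q N @[N --> \oo] --> f q).

Section AnalyticAlgebra.
Variables (R : realType) (p : (R * R) * R).
Implicit Types (f g : (R * R) * R -> R) (q : (R * R) * R) (r M : R).

Lemma ball3P (p' : (R * R) * R) r q : ball p' r q <->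
  [/\ `|q.1.1 - p'.1.1| < r, `|q.1.2 - p'.1.2| < r & `|q.2 - p'.2| < r].
Proof.
split=> [[[h1 h2] h3]|[h1 h2 h3]].
  by split; rewrite distrC.
by split; [split|]; rewrite /ball/= distrC.
Qed.

Lemma pterm_le c r q i j k : 0 <= r -> ball p r q ->
  `|pterm c p q i j k| <= `|c i j k| * r ^+ (i + j + k).
Proof.
move=> r0 /ball3P[h1 h2 h3]; rewrite /pterm !normrM -!mulrA ler_wpM2l// !normrX !exprD -!mulrA.
apply: ler_pM => //; rewrite ?mulr_ge0 ?exprn_ge0//; first by rewrite lerXn2r ?nnegrE// ltW.
by apply: ler_pM => //; rewrite ?exprn_ge0// lerXn2r ?nnegrE// ltW.
Qed.

Lemma psum_le c r q N : 0 <= r -> ball p r q ->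
  `|psum c p q N| <= tsum (fun i j k => `|c i j k| * r ^+ (i + j + k)) N.
Proof.
move=> r0 hq; apply: le_trans (ler_norm_tsum _ _) _.
by apply: ler_tsum => i j k; exact: pterm_le.
Qed.

Lemma An_ge0 r f M : 0 <= r -> An p r f M -> 0 <= M.
Proof.
move=> r0 [c [h _]]; apply: le_trans (h 0%N); apply: tsum_ge0 => i j k.
by rewrite mulr_ge0 ?exprn_ge0.
Qed.

Lemma An_bound r f M q : 0 <= r -> An p r f M -> ball p r q -> `|f q| <= M.
Proof.
move=> r0 [c [h hc]] hq; apply: cvgn_normr_le (hc q hq) _ => N.
exact: le_trans (psum_le _ _ r0 hq) (h N).
Qed.

Lemma An_ext r f g M : (forall q, ball p r q -> f q = g q) -> An p r f M -> An p r g M.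
Proof. by move=> fg [c [h hc]]; exists c; split=> // q hq; rewrite -fg//; exact: hc. Qed.

Lemma An_le r f M M' : M <= M' -> An p r f M -> An p r f M'.
Proof. by move=> MM [c [h hc]]; exists c; split=> // N; exact: le_trans (h N) MM. Qed.

Lemma An_shrink r r' f M : 0 <= r' -> r' <= r -> An p r f M -> An p r' f M.
Proof.
move=> r0 rr [c [h hc]]; exists c; split=> [N|q /(le_ball rr)]; last exact: hc.
apply: le_trans (h N); apply: ler_tsum => i j k; apply: ler_wpM2l => //.
by rewrite lerXn2r ?nnegrE// (le_trans r0).
Qed.

Lemma An_cst r (a : R) : An p r (fun=> a) `|a|.
Proof.
exists (fun i j k => if (i + j + k == 0)%N then a else 0); split=> [N|q hq].
  rewrite tsum_const0 /= ?expr0 ?mulr1// => i j k h.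
  by rewrite ifF ?normr0 ?mul0r//; apply/negbTE; rewrite -lt0n.
rewrite (_ : (fun N => _) = fun=> a); first exact: cvg_cst.
apply/funext => N; rewrite [LHS]tsum_const0 /pterm /= ?expr0 ?mulr1// => i j k h.
by rewrite ifF ?mul0r//; apply/negbTE; rewrite -lt0n.
Qed.

Lemma AnD r f g M M' : 0 <= r -> An p r f M -> An p r g M' ->
  An p r (fun q => f q + g q) (M + M').
Proof.
move=> r0 [c [h hc]] [d [k hd]]; exists (fun i j k => c i j k + d i j k); split=> [N|q hq].
  apply: le_trans (lerD (h N) (k N)); rewrite -tsumD; apply: ler_tsum => i j l.
  by rewrite -mulrDl ler_wpM2r ?exprn_ge0// ler_normD.
rewrite (_ : (fun N => _) = fun N => psum c p q N + psum d p q N).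
  by apply: cvgD; [exact: hc|exact: hd].
apply/funext => N; rewrite /psum -[RHS]tsumD; apply: eq_tsum => i j l.
by rewrite /pterm !mulrDl.
Qed.

Lemma AnZ r f M (a : R) : An p r f M -> An p r (fun q => a * f q) (`|a| * M).
Proof.
move=> [c [h hc]]; exists (fun i j k => a * c i j k); split=> [N|q hq].
  apply: le_trans (ler_wpM2l _ (h N)) => //; rewrite -tsumZ; apply: ler_tsum => i j l.
  by rewrite normrM mulrA.
rewrite (_ : (fun N => _) = fun N => a * psum c p q N).
  by apply: cvgMr; exact: hc.
apply/funext => N; rewrite /psum -[RHS]tsumZ; apply: eq_tsum => i j l.
by rewrite /pterm !mulrA.
Qed.

End AnalyticAlgebra.

Section AnalyticAlgebra2.
Variables (R : realType) (p : (R * R) * R).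
Implicit Types (f g : (R * R) * R -> R) (q : (R * R) * R) (r M : R).

Lemma tsum_shift1 (g : nat -> nat -> nat -> R) N : (forall j k, g 0%N j k = 0) ->
  tsum g N.+1 = tsum (fun i j k => g i.+1 j k) N.
Proof.
move=> g0; rewrite /tsum big_ord_recl big1 ?add0r; last by move=> j _; rewrite big1.
apply: eq_bigr => i _; rewrite big_ord_recr /= [X in _ + X]big_pred0 ?addr0; last first.
  by move=> k; rewrite /bump /=; lia.
apply: eq_bigr => j _; rewrite big_mkcond big_ord_recr /= ifF ?addr0; last by rewrite /bump /=; lia.
by rewrite [RHS]big_mkcond.
Qed.

Lemma tsum_shift2 (g : nat -> nat -> nat -> R) N : (forall i k, g i 0%N k = 0) ->
  tsum g N.+1 = tsum (fun i j k => g i j.+1 k) N.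
Proof.
move=> g0; rewrite /tsum big_ord_recr /= [X in _ + X]big1 ?addr0; last first.
  move=> [[|j] hj] _ /=; first by rewrite big1.
  by rewrite big_pred0// => k; lia.
apply: eq_bigr => i _; rewrite big_ord_recl big1 ?add0r; last by move=> k _; exact: g0.
apply: eq_bigr => j _; rewrite big_mkcond big_ord_recr /= ifF ?addr0; last by rewrite /bump /=; lia.
rewrite [RHS]big_mkcond; apply: eq_bigr => k _; rewrite /bump /=.
by rewrite (_ : (i + (1 + j) + k <= N.+1)%N = (i + j + k <= N)%N)//; lia.
Qed.

Lemma tsum_shift3 (g : nat -> nat -> nat -> R) N : (forall i j, g i j 0%N = 0) ->
  tsum g N.+1 = tsum (fun i j k => g i j k.+1) N.
Proof.
move=> g0; rewrite /tsum big_ord_recr /= [X in _ + X]big1 ?addr0; last first.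
  move=> j _; rewrite big_mkcond big1// => -[[|k] hk] _ /=; first by rewrite g0 if_same.
  by rewrite ifF//; lia.
apply: eq_bigr => i _; rewrite big_ord_recr /= [X in _ + X]big1 ?addr0; last first.
  move=> [[|k] hk] /=; first by rewrite g0.
  by move=> h; exfalso; lia.
apply: eq_bigr => j _; rewrite big_mkcond big_ord_recl /= g0 if_same add0r [RHS]big_mkcond.
apply: eq_bigr => k _; rewrite /bump /=.
by rewrite (_ : (i + j + (1 + k) <= N.+1)%N = (i + j + k <= N)%N)//; lia.
Qed.

Lemma tsum0 (g : nat -> nat -> nat -> R) : tsum g 0%N = g 0%N 0%N 0%N.
Proof. by rewrite /tsum !big_ord1 big_mkcond big_ord1. Qed.

Lemma An_shift (e : 'I_3) r f M : 0 <= r -> An p r f M ->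
  An p r (fun q => (if val e is 0%N then q.1.1 - p.1.1 else
                    if val e is 1%N then q.1.2 - p.1.2 else q.2 - p.2) * f q) (r * M).
Proof.
move=> r0 [c [h hc]].
(* The three variables are treated alike: [c'] is [c] moved by one in direction [e], and any
   termwise expression [F] that vanishes on the coefficient [0] sums over [c'] up to degree [N + 1]
   as it does, shifted, over [c] up to degree [N]. *)
have key (c' : nat -> nat -> nat -> R) (X : (R * R) * R -> R) :
  c' 0%N 0%N 0%N = 0 ->
  (forall (F : nat -> nat -> nat -> R -> R) N, (forall i j k, F i j k 0 = 0) ->
     tsum (fun i j k => F i j k (c' i j k)) N.+1 =
     tsum (fun i j k => F (i + (val e == 0%N))%N (j + (val e == 1%N))%N (k + (1 < val e)%N)%N
                            (c i j k)) N) ->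
  (forall q, X q = if val e is 0%N then q.1.1 - p.1.1 else
                    if val e is 1%N then q.1.2 - p.1.2 else q.2 - p.2) ->
   An p r (fun q => X q * f q) (r * M).
  move=> c0 hF hX; exists c'; split.
    case=> [|N].
      rewrite tsum0 c0 normr0 mul0r mulr_ge0// (An_ge0 (p := p) (f := f) r0)//.
      by exists c.
    rewrite (hF (fun i j k x => `|x| * r ^+ (i + j + k)) N); last first.
      by move=> *; rewrite normr0 mul0r.
    apply: le_trans (ler_wpM2l r0 (h N)); rewrite -tsumZ; apply: ler_tsum => i j k.
    rewrite mulrCA -exprS.
    suff -> : (i + (val e == 0) + (j + (val e == 1)) + (k + (1 < val e)) = (i + j + k).+1)%N by [].
    case: e {hF hX} => -[|[|[|//]]] /= _; lia.
  move=> q hq; rewrite -cvg_shiftS /=.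
  rewrite (_ : (fun N => _) = fun N => X q * psum c p q N); first by apply: cvgMr; exact: hc.
  apply/funext => N; rewrite /psum -[RHS]tsumZ.
  rewrite [LHS](hF (fun i j k x => x * (q.1.1 - p.1.1) ^+ i * (q.1.2 - p.1.2) ^+ j *
     (q.2 - p.2) ^+ k) N); last by move=> *; rewrite !mul0r.
  apply: eq_tsum => i j k; rewrite /pterm hX.
  by case: e {hF hX} => -[|[|[|//]]] /= _; rewrite ?addn0 ?addn1 ?exprS; ring.
case: e key => -[|[|[|//]]] /= _ key.
- apply: (key (fun i j k => if i is i'.+1 then c i' j k else 0)) => // F N F0.
  rewrite tsum_shift1 => [|j k]; last exact: F0.
  by apply: eq_tsum => i j k; rewrite !addn0 addn1.
- apply: (key (fun i j k => if j is j'.+1 then c i j' k else 0)) => // F N F0.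
  rewrite tsum_shift2 => [|j k]; last exact: F0.
  by apply: eq_tsum => i j k; rewrite !addn0 addn1.
- apply: (key (fun i j k => if k is k'.+1 then c i j k' else 0)) => // F N F0.
  rewrite tsum_shift3 => [|j k]; last exact: F0.
  by apply: eq_tsum => i j k; rewrite !addn0 addn1.
Qed.

Lemma An_monom i j k r f M : 0 <= r -> An p r f M ->
  An p r (fun q => (q.1.1 - p.1.1) ^+ i * (q.1.2 - p.1.2) ^+ j * (q.2 - p.2) ^+ k * f q)
     (r ^+ (i + j + k) * M).
Proof.
move=> r0 hf; elim: i => [|i IH].
  elim: j => [|j IH].
    elim: k => [|k IH]; first by under eq_fun do rewrite !expr0 !mul1r; rewrite mul1r.
    have := An_shift (@Ordinal 3 2 isT) r0 IH; rewrite /= mulrA -exprS.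
    by apply: An_ext => q _; rewrite !expr0 exprS; ring.
  have := An_shift (@Ordinal 3 1 isT) r0 IH; rewrite /= mulrA -exprS.
  by apply: An_ext => q _; rewrite !expr0 exprS; ring.
have := An_shift (@Ordinal 3 0 isT) r0 IH; rewrite /= mulrA -exprS.
by apply: An_ext => q _; rewrite exprS; ring.
Qed.

(** The coefficients of [F] are the termwise sums. Exchanging the sum over [n] with the limit in the
    degree rests on a single tail bound, [L] minus a partial sum of [m], which holds at every
    truncation degree and for the values as well. *)
Lemma An_series (f : nat -> (R * R) * R -> R) (m : nat -> R) r (F : (R * R) * R -> R) M :
  0 < r -> (forall n, An p r (f n) (m n)) -> (forall N, \sum_(n < N) m n <= M) ->
  (forall q, ball p r q -> (\sum_(n < N) f n q) @[N --> \oo] --> F q) ->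
  An p r F M.
Proof.
move=> r0 hf hM hF; have r0' := ltW r0.
have [c hc] := choice hf.
have m0 n : 0 <= m n by exact: An_ge0 (hf n).
have cm n i j k : `|c n i j k| <= m n / r ^+ (i + j + k).
  rewrite ler_pdivlMr ?exprn_gt0//; apply: le_trans (proj1 (hc n) (i + j + k)%N).
  apply: (ler_tsum_coef (g := fun i j k => `|c n i j k| * r ^+ (i + j + k))) => // i' j' k'.
  by rewrite mulr_ge0 ?exprn_ge0.
have cvgc i j k : exists l : R, (\sum_(n < N) c n i j k) @[N --> \oo] --> l.
  apply: (@cvgn_bounded_sum _ (fun n => c n i j k) (fun n => m n / r ^+ (i + j + k)) (M / r ^+ (i + j + k))) => // N.
  by rewrite -mulr_suml; apply: ler_wpM2r (hM N); rewrite invr_ge0 exprn_ge0.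
have /choice[d0 hd0] : forall I : nat * nat * nat, exists l : R,
   (\sum_(n < N) c n I.1.1 I.1.2 I.2) @[N --> \oo] --> l by move=> I; exact: cvgc.
pose d i j k := d0 (i, j, k).
have hd i j k : (\sum_(n < N) c n i j k) @[N --> \oo] --> d i j k by exact: (hd0 (i, j, k)).
exists d; split=> [N|q hq].
  apply: (@cvgn_le _ (fun n => tsum (fun i j k => `|\sum_(l < n) c l i j k| * r ^+ (i + j + k)) N)).
    by apply: tsum_cvg => i j k; apply: cvgMl; apply: cvg_norm; exact: hd.
  move=> n; apply: le_trans (hM n).
  apply: (@le_trans _ _ (\sum_(l < n) tsum (fun i j k => `|c l i j k| * r ^+ (i + j + k)) N)).
    rewrite -tsum_sum; apply: ler_tsum => i j k; rewrite -mulr_suml.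
    by rewrite ler_wpM2r ?exprn_ge0// ler_norm_sum.
  by apply: ler_sum => l _; exact: (proj1 (hc l)).
have [L hL] : exists L : R, (\sum_(n < N) m n) @[N --> \oo] --> L.
  by apply: (@cvgn_bounded_sum _ m m M) => // n; rewrite ger0_norm.
have mono a b : (a <= b)%N -> \sum_(n < a) m n <= \sum_(n < b) m n.
  move=> ab; rewrite -(subnKC ab) big_split_ord /= lerDl; exact: sumr_ge0.
have leL n : \sum_(l < n) m l <= L.
  rewrite leNgt; apply/negP => lt.
  move/cvgn_eps: hL => /(_ ((\sum_(l < n) m l - L) / 2)) [|N hN]; first by lra.
  have := hN (N + n)%N (leq_addr _ _); have := mono n (N + n)%N (leq_addl _ _).
  by rewrite ler_norml => ? /andP[? ?]; lra.
have tail (x : nat -> R) y n0 : (forall n, `|x n| <= m n) ->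
    ((\sum_(n < N) x n) @[N --> \oo] --> y) -> `|y - \sum_(l < n0) x l| <= L - \sum_(l < n0) m l.
  move=> xm hx.
  apply: (@cvgn_normr_le _ (fun N => \sum_(n < N + n0) x n - \sum_(l < n0) x l)).
    by apply: cvgB; [rewrite (cvg_shiftn n0 (fun N => \sum_(n < N) x n))|exact: cvg_cst].
  move=> N; rewrite addnC big_split_ord /= addrAC subrr add0r.
  have := leL (n0 + N)%N; rewrite big_split_ord /= => h.
  apply: le_trans (ler_norm_sum _ _ _) _.
  have : \sum_(i < N) `|x (n0 + i)%N| <= \sum_(i < N) m (n0 + i)%N by apply: ler_sum.
  by lra.
apply/cvgn_eps => e e0.
have [n0 hn0] := (proj1 (cvgn_eps _ _) hL) (e / 3) ltac:(lra).
have {}hn0 : L - \sum_(l < n0) m l <= e / 3.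
  by have := hn0 n0 (leqnn _); rewrite ler_norml => /andP[? ?]; lra.
have hfin : (\sum_(l < n0) psum (c l) p q N) @[N --> \oo] --> \sum_(l < n0) f l q.
  by apply: cvgn_sum => l _; exact: (proj2 (hc l)).
have [N hN] := (proj1 (cvgn_eps _ _) hfin) (e / 3) ltac:(lra).
exists N => n Nn; have {hN} := hN n Nn.
have : `|psum d p q n - \sum_(l < n0) psum (c l) p q n| <= L - \sum_(l < n0) m l.
  apply: (tail (fun l => psum (c l) p q n)) => [l|].
    exact: le_trans (psum_le _ _ r0' hq) (proj1 (hc l) n).
  rewrite (_ : (fun N => _) = fun n' => tsum (fun i j k => pterm (fun i j k => \sum_(l < n') c l i j k) p q i j k) n).
    by apply: tsum_cvg => i j k; rewrite /pterm; do 3 apply: cvgMl; exact: hd.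
  apply/funext => n'; rewrite -[LHS](tsum_sum _ (fun l : 'I_n' => pterm (c l) p q)).
  by apply: eq_tsum => i j k; rewrite /pterm -!mulr_suml.
have : `|F q - \sum_(l < n0) f l q| <= L - \sum_(l < n0) m l.
  by apply: (tail (fun l => f l q)) => [l|]; [exact: An_bound (hf l) hq|exact: hF].
by rewrite !ler_norml => /andP[? ?] /andP[? ?] /andP[? ?]; apply/andP; split; lra.
Qed.

End AnalyticAlgebra2.

Section AnalyticProducts.
Variables (R : realType) (p : (R * R) * R).
Implicit Types (f g : (R * R) * R -> R) (q : (R * R) * R) (r M : R).

Lemma An_sum (I : Type) (s : seq I) (P : pred I) (f : I -> (R * R) * R -> R) (m : I -> R) r :
  0 <= r -> (forall i, P i -> An p r (f i) (m i)) ->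
  An p r (fun q => \sum_(i <- s | P i) f i q) (\sum_(i <- s | P i) m i).
Proof.
move=> r0 h; elim: s => [|a s IH].
  rewrite big_nil; apply: (@An_le _ _ _ _ `|0|); first by rewrite normr0.
  apply: An_ext (An_cst p r 0) => q _.
  by rewrite big_nil.
rewrite big_cons; case: ifP => Pa.
  by apply: An_ext (AnD r0 (h _ Pa) IH) => q _; rewrite big_cons Pa.
by apply: An_ext IH => q _; rewrite big_cons Pa.
Qed.

Lemma An_dsum (f : nat -> nat -> nat -> (R * R) * R -> R) m n r : 0 <= r ->
  (forall i j k, An p r (f i j k) (m i j k)) ->
  An p r (fun q => dsum (fun i j k => f i j k q) n) (dsum m n).
Proof.
move=> r0 h.
refine (@An_sum _ _ _ (fun (i : 'I_n.+1) q => \sum_(j < n.+1) \sum_(k < n.+1 | (i + j + k == n)%N) f i j k q) _ r r0 _) => i _.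
refine (@An_sum _ _ _ (fun (j : 'I_n.+1) q => \sum_(k < n.+1 | (i + j + k == n)%N) f i j k q) _ r r0 _) => j _.
by refine (@An_sum _ _ _ (fun (k : 'I_n.+1) q => f i j k q) _ r r0 _) => k _.
Qed.

(** The first factor is expanded into its homogeneous layers, so the product becomes a series of
    monomials times [g], covered by [An_monom] and [An_series]; no Cauchy product of coefficients is
    written down. *)
Lemma An_mul r f g M M' : 0 < r -> An p r f M -> An p r g M' ->
  An p r (fun q => f q * g q) (M * M').
Proof.
move=> r0 [c [h hc]] hg; have r0' := ltW r0.
pose m n := dsum (fun i j k => `|c i j k| * r ^+ (i + j + k)) n * M'.
apply: (An_series (f := fun n q => dsum (pterm c p q) n * g q) (m := m)) => //.
- move=> n; pose F i j k q := pterm c p q i j k * g q.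
  have hF i j k : An p r (F i j k) (`|c i j k| * r ^+ (i + j + k) * M').
    by rewrite -mulrA; apply: An_ext (AnZ (c i j k) (An_monom i j k r0' hg)) => q _; rewrite /F /pterm; ring.
  have := An_dsum n r0' hF; congr An.
    by apply/funext => q; rewrite /dsum !mulr_suml; apply: eq_bigr => i _; rewrite mulr_suml;
       apply: eq_bigr => j _; rewrite mulr_suml.
  by rewrite /m /dsum !mulr_suml; apply: eq_bigr => i _; rewrite mulr_suml;
     apply: eq_bigr => j _; rewrite mulr_suml.
- case=> [|N]; first by rewrite big_ord0 mulr_ge0 ?(An_ge0 r0' hg)// (An_ge0 (p := p) (f := f) r0')//; exists c.
  by rewrite -mulr_suml -tsum_dsum ler_wpM2r// (An_ge0 r0' hg).
- move=> q hq; rewrite -cvg_shiftS /=.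
  rewrite (_ : (fun n => _) = fun N => psum c p q N * g q); first by apply: cvgMl; exact: hc.
  by apply/funext => N; rewrite -mulr_suml -tsum_dsum.
Qed.

Definition AnAt f := exists2 r, 0 < r & exists M, An p r f M.

Lemma An_AnAt r f M : 0 < r -> An p r f M -> AnAt f.
Proof. by move=> r0 h; exists r => //; exists M. Qed.

(** Shrinking the radius by a factor [t] multiplies each weighted coefficient of positive degree by
    at most [t], while the constant coefficient is [f p]. This supplies the small norms on which
    inversion, square roots and the recursions below depend. *)
Lemma AnAt_norm f e : AnAt f -> 0 < e ->
  exists2 r0, 0 < r0 & forall r, 0 <= r -> r <= r0 -> An p r f (`|f p| + e).
Proof.
move=> [r0 r00 [M [c [h hc]]]] e0; have r0' := ltW r00.
have M0 : 0 <= M by apply: (An_ge0 (p := p) (f := f) r0'); exists c.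
have fp : f p = c 0%N 0%N 0%N.
  apply: cvgn_unique (hc p (ballxx p r00)) _.
  rewrite (_ : (fun N => _) = fun=> c 0%N 0%N 0%N); first exact: cvg_cst.
  apply/funext => N; rewrite [LHS]tsum_const0 /pterm ?subrr ?expr0 ?mulr1//.
  case=> [|i] [|j] [|k]//= _; rewrite ?expr0n /= ?mulr0 ?mul0r ?mulr1//.
pose t := Num.min 1 (e / (M + 1)).
have t0 : 0 < t by rewrite /t lt_min ltr01 divr_gt0//; lra.
have t1 : t <= 1 by rewrite /t ge_min lexx.
have te : t * M <= e.
  have : t * (M + 1) <= e.
    rewrite -ler_pdivlMr; last by lra.
    by rewrite /t ge_min lexx orbT.
  by rewrite mulrDr mulr1; lra.
exists (t * r0); first by rewrite mulr_gt0.
move=> r rge rle; have r0r : r <= r0 by apply: le_trans rle _; rewrite ler_piMl.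
exists c; split=> [N|q /(le_ball r0r)]; last exact: hc.
rewrite fp.
have -> : tsum (fun i j k => `|c i j k| * r ^+ (i + j + k)) N =
   `|c 0%N 0%N 0%N| + tsum (fun i j k => if (i + j + k == 0)%N then 0 else `|c i j k| * r ^+ (i + j + k)) N.
  rewrite -[X in X + _](tsum_const0 (g := fun i j k => if (i + j + k == 0)%N then `|c i j k| else 0) N).
    rewrite -tsumD; apply: eq_tsum => i j k; case: eqP => [h0|_]; last by rewrite add0r.
    by rewrite h0 expr0 mulr1 addr0.
  by move=> i j k hi; rewrite ifF//; apply/negbTE; rewrite -lt0n.
rewrite lerD2l; apply: le_trans te; apply: le_trans (ler_wpM2l (ltW t0) (h N)).
rewrite -tsumZ; apply: ler_tsum => i j k; case: eqP => [_|/eqP h0].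
  by rewrite !mulr_ge0 ?exprn_ge0// ltW.
rewrite mulrCA ler_wpM2l//; apply: (@le_trans _ _ ((t * r0) ^+ (i + j + k))).
  by apply: lerXn2r rle; rewrite nnegrE// mulr_ge0// ltW.
rewrite exprMn ler_wpM2r ?exprn_ge0//; case: (i + j + k)%N h0 => // n _.
by rewrite exprS ler_piMr ?exprn_ile1// ltW.
Qed.

Lemma AnAt_ext f g : (exists2 r, 0 < r & forall q, ball p r q -> f q = g q) ->
  AnAt f -> AnAt g.
Proof.
move=> [r r0 h] [r' r'0 [M hf]]; have m0 : 0 < Num.min r r' by rewrite lt_min r0.
exists (Num.min r r') => //; exists M; apply: (@An_ext _ _ _ f) => [q hq|].
  by apply: h; apply: le_ball hq; rewrite ge_min lexx.
by apply: An_shrink hf; rewrite ?(ltW m0)// ge_min lexx orbT.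
Qed.

Lemma AnAt_cst (a : R) : AnAt (fun=> a).
Proof. by exists 1 => //; exists `|a|; exact: An_cst. Qed.

Lemma AnAt_coord (e : 'I_3) :
  AnAt (fun q => if val e is 0%N then q.1.1 else if val e is 1%N then q.1.2 else q.2).
Proof.
exists 1 => //; pose x (q : (R * R) * R) := if val e is 0%N then q.1.1 else if val e is 1%N then q.1.2 else q.2.
have := AnD ler01 (An_shift e ler01 (An_cst p 1 1)) (An_cst p 1 (x p)).
exists (1 * `|1| + `|x p|); apply: An_ext H => q _; rewrite /x mulr1.
by case: e {x} => -[|[|[|//]]] /= _; rewrite subrK.
Qed.

Lemma AnAtD f g : AnAt f -> AnAt g -> AnAt (fun q => f q + g q).
Proof.
move=> [r r0 [M hf]] [r' r'0 [M' hg]].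
have m0 : 0 < Num.min r r' by rewrite lt_min r0.
exists (Num.min r r') => //; exists (M + M'); apply: AnD; rewrite ?ltW//.
  by apply: An_shrink hf; rewrite ?(ltW m0)// ge_min lexx.
by apply: An_shrink hg; rewrite ?(ltW m0)// ge_min lexx orbT.
Qed.

Lemma AnAtM f g : AnAt f -> AnAt g -> AnAt (fun q => f q * g q).
Proof.
move=> [r r0 [M hf]] [r' r'0 [M' hg]].
have m0 : 0 < Num.min r r' by rewrite lt_min r0.
exists (Num.min r r') => //; exists (M * M'); apply: An_mul => //.
  by apply: An_shrink hf; rewrite ?(ltW m0)// ge_min lexx.
by apply: An_shrink hg; rewrite ?(ltW m0)// ge_min lexx orbT.
Qed.

Lemma AnAtN f : AnAt f -> AnAt (fun q => - f q).
Proof.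
move=> hf; apply: AnAt_ext (AnAtM (AnAt_cst (-1)) hf).
by exists 1 => // q _; rewrite mulN1r.
Qed.

Lemma AnAtB f g : AnAt f -> AnAt g -> AnAt (fun q => f q - g q).
Proof. by move=> hf hg; exact: AnAtD hf (AnAtN hg). Qed.

Lemma An_exp r f M n : 0 < r -> An p r f M -> An p r (fun q => f q ^+ n) (M ^+ n).
Proof.
move=> r0 hf; elim: n => [|n IH]; first by rewrite expr0 -(@normr1 R); exact: An_cst.
by rewrite exprS; apply: An_ext (An_mul r0 hf IH) => q _; rewrite exprS.
Qed.

Lemma geom_sum_le (x : R) N : 0 <= x < 1 -> \sum_(n < N) x ^+ n <= (1 - x)^-1.
Proof.
move=> /andP[x0 x1]; have := subrX1 x N => e.
rewrite -[leRHS]mul1r ler_pdivlMr; last by lra.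
have : 0 <= x ^+ N by exact: exprn_ge0.
by nra.
Qed.

Lemma geom_cvg0 (x : R) : `|x| < 1 -> x ^+ n @[n --> \oo] --> (0 : R).
Proof. exact: cvg_expr. Qed.

(** Neumann series in [g = 1 - f / f p], which vanishes at [p] and so has norm at most [1/2] on a
    small box. *)
Lemma AnAtV f : AnAt f -> f p != 0 -> AnAt (fun q => (f q)^-1).
Proof.
move=> hf fp0; pose g q := 1 + - (f p)^-1 * f q.
have hg : AnAt g by apply: AnAtD; [exact: AnAt_cst|apply: AnAtM => //; exact: AnAt_cst].
have gp : g p = 0 by rewrite /g mulNr mulVf// subrr.
have [r r0 hr] := AnAt_norm hg (ltac:(lra) : 0 < 1 / 2 :> R).
have {}hr := hr r (ltW r0) (lexx _); rewrite gp normr0 add0r in hr.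
have h1 : An p r (fun q => (1 - g q)^-1) 2.
  apply: (An_series (f := fun n q => g q ^+ n) (m := fun n => (1 / 2) ^+ n)) => //.
  - by move=> n; exact: An_exp.
  - move=> N; apply: le_trans (geom_sum_le _ _) _; first by lra.
    by rewrite le_eqVlt; apply/orP; left; apply/eqP; field.
  - move=> q hq; have gq := An_bound (ltW r0) hr hq.
    have g1 : 1 - g q != 0.
      by move: gq; rewrite ler_norml => /andP[_ ?]; apply/eqP => ?; lra.
    rewrite (_ : (fun N => _) = fun N => (1 - g q ^+ N) / (1 - g q)); last first.
      apply/funext => N; apply: (mulIf g1); rewrite divfK//.
      by rewrite -[1 - g q ^+ N]opprB subrX1; ring.
    rewrite -[X in _ --> X]mul1r; apply: cvgMl; rewrite -[X in _ --> X]subr0.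
    apply: cvgB; first exact: cvg_cst.
    by apply: geom_cvg0; apply: le_lt_trans gq _; lra.
apply: (@AnAt_ext (fun q => (f p)^-1 * (1 - g q)^-1)).
  exists r => // q hq; rewrite /g mulNr opprD opprK addrA subrr add0r invfM invrK mulrA.
  by rewrite mulVf// mul1r.
by apply: AnAtM; [exact: AnAt_cst|exact: An_AnAt h1].
Qed.

(* sqrt (1 + g) = 1 + y where y is the fixed point of y |-> (g - y ^ 2) / 2,
   a contraction in the weighted l1 norm as soon as g is small. *)
Lemma AnAt_sqrt f : AnAt f -> 0 < f p -> AnAt (fun q => Num.sqrt (f q)).
Proof.
move=> hf fp0; pose g q := (f p)^-1 * f q - 1.
have hg : AnAt g by apply: AnAtB; [apply: AnAtM => //|]; exact: AnAt_cst.
have gp : g p = 0 by rewrite /g mulVf ?gt_eqF// subrr.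
have [r r0 hr] := AnAt_norm hg (ltac:(lra) : 0 < 1 / 4 :> R).
have {}hr := hr r (ltW r0) (lexx _); rewrite gp normr0 add0r in hr.
pose y := fix y (n : nat) q : R := if n is n'.+1 then (g q - y n' q ^+ 2) / 2 else 0.
(* The ball of radius [1/4] is stable because [(1/4 + 1/16) / 2 <= 1/4], and successive differences
   shrink by [(1/4 + 1/4) / 2 = 1/4]. *)
have hy n : An p r (y n) (1 / 4).
  elim: n => [|n IH].
    apply: (@An_le _ _ _ _ `|0 : R|); first by rewrite normr0; lra.
    exact: (An_cst p r 0).
  apply: (@An_le _ _ _ _ (`|1 / 2| * (1 / 4 + `|-1| * (1 / 4 * (1 / 4))))).
    by rewrite normrN normr1 ger0_norm; lra.
  apply: An_ext (AnZ (1 / 2) (AnD (ltW r0) hr (AnZ (-1) (An_mul r0 IH IH)))) => q _ /=.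
  by field.
have he n : An p r (fun q => y n.+1 q - y n q) ((1 / 4) ^+ n).
  elim: n => [|n IH].
    rewrite expr0; apply: (@An_le _ _ _ _ (1 / 4)); first by lra.
    by apply: An_ext (hy 1%N) => q _; rewrite /= subr0.
  apply: (@An_le _ _ _ _ (`|- (1 / 2)| * ((1 / 4) ^+ n * (1 / 4 + 1 / 4)))).
    rewrite normrN ger0_norm; last lra.
    have h4 : 0 <= (1 / 4 : R) ^+ n by apply: exprn_ge0; lra.
    by rewrite exprS; lra.
  apply: An_ext (AnZ (- (1 / 2)) (An_mul r0 IH (AnD (ltW r0) (hy n.+1) (hy n)))) => q _ /=.
  by field.
have tel N q : \sum_(n < N) (y n.+1 q - y n q) = y N q.
  elim: N => [|N IH]; first by rewrite big_ord0.
  by rewrite big_ord_recr /= IH addrC subrK.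
have summ N : \sum_(n < N) (1 / 4 : R) ^+ n <= 2.
  apply: le_trans (geom_sum_le _ _) _; first by lra.
  rewrite -[leRHS]invrK lef_pV2 ?posrE; lra.
have /choice[Y0 hY0] : forall q, exists l : R, ball p r q -> (y n q) @[n --> \oo] --> l.
  move=> q; have [hq|hq] := pselect (ball p r q); last by exists 0 => /hq.
  have [l hl] := @cvgn_bounded_sum _ (fun n => y n.+1 q - y n q) (fun n => (1 / 4) ^+ n) 2
    (fun n => An_bound (ltW r0) (he n) hq) summ.
  exists l => _; rewrite (_ : (fun n => y n q) = fun N => \sum_(n < N) (y n.+1 q - y n q))//.
  by apply/funext => N; rewrite tel.
have hY : An p r Y0 2.
  apply: (An_series (f := fun n q => y n.+1 q - y n q)) he summ _ => // q hq.
  under eq_fun do rewrite tel; exact: hY0.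
have fixY q : ball p r q -> Y0 q = (g q - Y0 q ^+ 2) / 2.
  move=> hq; apply: (@cvgn_unique _ (fun n => y n.+1 q)).
    by rewrite (cvg_shiftS (fun n => y n q)); exact: hY0.
  rewrite /=; apply: cvgMl; apply: cvgB; first exact: cvg_cst.
  by under eq_fun do rewrite expr2; rewrite expr2; apply: cvgM; exact: hY0.
have Yle q : ball p r q -> `|Y0 q| <= 1 / 4.
  move=> hq; apply: cvgn_normr_le (hY0 q hq) _ => n; exact: An_bound (ltW r0) (hy n) hq.
apply: (@AnAt_ext (fun q => Num.sqrt (f p) * (1 + Y0 q))); last first.
  apply: AnAtM; first exact: AnAt_cst.
  apply: AnAtD; [exact: AnAt_cst|exact: An_AnAt hY].
(* The bound [1/4] on [Y0] selects the nonnegative root. *)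
exists r => // q hq; have Y1 : 0 <= 1 + Y0 q.
  by have := Yle q hq; rewrite ler_norml => /andP[? ?]; lra.
rewrite -[1 + Y0 q]ger0_norm// -sqrtr_sqr -sqrtrM ?ltW//; congr Num.sqrt.
have -> : (1 + Y0 q) ^+ 2 = 1 + g q by move: (fixY q hq) => h'; lra.
by rewrite /g; field; rewrite gt_eqF.
Qed.

End AnalyticProducts.

(** * Complex-valued analytic functions *)

Notation Rez := complex.Re.
Notation Imz := complex.Im.

Section ComplexBasics.
Variable R : realType.
Implicit Types (z w : R[i]) (x : R).

Lemma RezD z w : Rez (z + w) = Rez z + Rez w. Proof. by case: z w => [a b] [c d]. Qed.
Lemma ImzD z w : Imz (z + w) = Imz z + Imz w. Proof. by case: z w => [a b] [c d]. Qed.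
Lemma RezN z : Rez (- z) = - Rez z. Proof. by case: z. Qed.
Lemma ImzN z : Imz (- z) = - Imz z. Proof. by case: z. Qed.
Lemma RezM z w : Rez (z * w) = Rez z * Rez w - Imz z * Imz w.
Proof. by case: z w => [a b] [c d]. Qed.
Lemma ImzM z w : Imz (z * w) = Rez z * Imz w + Imz z * Rez w.
Proof. by case: z w => [a b] [c d]. Qed.
Lemma RezJ z : Rez (conjc z) = Rez z. Proof. by case: z. Qed.
Lemma ImzJ z : Imz (conjc z) = - Imz z. Proof. by case: z. Qed.
Lemma RezV z : Rez z^-1 = Rez z / (Rez z ^+ 2 + Imz z ^+ 2). Proof. by case: z. Qed.
Lemma ImzV z : Imz z^-1 = - (Imz z / (Rez z ^+ 2 + Imz z ^+ 2)). Proof. by case: z. Qed.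
Lemma complex_eqP z w : Rez z = Rez w -> Imz z = Imz w -> z = w.
Proof. by case: z w => [a b] [c d] /= -> ->. Qed.

Lemma Rez_sum (I : Type) (s : seq I) (P : pred I) (f : I -> R[i]) :
  Rez (\sum_(i <- s | P i) f i) = \sum_(i <- s | P i) Rez (f i).
Proof. by elim/big_rec2: _ => // i y x _ <-; rewrite RezD. Qed.
Lemma Imz_sum (I : Type) (s : seq I) (P : pred I) (f : I -> R[i]) :
  Imz (\sum_(i <- s | P i) f i) = \sum_(i <- s | P i) Imz (f i).
Proof. by elim/big_rec2: _ => // i y x _ <-; rewrite ImzD. Qed.

(** The l1 norm fits the separate treatment of real and imaginary parts and is real valued and
    submultiplicative; the price is the factor [2] in [N1V]. *)
Definition N1 z : R := `|Rez z| + `|Imz z|.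

Lemma N1_ge0 z : 0 <= N1 z. Proof. exact: addr_ge0. Qed.
Lemma N1_0 : N1 0 = 0. Proof. by rewrite /N1 /= normr0 addr0. Qed.
Lemma N1_real x : N1 x%:C = `|x|. Proof. by rewrite /N1 /= normr0 addr0. Qed.
Lemma N1_1 : N1 1 = 1. Proof. by rewrite N1_real normr1. Qed.
Lemma N1N z : N1 (- z) = N1 z. Proof. by rewrite /N1 RezN ImzN !normrN. Qed.
Lemma N1_eq0 z : N1 z = 0 -> z = 0.
Proof.
move=> /eqP; rewrite paddr_eq0// !normr_eq0 => /andP[/eqP h /eqP h'].
by apply: complex_eqP; rewrite ?h ?h'.
Qed.
Lemma N1D z w : N1 (z + w) <= N1 z + N1 w.
Proof.
rewrite /N1 RezD ImzD addrACA; apply: lerD; exact: ler_normD.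
Qed.
Lemma N1B z w : N1 (z - w) <= N1 z + N1 w.
Proof. by rewrite -[N1 w]N1N; exact: N1D. Qed.
Lemma N1_distC z w : N1 (z - w) = N1 (w - z). Proof. by rewrite -N1N opprB. Qed.
Lemma N1M z w : N1 (z * w) <= N1 z * N1 w.
Proof.
rewrite /N1 RezM ImzM; apply: le_trans (lerD (ler_normB _ _) (ler_normD _ _)) _.
by rewrite !normrM; lra.
Qed.
Lemma N1X z n : N1 (z ^+ n) <= N1 z ^+ n.
Proof.
elim: n => [|n IH]; first by rewrite !expr0 N1_1.
by rewrite !exprS; apply: le_trans (N1M _ _) _; rewrite ler_wpM2l ?N1_ge0.
Qed.
Lemma N1_sum (I : Type) (s : seq I) (P : pred I) (f : I -> R[i]) :
  N1 (\sum_(i <- s | P i) f i) <= \sum_(i <- s | P i) N1 (f i).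
Proof.
elim/big_rec2: _ => [|i y x _ h]; first by rewrite N1_0.
by apply: le_trans (N1D _ _) _; rewrite lerD2l.
Qed.
Lemma N1_gt0 z : z != 0 -> 0 < N1 z.
Proof.
move=> z0; rewrite lt_neqAle N1_ge0 andbT eq_sym.
by apply: contraNneq z0 => /N1_eq0 ->.
Qed.
Lemma Rez_le z : `|Rez z| <= N1 z. Proof. by rewrite lerDl. Qed.
Lemma Imz_le z : `|Imz z| <= N1 z. Proof. by rewrite lerDr. Qed.
Lemma N1V z : z != 0 -> N1 z^-1 <= 2 / N1 z.
Proof.
move=> z0; have N0 := N1_gt0 z0.
rewrite ler_pdivlMr// /N1 RezV ImzV normrN !normrM.
set a := Rez z; set b := Imz z.
have d0 : 0 < a ^+ 2 + b ^+ 2.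
  rewrite lt_neqAle addr_ge0 ?sqr_ge0// andbT eq_sym paddr_eq0 ?sqr_ge0// !sqrf_eq0.
  by apply: contra z0 => /andP[/eqP h /eqP h']; apply/eqP/complex_eqP.
rewrite normfV (ger0_norm (ltW d0)) -mulrDl mulrAC ler_pdivrMr//.
rewrite -[a ^+ 2]real_normK ?num_real// -[b ^+ 2]real_normK ?num_real//.
by have := sqr_ge0 (`|a| - `|b|); nra.
Qed.

Definition ccvg (u : nat -> R[i]) (l : R[i]) :=
  (Rez (u n) @[n --> \oo] --> (Rez l : R)) /\ (Imz (u n) @[n --> \oo] --> (Imz l : R)).

Lemma ccvg_unique u l l' : ccvg u l -> ccvg u l' -> l = l'.
Proof. by move=> [a b] [c d]; apply: complex_eqP; [exact: cvgn_unique a c|exact: cvgn_unique b d]. Qed.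

Lemma ccvg_cst l : ccvg (fun=> l) l. Proof. by split; exact: cvg_cst. Qed.

Lemma ccvgD u v l l' : ccvg u l -> ccvg v l' -> ccvg (fun n => u n + v n) (l + l').
Proof.
move=> [a b] [c d]; split; rewrite ?RezD ?ImzD.
  by under eq_fun do rewrite RezD; exact: cvgD.
by under eq_fun do rewrite ImzD; exact: cvgD.
Qed.

Lemma ccvgM u v l l' : ccvg u l -> ccvg v l' -> ccvg (fun n => u n * v n) (l * l').
Proof.
move=> [a b] [c d]; split; rewrite ?RezM ?ImzM.
  by under eq_fun do rewrite RezM; apply: cvgB; apply: cvgM.
by under eq_fun do rewrite ImzM; apply: cvgD; apply: cvgM.
Qed.

Lemma ccvg_N1_le u l M : ccvg u l -> (forall n, N1 (u n) <= M) -> N1 l <= M.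
Proof.
move=> [a b] h; apply: cvgn_le h; apply: cvgD; exact: cvg_norm.
Qed.

Lemma ccvg_bounded_sum (a : nat -> R[i]) (m : nat -> R) (M : R) :
  (forall n, N1 (a n) <= m n) -> (forall N, \sum_(n < N) m n <= M) ->
  exists l, ccvg (fun N => \sum_(n < N) a n) l.
Proof.
move=> am hM.
have [l hl] := @cvgn_bounded_sum _ (fun n => Rez (a n)) m M
  (fun n => le_trans (Rez_le _) (am n)) hM.
have [l' hl'] := @cvgn_bounded_sum _ (fun n => Imz (a n)) m M
  (fun n => le_trans (Imz_le _) (am n)) hM.
exists (l +i* l'); split => /=.
  by under eq_fun do rewrite Rez_sum.
by under eq_fun do rewrite Imz_sum.
Qed.

Lemma ccvg_shiftS u l : ccvg (fun n => u n.+1) l <-> ccvg u l.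
Proof.
split=> -[a b]; split.
- by rewrite -(cvg_shiftS (fun n => Rez (u n))).
- by rewrite -(cvg_shiftS (fun n => Imz (u n))).
- by rewrite (cvg_shiftS (fun n => Rez (u n))).
- by rewrite (cvg_shiftS (fun n => Imz (u n))).
Qed.

Lemma ccvg_ext u v l : (forall n, u n = v n) -> ccvg u l -> ccvg v l.
Proof. by move=> h; rewrite (_ : u = v)//; apply/funext. Qed.

End ComplexBasics.

Section AnalyticComplex.
Variables (R : realType) (p : (R * R) * R).
Implicit Types (f g : (R * R) * R -> R[i]) (q : (R * R) * R) (r M : R).

(** Adding the bounds of the two parts mirrors [N1], so that bounds still multiply in [AnCM]. *)
Definition AnC r f M := exists M1 M2,
  [/\ An p r (fun q => Rez (f q)) M1, An p r (fun q => Imz (f q)) M2 & M1 + M2 <= M].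

Lemma AnC_ext r f g M : (forall q, ball p r q -> f q = g q) -> AnC r f M -> AnC r g M.
Proof.
move=> fg [M1 [M2 [h1 h2 le]]]; exists M1, M2; split=> //.
  by apply: An_ext h1 => q hq; rewrite fg.
by apply: An_ext h2 => q hq; rewrite fg.
Qed.

Lemma AnC_le r f M M' : M <= M' -> AnC r f M -> AnC r f M'.
Proof. by move=> MM [M1 [M2 [h1 h2 le]]]; exists M1, M2; split=> //; exact: le_trans le MM. Qed.

Lemma AnC_bound r f M q : 0 <= r -> AnC r f M -> ball p r q -> N1 (f q) <= M.
Proof.
move=> r0 [M1 [M2 [h1 h2 le]]] hq; apply: le_trans le; apply: lerD.
  exact: (An_bound r0 h1 hq).
exact: (An_bound r0 h2 hq).
Qed.

Lemma AnC_ge0 r f M : 0 <= r -> AnC r f M -> 0 <= M.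
Proof.
move=> r0 [M1 [M2 [h1 h2 le]]]; apply: le_trans le.
by rewrite addr_ge0 ?(An_ge0 r0 h1) ?(An_ge0 r0 h2).
Qed.

Lemma AnC_cst r (a : R[i]) : AnC r (fun=> a) (N1 a).
Proof. by exists `|Rez a|, `|Imz a|; split=> //; exact: An_cst. Qed.

Lemma AnCD r f g M M' : 0 <= r -> AnC r f M -> AnC r g M' -> AnC r (fun q => f q + g q) (M + M').
Proof.
move=> r0 [M1 [M2 [h1 h2 le]]] [M3 [M4 [h3 h4 le']]]; exists (M1 + M3), (M2 + M4); split.
- by apply: An_ext (AnD r0 h1 h3) => q _; rewrite RezD.
- by apply: An_ext (AnD r0 h2 h4) => q _; rewrite ImzD.
- by lra.
Qed.

Lemma AnCM r f g M M' : 0 < r -> AnC r f M -> AnC r g M' -> AnC r (fun q => f q * g q) (M * M').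
Proof.
move=> r0 [M1 [M2 [h1 h2 le]]] [M3 [M4 [h3 h4 le']]]; have r0' := ltW r0.
have [p1 p2 p3 p4] := (And4 (An_ge0 r0' h1) (An_ge0 r0' h2) (An_ge0 r0' h3) (An_ge0 r0' h4)).
exists (M1 * M3 + `|-1| * (M2 * M4)), (M1 * M4 + M2 * M3); split.
- by apply: An_ext (AnD r0' (An_mul r0 h1 h3) (AnZ (-1) (An_mul r0 h2 h4))) => q _; rewrite RezM mulN1r.
- by apply: An_ext (AnD r0' (An_mul r0 h1 h4) (An_mul r0 h2 h3)) => q _; rewrite ImzM.
- rewrite normrN normr1 mul1r; apply: (@le_trans _ _ ((M1 + M2) * (M3 + M4))); first by lra.
  by apply: ler_pM => //; exact: addr_ge0.
Qed.

Lemma AnC_sum (I : Type) (s : seq I) (P : pred I) (f : I -> (R * R) * R -> R[i]) (m : I -> R) r :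
  0 <= r -> (forall i, P i -> AnC r (f i) (m i)) ->
  AnC r (fun q => \sum_(i <- s | P i) f i q) (\sum_(i <- s | P i) m i).
Proof.
move=> r0 h; elim: s => [|a s IH].
  rewrite big_nil; apply: (@AnC_le _ _ (N1 0)); first by rewrite N1_0.
  by apply: AnC_ext (AnC_cst r 0) => q _; rewrite big_nil.
rewrite big_cons; case: ifP => Pa.
  by apply: AnC_ext (AnCD r0 (h _ Pa) IH) => q _; rewrite big_cons Pa.
by apply: AnC_ext IH => q _; rewrite big_cons Pa.
Qed.

Lemma AnC_series (f : nat -> (R * R) * R -> R[i]) (m : nat -> R) r (F : (R * R) * R -> R[i]) M :
  0 < r -> (forall n, AnC r (f n) (m n)) -> (forall N, \sum_(n < N) m n <= M) ->
  (forall q, ball p r q -> ccvg (fun N => \sum_(n < N) f n q) (F q)) ->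
  AnC r F M.
Proof.
move=> r0 /choice[m1 /choice[m2 hm]] hM hF; have r0' := ltW r0.
have m1p n : 0 <= m1 n by case: (hm n) => h _ _; exact: An_ge0 h.
have m2p n : 0 <= m2 n by case: (hm n) => _ h _; exact: An_ge0 h.
have hM12 N : \sum_(n < N) m1 n + \sum_(n < N) m2 n <= M.
  apply: le_trans (hM N); rewrite -big_split; apply: ler_sum => n _.
  by case: (hm n).
have le1 N N' : \sum_(n < N) m1 n + \sum_(n < N') m2 n <= M.
  apply: le_trans (hM12 (N + N')%N); apply: lerD; last rewrite addnC;
    rewrite big_split_ord /= lerDl; exact: sumr_ge0.
have [L1 hL1] : exists L : R, (\sum_(n < N) m1 n) @[N --> \oo] --> L.
  apply: (@cvgn_bounded_sum _ m1 m1 M) => [n|N]; first by rewrite ger0_norm.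
  by have := le1 N 0%N; rewrite big_ord0 addr0.
have le2 N' : L1 + \sum_(n < N') m2 n <= M.
  rewrite -lerBrDr; apply: cvgn_le hL1 _ => N; rewrite lerBrDr; exact: le1.
have leL1 N : \sum_(n < N) m1 n <= L1.
  rewrite -subr_ge0; apply: (@closed_cvg _ _ \oo _ (fun n => \sum_(l < n + N) m1 l - \sum_(l < N) m1 l) [set x | 0 <= x]).
  - exact: closed_ge.
  - by near=> n; rewrite /= addnC big_split_ord /= addrC addrK sumr_ge0.
  - by apply: cvgB; [rewrite (cvg_shiftn N (fun N => \sum_(n < N) m1 n))|exact: cvg_cst].
(* Only the sum of the two bounds is controlled by [M]: the real part takes its exact total [L1] and
   the imaginary part whatever remains. *)
exists L1, (M - L1); split; last by rewrite addrC subrK.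
- apply: (An_series (f := fun n q => Rez (f n q)) (m := m1)) => // [n|q hq].
    by case: (hm n).
  by have [h _] := hF q hq; move: h; under eq_fun do rewrite Rez_sum.
- apply: (An_series (f := fun n q => Imz (f n q)) (m := m2)) => // [n|N|q hq].
  + by case: (hm n).
  + by have := le2 N; lra.
  by have [_ h] := hF q hq; move: h; under eq_fun do rewrite Imz_sum.
Unshelve. all: by end_near.
Qed.

Lemma AnCX r f M n : 0 < r -> AnC r f M -> AnC r (fun q => f q ^+ n) (M ^+ n).
Proof.
move=> r0 hf; elim: n => [|n IH]; first by rewrite expr0 -(@N1_1 R); exact: AnC_cst.
by rewrite exprS; apply: AnC_ext (AnCM r0 hf IH) => q _; rewrite exprS.
Qed.

Definition AnCAt f := AnAt p (fun q => Rez (f q)) /\ AnAt p (fun q => Imz (f q)).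

Lemma AnC_AnCAt r f M : 0 < r -> AnC r f M -> AnCAt f.
Proof. by move=> r0 [M1 [M2 [h1 h2 _]]]; split; [exact: An_AnAt h1|exact: An_AnAt h2]. Qed.

Lemma AnCAt_norm f e : AnCAt f -> 0 < e ->
  exists2 r0, 0 < r0 & forall r, 0 <= r -> r <= r0 -> AnC r f (N1 (f p) + e).
Proof.
move=> [h1 h2] e0.
have [r1 r10 hr1] := AnAt_norm h1 (ltac:(lra) : 0 < e / 2).
have [r2 r20 hr2] := AnAt_norm h2 (ltac:(lra) : 0 < e / 2).
exists (Num.min r1 r2); first by rewrite lt_min r10.
move=> r r0; rewrite le_min => /andP[a b].
exists (`|Rez (f p)| + e / 2), (`|Imz (f p)| + e / 2); split; [exact: hr1|exact: hr2|].
by rewrite /N1; lra.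
Qed.

Lemma AnCAt_ext f g : (exists2 r, 0 < r & forall q, ball p r q -> f q = g q) -> AnCAt f -> AnCAt g.
Proof.
move=> [r r0 h] [h1 h2]; split; [apply: AnAt_ext h1|apply: AnAt_ext h2]; exists r => // q hq;
  by rewrite h.
Qed.

Lemma AnCAt_cst a : AnCAt (fun=> a). Proof. by split; exact: AnAt_cst. Qed.

Lemma AnCAt_real (f : (R * R) * R -> R) : AnAt p f -> AnCAt (fun q => (f q)%:C).
Proof. by move=> h; split=> //; exact: AnAt_cst. Qed.

Lemma AnCAtD f g : AnCAt f -> AnCAt g -> AnCAt (fun q => f q + g q).
Proof.
move=> [a b] [c d]; split.
  by under eq_fun do rewrite RezD; exact: AnAtD.
by under eq_fun do rewrite ImzD; exact: AnAtD.
Qed.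

Lemma AnCAtM f g : AnCAt f -> AnCAt g -> AnCAt (fun q => f q * g q).
Proof.
move=> [a b] [c d]; split.
  by under eq_fun do rewrite RezM; apply: AnAtB; exact: AnAtM.
by under eq_fun do rewrite ImzM; apply: AnAtD; exact: AnAtM.
Qed.

Lemma AnCAtN f : AnCAt f -> AnCAt (fun q => - f q).
Proof.
move=> [a b]; split.
  by under eq_fun do rewrite RezN; exact: AnAtN.
by under eq_fun do rewrite ImzN; exact: AnAtN.
Qed.

Lemma AnCAtB f g : AnCAt f -> AnCAt g -> AnCAt (fun q => f q - g q).
Proof. by move=> hf hg; exact: AnCAtD hf (AnCAtN hg). Qed.

Lemma AnCAtJ f : AnCAt f -> AnCAt (fun q => conjc (f q)).
Proof.
move=> [a b]; split.
  by under eq_fun do rewrite RezJ.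
by under eq_fun do rewrite ImzJ; exact: AnAtN.
Qed.

Lemma AnCAt_sum (I : Type) (s : seq I) (P : pred I) (f : I -> (R * R) * R -> R[i]) :
  (forall i, P i -> AnCAt (f i)) -> AnCAt (fun q => \sum_(i <- s | P i) f i q).
Proof.
move=> h; elim: s => [|a s IH].
  by apply: AnCAt_ext (AnCAt_cst _); exists 1 => // q _; rewrite big_nil.
case Pa: (P a); last first.
  by apply: AnCAt_ext IH; exists 1 => // q _; rewrite big_cons Pa.
apply: AnCAt_ext (AnCAtD (h _ Pa) IH); exists 1 => // q _; by rewrite big_cons Pa.
Qed.

Lemma AnCAt_prod (I : Type) (s : seq I) (P : pred I) (f : I -> (R * R) * R -> R[i]) :
  (forall i, P i -> AnCAt (f i)) -> AnCAt (fun q => \prod_(i <- s | P i) f i q).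
Proof.
move=> h; elim: s => [|a s IH].
  by apply: AnCAt_ext (AnCAt_cst _); exists 1 => // q _; rewrite big_nil.
case Pa: (P a); last first.
  by apply: AnCAt_ext IH; exists 1 => // q _; rewrite big_cons Pa.
apply: AnCAt_ext (AnCAtM (h _ Pa) IH); exists 1 => // q _; by rewrite big_cons Pa.
Qed.

End AnalyticComplex.

(** * Derivatives along curves *)

Section RealDerivatives.
Variable R : realType.
Implicit Types (f g : R -> R) (t : R).

Lemma is_derive_eps f t l : is_derive t 1 f l <->
  (forall e, 0 < e -> exists2 d, 0 < d &
     forall h, h != 0 -> `|h| < d -> `|(f (t + h) - f t) / h - l| <= e).
Proof.
have E : (fun h : R => h^-1 *: ((f \o shift t) (h *: (1 : R)) - f t)) =
   (fun h : R => (f (t + h) - f t) / h).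
  by apply/funext => h; rewrite /= [h *: _]mulr1 [h + t]addrC /GRing.scale/= mulrC.
split=> [[dv val]|h].
  have hc : (f (t + h) - f t) / h @[h --> (0 : R)^'] --> l.
    by move: dv; rewrite /derivable E => dv; rewrite -val /derive E; exact: dv.
  move=> e e0; move/cvgrPdist_le: hc => /(_ e e0); rewrite near_withinE => /nbhs_ballP[d /= d0 hd].
  exists d => // h h0 hhd; rewrite distrC; apply: hd => //.
  by rewrite /ball /= sub0r normrN.
have hc : (f (t + h) - f t) / h @[h --> (0 : R)^'] --> l.
  apply/cvgrPdist_le => e e0; have [d d0 hd] := h e e0.
  rewrite near_withinE; apply/nbhs_ballP; exists d => //= x; rewrite /ball /= sub0r normrN => xd x0.
  by rewrite distrC; exact: hd.
apply: DeriveDef; last by rewrite /derive E; exact: cvg_lim.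
by rewrite /derivable E; apply/cvg_ex; exists l.
Qed.

Lemma is_derive_unique f t l l' : is_derive t 1 f l -> is_derive t 1 f l' -> l = l'.
Proof. by case=> _ <- [_ <-]. Qed.

Lemma is_derive_near f g t l : (exists2 d, 0 < d & forall s, `|s - t| < d -> f s = g s) ->
  is_derive t 1 f l -> is_derive t 1 g l.
Proof.
move=> [d d0 fg] /is_derive_eps h; apply/is_derive_eps => e e0; have [d' d'0 hd'] := h e e0.
exists (Num.min d d') => [|s s0]; first by rewrite lt_min d0.
rewrite lt_min => /andP[sd sd']; rewrite -!fg ?subrr ?normr0//; first exact: hd'.
by rewrite addrC addKr.
Qed.

Lemma is_derive_squeeze f g t : (exists2 d, 0 < d & forall s, `|s - t| < d -> `|f s| <= g s) ->
  g t = 0 -> is_derive t 1 g 0 -> is_derive t 1 f 0.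
Proof.
move=> [d d0 fg] gt0 /is_derive_eps h; apply/is_derive_eps => e e0; have [d' d'0 hd'] := h e e0.
have ft0 : f t = 0.
  by apply/eqP; rewrite -normr_le0 -gt0; apply: fg; rewrite subrr normr0.
exists (Num.min d d') => [|s s0]; first by rewrite lt_min d0.
rewrite lt_min => /andP[sd sd']; have := hd' s s0 sd'; rewrite gt0 ft0 !subr0 !normrM.
apply: le_trans; apply: ler_wpM2r => //; apply: le_trans (ler_norm _).
by apply: fg; rewrite addrC addKr.
Qed.

Lemma is_derive_continuous f t l : is_derive t 1 f l -> {for t, continuous f}.
Proof. by case=> /derivable1_diffP dv _; exact: differentiable_continuous. Qed.

Lemma is_derive_eps_cont f t l : is_derive t 1 f l ->
  forall e, 0 < e -> exists2 d, 0 < d & forall s, `|s - t| < d -> `|f s - f t| <= e.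
Proof.
move=> /is_derive_continuous /cvgrPdist_le h e e0; have := h e e0.
move=> /nbhs_ballP[d /= d0 hd]; exists d => // s st; rewrite distrC; apply: hd.
by rewrite /ball /= distrC.
Qed.

Lemma is_derive_MVT f df (a b : R) : a <= b ->
  (forall x, a <= x <= b -> is_derive x 1 f (df x)) ->
  exists2 c, a <= c <= b & f b - f a = df c * (b - a).
Proof.
move=> ab h.
have h1 x : x \in `]a, b[%R -> is_derive x 1 f (df x).
  by rewrite in_itv /= => /andP[xa xb]; apply: h; rewrite !ltW.
have h2 : {within `[a, b], continuous f}.
  apply: continuous_in_subspaceT => x /set_mem /=; rewrite in_itv /= => xab.
  by apply: is_derive_continuous (h x xab).
have [c cab e] := MVT_segment ab h1 h2.
by exists c => //; move: cab; rewrite in_itv.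
Qed.

End RealDerivatives.

Section ComplexCurves.
Variable R : realType.
Implicit Types (f g : R -> R[i]) (t : R) (l : R[i]).

Definition cder f t l :=
  is_derive t 1 (fun s => Rez (f s)) (Rez l) /\ is_derive t 1 (fun s => Imz (f s)) (Imz l).

Lemma cder_eq f t l l' : cder f t l -> l = l' -> cder f t l'. Proof. by move=> h <-. Qed.

Lemma cder_unique f t l l' : cder f t l -> cder f t l' -> l = l'.
Proof.
by move=> [a b] [c d]; apply: complex_eqP; [exact: is_derive_unique a c|exact: is_derive_unique b d].
Qed.

Lemma cder_near f g t l : (exists2 d, 0 < d & forall s, `|s - t| < d -> f s = g s) ->
  cder f t l -> cder g t l.
Proof.
move=> [d d0 h] [a b]; split; [apply: is_derive_near a|apply: is_derive_near b];
  by exists d => // s hs; rewrite h.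
Qed.

Lemma cder_ext f g t l : (forall s, f s = g s) -> cder f t l -> cder g t l.
Proof. by move=> h; rewrite (_ : f = g)//; apply/funext. Qed.

Lemma cder_cst (a : R[i]) t : cder (fun=> a) t 0.
Proof. by split; exact: is_derive_cst. Qed.

Lemma cderD f g t l l' : cder f t l -> cder g t l' -> cder (fun s => f s + g s) t (l + l').
Proof.
move=> [a b] [c d]; split; rewrite ?RezD ?ImzD.
  by under eq_fun do rewrite RezD; exact: is_deriveD.
by under eq_fun do rewrite ImzD; exact: is_deriveD.
Qed.

Lemma cderN f t l : cder f t l -> cder (fun s => - f s) t (- l).
Proof.
move=> [a b]; split; rewrite ?RezN ?ImzN.
  by under eq_fun do rewrite RezN; exact: is_deriveN.
by under eq_fun do rewrite ImzN; exact: is_deriveN.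
Qed.

Lemma cderB f g t l l' : cder f t l -> cder g t l' -> cder (fun s => f s - g s) t (l - l').
Proof. by move=> a b; apply: cderD => //; exact: cderN. Qed.

Lemma cderJ f t l : cder f t l -> cder (fun s => conjc (f s)) t (conjc l).
Proof.
move=> [a b]; split; rewrite ?RezJ ?ImzJ.
  by under eq_fun do rewrite RezJ.
by under eq_fun do rewrite ImzJ; exact: is_deriveN.
Qed.

Lemma cder_real (u : R -> R) t (x : R) : is_derive t 1 u x -> cder (fun s => (u s)%:C) t x%:C.
Proof. by move=> h; split=> //=; exact: is_derive_cst. Qed.

Lemma is_deriveM_mul (u v : R -> R) t (x y : R) : is_derive t 1 u x -> is_derive t 1 v y ->
  is_derive t 1 (fun s => u s * v s) (x * v t + u t * y).
Proof.
move=> h h'; have := is_deriveM h h'; rewrite /GRing.scale /= => H.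
by apply: is_derive_eq H _; rewrite addrC; congr (_ + _); rewrite mulrC.
Qed.

Lemma cderM f g t l l' : cder f t l -> cder g t l' ->
  cder (fun s => f s * g s) t (l * g t + f t * l').
Proof.
move=> [a b] [c d]; split.
  under eq_fun do rewrite RezM.
  apply: is_derive_eq (is_deriveB (is_deriveM_mul a c) (is_deriveM_mul b d)) _.
  by rewrite RezD !RezM; ring.
under eq_fun do rewrite ImzM.
apply: is_derive_eq (is_deriveD (is_deriveM_mul a d) (is_deriveM_mul b c)) _.
by rewrite ImzD !ImzM; ring.
Qed.

Lemma cderZ (a : R[i]) f t l : cder f t l -> cder (fun s => a * f s) t (a * l).
Proof. by move=> h; apply: cder_eq (cderM (cder_cst a t) h) _; rewrite mul0r add0r. Qed.

Lemma cder_sum (I : Type) (s : seq I) (f : I -> R -> R[i]) (l : I -> R[i]) t :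
  (forall i, cder (f i) t (l i)) ->
  cder (fun x => \sum_(i <- s) f i x) t (\sum_(i <- s) l i).
Proof.
move=> h; elim: s => [|a s IH].
  by rewrite big_nil; apply: cder_ext (cder_cst 0 t) => x; rewrite big_nil.
by rewrite big_cons; apply: cder_ext (cderD (h a) IH) => x; rewrite big_cons.
Qed.

Lemma cder_line (z v : R[i]) t : cder (fun s => z + s%:C * v) t v.
Proof.
apply: cder_eq (cderD (cder_cst z t) (cderM (cder_real (is_derive_id t 1)) (cder_cst v t))) _.
by rewrite mulr0 addr0 add0r mul1r.
Qed.

Lemma cder_cont f t l e : cder f t l -> 0 < e ->
  exists2 d, 0 < d & forall s, `|s - t| < d -> N1 (f s - f t) < e.
Proof.
move=> [a b] e0.
have [d1 d10 h1] := is_derive_eps_cont a (ltac:(lra) : 0 < e / 3).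
have [d2 d20 h2] := is_derive_eps_cont b (ltac:(lra) : 0 < e / 3).
exists (Num.min d1 d2) => [|s]; first by rewrite lt_min d10.
rewrite lt_min => /andP[s1 s2]; rewrite /N1 RezD ImzD RezN ImzN.
by have := h1 s s1; have := h2 s s2; lra.
Qed.

Lemma cder0_cst f : (forall t, 0 <= t <= 1 -> cder f t 0) -> f 1 = f 0.
Proof.
move=> h; apply: complex_eqP; apply/eqP; rewrite -subr_eq0; apply/eqP.
  have [c _ ->] := @is_derive_MVT _ (fun s => Rez (f s)) (fun=> 0) 0 1 ler01 (fun x hx => proj1 (h x hx)).
  by rewrite mul0r.
have [c _ ->] := @is_derive_MVT _ (fun s => Imz (f s)) (fun=> 0) 0 1 ler01 (fun x hx => proj2 (h x hx)).
by rewrite mul0r.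
Qed.

(** Complex differentiability with a quadratic remainder. Power series and inversion provide it
    directly, and it yields the chain rule along real curves, because the remainder is squeezed by a
    quadratic expression in the coordinates. *)
Definition Qder (F : R[i] -> R[i]) (z L : R[i]) :=
  exists K e, [/\ 0 < e, 0 <= K & forall s, N1 s < e -> N1 (F (z + s) - F z - s * L) <= K * N1 s ^+ 2].

Lemma cder_comp (F : R[i] -> R[i]) (c : R -> R[i]) t L l :
  Qder F (c t) L -> cder c t l -> cder (fun s => F (c s)) t (l * L).
Proof.
move=> [K [e [e0 K0 hF]]] hc.
have [d d0 hd] := cder_cont hc e0.
pose E s := F (c s) - F (c t) - (c s - c t) * L.
pose q s := 2 * K * ((Rez (c s) - Rez (c t)) ^+ 2 + (Imz (c s) - Imz (c t)) ^+ 2).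
have Eq s : `|s - t| < d -> N1 (E s) <= q s.
  move=> /hd hs; have := hF (c s - c t) hs; rewrite [c t + _]addrC subrK => h; apply: le_trans h _.
  rewrite /q /N1 RezD ImzD RezN ImzN.
  set a := Rez _ - _; set b := Imz _ - _.
  have h1 : (`|a| + `|b|) ^+ 2 <= 2 * (a ^+ 2 + b ^+ 2).
    rewrite -[a ^+ 2]real_normK ?num_real// -[b ^+ 2]real_normK ?num_real//.
    by have := sqr_ge0 (`|a| - `|b|); nra.
  by apply: le_trans (ler_wpM2l K0 h1) _; rewrite mulrA [K * 2]mulrC.
have q0 : is_derive t 1 q 0.
  have [a b] := hc.
  have sq (u : R -> R) du : is_derive t 1 u du -> is_derive t 1 (fun s => (u s - u t) ^+ 2) 0.
    move=> hu; have hu' := is_deriveB hu (is_derive_cst (u t) t (1 : R)).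
    have H := is_deriveM_mul hu' hu'.
    have : is_derive t 1 (fun s => (u s - u t) * (u s - u t)) 0.
      by apply: is_derive_eq H _; rewrite /cst /= !fctE subrr mulr0 mul0r addr0.
    by congr is_derive.
  have H := is_deriveZ (2 * K) (is_deriveD (sq _ _ a) (sq _ _ b)).
  apply: is_derive_eq H _; by rewrite addr0 scaler0.
have qt : q t = 0 by rewrite /q !subrr expr0n /= addr0 mulr0.
have hE : cder E t 0.
  split; apply: (is_derive_squeeze (g := q)) => //; exists d => // s hs; apply: le_trans (Eq s hs).
    exact: Rez_le.
  exact: Imz_le.
have := cderD hE (cderD (cder_cst (F (c t)) t) (cderM (cderB hc (cder_cst (c t) t)) (cder_cst L t))).
rewrite mulr0 addr0 subr0 !add0r; apply: cder_ext => s; rewrite /E; ring.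
Qed.

End ComplexCurves.

Section MatrixCurves.
Variable R : realType.

Definition mder (m n : nat) (M : R -> 'M[R[i]]_(m, n)) (t : R) (L : 'M[R[i]]_(m, n)) :=
  forall i j, cder (fun s => M s i j) t (L i j).

Lemma mder_eq m n (M : R -> 'M[R[i]]_(m, n)) t L L' : mder M t L -> L = L' -> mder M t L'.
Proof. by move=> h <-. Qed.

Lemma mder_ext m n (M N : R -> 'M[R[i]]_(m, n)) t L : (forall s, M s = N s) -> mder M t L -> mder N t L.
Proof. by move=> h hM i j; apply: cder_ext (hM i j) => s; rewrite h. Qed.

Lemma mder_near m n (M N : R -> 'M[R[i]]_(m, n)) t L :
  (exists2 d, 0 < d & forall s, `|s - t| < d -> M s = N s) -> mder M t L -> mder N t L.
Proof. by move=> [d d0 h] hM i j; apply: cder_near (hM i j); exists d => // s hs; rewrite h. Qed.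

Lemma mder_cst m n (A : 'M[R[i]]_(m, n)) t : mder (fun=> A) t 0.
Proof. by move=> i j; rewrite mxE; exact: cder_cst. Qed.

Lemma mderM m n k (M : R -> 'M[R[i]]_(m, n)) (N : R -> 'M[R[i]]_(n, k)) t L L' :
  mder M t L -> mder N t L' -> mder (fun s => M s *m N s) t (L *m N t + M t *m L').
Proof.
move=> h h' i j; rewrite !mxE -big_split.
apply: cder_ext (cder_sum (index_enum _) (fun l => cderM (h i l) (h' l j))) => s.
by rewrite mxE.
Qed.

Lemma mder_ctr m n (M : R -> 'M[R[i]]_(m, n)) t L : mder M t L -> mder (fun s => ctr (M s)) t (ctr L).
Proof. by move=> h i j; rewrite !mxE; apply: cder_ext (cderJ (h j i)) => s; rewrite !mxE. Qed.

Lemma mder_tr m n (M : R -> 'M[R[i]]_(m, n)) t L : mder M t L -> mder (fun s => (M s)^T) t L^T.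
Proof. by move=> h i j; rewrite !mxE; apply: cder_ext (h j i) => s; rewrite !mxE. Qed.

Lemma mderZ m n (f : R -> R[i]) (M : R -> 'M[R[i]]_(m, n)) t l L : cder f t l -> mder M t L ->
  mder (fun s => f s *: M s) t (l *: M t + f t *: L).
Proof.
by move=> h hM i j; rewrite !mxE; apply: cder_ext (cderM h (hM i j)) => s; rewrite mxE.
Qed.

Lemma mder0_cst m n (M : R -> 'M[R[i]]_(m, n)) : (forall t, 0 <= t <= 1 -> mder M t 0) -> M 1 = M 0.
Proof.
move=> h; apply/matrixP => i j; apply: (@cder0_cst _ (fun s => M s i j)) => t ht.
by have := h t ht i j; rewrite mxE.
Qed.

Lemma ctrM m n k (A : 'M[R[i]]_(m, n)) (B : 'M[R[i]]_(n, k)) : ctr (A *m B) = ctr B *m ctr A.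
Proof. by rewrite /ctr map_mxM trmx_mul. Qed.

Lemma ctrK m n (A : 'M[R[i]]_(m, n)) : ctr (ctr A) = A.
Proof. by apply/matrixP => i j; rewrite !mxE conjcK. Qed.

Lemma ctrD m n (A B : 'M[R[i]]_(m, n)) : ctr (A + B) = ctr A + ctr B.
Proof. by apply/matrixP => i j; rewrite !mxE rmorphD. Qed.

Lemma ctrN m n (A : 'M[R[i]]_(m, n)) : ctr (- A) = - ctr A.
Proof. by apply/matrixP => i j; rewrite !mxE rmorphN. Qed.

Lemma ctrZ m n (a : R[i]) (A : 'M[R[i]]_(m, n)) : ctr (a *: A) = conjc a *: ctr A.
Proof. by apply/matrixP => i j; rewrite !mxE rmorphM. Qed.

Lemma ctr1 n : ctr (1%:M : 'M[R[i]]_n) = 1%:M.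
Proof. by rewrite /ctr map_mx1 trmx1. Qed.

End MatrixCurves.

Lemma eq_ler (R : realType) (x y : R) : x = y -> x <= y. Proof. by move->. Qed.

(** * Complex power series and their derivatives *)

Section PowerSeries.
Variable R : realType.
Implicit Types (c : nat -> R[i]) (z : R[i]).

(** A total limit with default value [0]; it is evaluated only through [climE], hence under
    convergence. *)
Definition clim (u : nat -> R[i]) : R[i] := xget 0 [set l | ccvg u l].

Lemma climE u l : ccvg u l -> clim u = l.
Proof. by move=> h; rewrite /clim; case: xgetP => [x _ /= hx|/(_ l)//]; exact: ccvg_unique hx h. Qed.

Definition PS c z := clim (fun N => \sum_(k < N) c k * z ^+ k).

Lemma geom_le2 (x : R) N : 0 <= x <= 1 / 2 -> \sum_(n < N) x ^+ n <= 2.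
Proof.
move=> /andP[x0 x1]; apply: le_trans (geom_sum_le _ _) _; first by lra.
by rewrite -[leRHS]invrK lef_pV2 ?posrE; lra.
Qed.

Lemma geom_le2w (x w : R) N : 0 <= x <= 1 / 2 -> 0 <= w -> \sum_(n < N) w * x ^+ n <= 2 * w.
Proof. by move=> hx w0; rewrite -mulr_sumr mulrC ler_wpM2r// geom_le2. Qed.

Lemma PS_term_le c (w K : R) z k : (forall k, N1 (c k) <= w * K ^+ k) -> N1 (c k * z ^+ k) <= w * (K * N1 z) ^+ k.
Proof.
move=> h; apply: le_trans (N1M _ _) _; rewrite exprMn mulrA.
by apply: ler_pM; rewrite ?N1_ge0//; exact: N1X.
Qed.

Lemma PS_cvg c (w K : R) z : 0 <= w -> 0 <= K -> (forall k, N1 (c k) <= w * K ^+ k) ->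
  K * N1 z <= 1 / 2 -> ccvg (fun N => \sum_(k < N) c k * z ^+ k) (PS c z).
Proof.
move=> w0 K0 h hz.
have [|l hl] := @ccvg_bounded_sum _ (fun k => c k * z ^+ k) (fun k => w * (K * N1 z) ^+ k) (2 * w)
    (fun k => PS_term_le z k h).
  by move=> N; apply: geom_le2w => //; rewrite mulr_ge0 ?N1_ge0.
by rewrite /PS (climE hl).
Qed.

Lemma PS0 c : PS c 0 = c 0%N.
Proof.
apply: climE; apply/ccvg_shiftS; apply: ccvg_ext (ccvg_cst _) => N.
by rewrite big_ord_recl expr0 mulr1 big1 ?addr0// => i _; rewrite expr0n /= mulr0.
Qed.

Definition dcoef c (k : nat) := (k.+1)%:R * c k.+1.

Lemma N1_nat n : N1 (n%:R : R[i]) = n%:R.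
Proof. by rewrite -[n%:R in LHS](rmorph_nat (real_complex R)) N1_real ger0_norm. Qed.

(** The factor [k + 1] is absorbed by [2 ^ k], at the cost of doubling the growth rate. *)
Lemma dcoef_le c (w K : R) k : 0 <= w -> 0 <= K -> (forall k, N1 (c k) <= w * K ^+ k) ->
  N1 (dcoef c k) <= w * K * (2 * K) ^+ k.
Proof.
move=> w0 K0 h; apply: le_trans (N1M _ _) _; rewrite N1_nat exprMn.
have -> : w * K * (2 ^+ k * K ^+ k) = 2 ^+ k * (w * K ^+ k.+1) by rewrite exprS; ring.
apply: ler_pM; rewrite ?N1_ge0//.
by rewrite -natrX ler_nat; elim: k {h} => // k IH; rewrite expnS; lia.
Qed.

(** Both sides carry an extra [r] to avoid a negative power at [k = 0]. The crude [2 ^ k.+1]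
    replaces the binomial coefficient; the radius [(4 * K)^-1] in [PS_Qder] pays for it. *)
Lemma pow_taylor (z s : R[i]) (r : R) k : 0 < r -> N1 z <= r -> N1 (z + s) <= r ->
  N1 ((z + s) ^+ k.+1 - z ^+ k.+1 - k.+1%:R * z ^+ k * s) * r <= 2 ^+ k.+1 * r ^+ k * N1 s ^+ 2.
Proof.
move=> r0 hz hzs.
elim: k => [|k IH].
  have -> : (z + s) ^+ 1 - z ^+ 1 - 1%:R * z ^+ 0 * s = 0 by rewrite !expr1 expr0; ring.
  by rewrite N1_0 mul0r expr0 mulr1 mulr_ge0 ?sqr_ge0.
have -> : (z + s) ^+ k.+2 - z ^+ k.+2 - k.+2%:R * z ^+ k.+1 * s =
  (z + s) * ((z + s) ^+ k.+1 - z ^+ k.+1 - k.+1%:R * z ^+ k * s) + (k.+1%:R * z ^+ k * s) * s.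
  by rewrite -[k.+2%:R]natr1 [_ ^+ k.+2]exprS [z ^+ k.+2]exprS [z ^+ k.+1]exprS; ring.
set E := (z + s) ^+ k.+1 - _ - _ in IH *.
have hE := IH.
have h1 : N1 ((z + s) * E) * r <= r * (2 ^+ k.+1 * r ^+ k * N1 s ^+ 2).
  apply: le_trans (ler_wpM2r (ltW r0) (N1M _ _)) _; rewrite -(mulrA (N1 _)).
  by apply: ler_pM => //; [exact: N1_ge0|rewrite mulr_ge0 ?N1_ge0// ltW].
have h2 : N1 (k.+1%:R * z ^+ k * s * s) * r <= 2 ^+ k.+1 * r ^+ k.+1 * N1 s ^+ 2.
  have : N1 (k.+1%:R * z ^+ k * s * s) <= 2 ^+ k.+1 * r ^+ k * N1 s ^+ 2.
    rewrite -mulrA; apply: le_trans (N1M _ _) _; apply: ler_pM; rewrite ?N1_ge0//; last first.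
      by rewrite expr2; exact: N1M.
    apply: le_trans (N1M _ _) _; apply: ler_pM; rewrite ?N1_ge0//.
      rewrite N1_nat -natrX ler_nat; elim: k {IH E hE h1} => // k IH; rewrite expnS; lia.
    apply: le_trans (N1X _ _) _; apply: lerXn2r; rewrite ?nnegrE ?N1_ge0//; exact: ltW.
  by move=> /(ler_wpM2r (ltW r0)) /le_trans; apply; apply/eq_ler; rewrite !exprS; ring.
apply: le_trans (ler_wpM2r (ltW r0) (N1D _ _)) _; rewrite mulrDl.
apply: le_trans (lerD h1 h2) _; apply/eq_ler; rewrite !exprS; ring.
Qed.

Lemma PS_Qder c (w K : R) z : 0 <= w -> 0 < K -> (forall k, N1 (c k) <= w * K ^+ k) ->
  4 * K * N1 z < 1 -> Qder (PS c) z (PS (dcoef c) z).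
Proof.
move=> w0 K0 h hz; have K0' := ltW K0.
pose r := (4 * K)^-1; have r0 : 0 < r by rewrite invr_gt0; lra.
have rK : 4 * K * r = 1 by rewrite mulfV// gt_eqF//; lra.
have zr : N1 z < r by rewrite -[r]mul1r ltr_pdivlMr; lra.
exists (2 * w / r ^+ 2), (r - N1 z); split.
- by lra.
- by rewrite divr_ge0 ?exprn_ge0// ?(ltW r0)//; lra.
move=> s hs; have zsr : N1 (z + s) <= r by apply: le_trans (N1D _ _) _; lra.
have small x : N1 x <= r -> K * N1 x <= 1 / 2.
  by move=> hx; have := ler_wpM2l K0' hx; lra.
have c1 := PS_cvg w0 K0' h (small _ zsr).
have c2 := PS_cvg w0 K0' h (small _ (ltW zr)).
have c3 : ccvg (fun N => \sum_(k < N) dcoef c k * z ^+ k) (PS (dcoef c) z).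
  apply: (@PS_cvg _ (w * K) (2 * K)) => [||k|]; rewrite ?mulr_ge0//; first exact: dcoef_le.
  by have := ler_wpM2l K0' (ltW zr); lra.
move: c1 => /(ccvg_shiftS _ _).2 c1; move: c2 => /(ccvg_shiftS _ _).2 c2.
have := ccvgD (ccvgD c1 (ccvgM (ccvg_cst (-1)) c2)) (ccvgM (ccvg_cst (- s)) c3).
rewrite !mulN1r mulNr => hl; apply: ccvg_N1_le hl _ => N.
rewrite mulN1r mulNr mulr_sumr !big_ord_recl !expr0 !mulr1 opprD addrACA subrr add0r.
rewrite -!sumrB.
apply: le_trans (N1_sum _ _ _) _.
apply: (@le_trans _ _ (\sum_(k < N) (w / r ^+ 2 * N1 s ^+ 2) * (1 / 2) ^+ k)); last first.
  apply: le_trans (geom_le2w _ _ _) _; first by lra.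
    by rewrite mulr_ge0 ?sqr_ge0// divr_ge0 ?sqr_ge0.
  by apply/eq_ler; ring.
apply: ler_sum => k _; rewrite /bump /= ?add1n.
have -> : c k.+1 * (z + s) ^+ k.+1 - c k.+1 * z ^+ k.+1 - s * (dcoef c k * z ^+ k) =
   c k.+1 * ((z + s) ^+ k.+1 - z ^+ k.+1 - k.+1%:R * z ^+ k * s) by rewrite /dcoef; ring.
apply: le_trans (N1M _ _) _.
have := pow_taylor k r0 (ltW zr) zsr; rewrite -ler_pdivlMr// => hT.
apply: (@le_trans _ _ (w * K ^+ k.+1 * (2 ^+ k.+1 * r ^+ k * N1 s ^+ 2 / r))).
  by apply: ler_pM; rewrite ?N1_ge0.
have -> : w * K ^+ k.+1 * (2 ^+ k.+1 * r ^+ k * N1 s ^+ 2 / r) =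
   w / r ^+ 2 * N1 s ^+ 2 * (2 * K * r) ^+ k.+1.
  by rewrite !exprMn [r ^+ k.+1]exprS; field; rewrite gt_eqF.
rewrite (_ : 2 * K * r = 1 / 2); last by lra.
apply: ler_wpM2l; first by rewrite mulr_ge0 ?sqr_ge0// divr_ge0 ?sqr_ge0.
by rewrite exprS ler_piMl ?exprn_ge0//; lra.
Qed.

End PowerSeries.

(** * Entrywise norms and analytic families of matrices *)

Section MatrixNorm.
Variable R : realType.

Definition nm m n (A : 'M[R[i]]_(m, n)) : R := \sum_i \sum_j N1 (A i j).

Lemma nm_ge0 m n (A : 'M[R[i]]_(m, n)) : 0 <= nm A.
Proof. by do 2 (apply: sumr_ge0 => ? _); exact: N1_ge0. Qed.

Lemma N1_nm m n (A : 'M[R[i]]_(m, n)) i j : N1 (A i j) <= nm A.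
Proof.
rewrite /nm (bigD1 i)//= (bigD1 j)//= -addrA lerDl addr_ge0//.
  by apply: sumr_ge0 => ? _; exact: N1_ge0.
by do 2 (apply: sumr_ge0 => ? _); exact: N1_ge0.
Qed.

Variable p : (R * R) * R.

Definition AnM r m n (A : (R * R) * R -> 'M[R[i]]_(m, n)) (b : R) :=
  exists M : 'I_m -> 'I_n -> R, (forall i j, AnC p r (fun q => A q i j) (M i j)) /\
    \sum_i \sum_j M i j <= b.

Lemma AnM_ext r m n (A B : (R * R) * R -> 'M[R[i]]_(m, n)) b :
  (forall q, A q = B q) -> AnM r A b -> AnM r B b.
Proof. by move=> h; rewrite (_ : A = B)//; apply/funext. Qed.

Lemma AnM_le r m n (A : (R * R) * R -> 'M[R[i]]_(m, n)) b b' : b <= b' -> AnM r A b -> AnM r A b'.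
Proof. by move=> bb [M [h le]]; exists M; split=> //; exact: le_trans le bb. Qed.

Lemma AnM_entry r m n (A : (R * R) * R -> 'M[R[i]]_(m, n)) b i j : 0 <= r -> AnM r A b ->
  AnC p r (fun q => A q i j) b.
Proof.
move=> r0 [M [h le]]; apply: AnC_le (h i j); apply: le_trans le.
have M0 i' j' : 0 <= M i' j' by exact: AnC_ge0 (h i' j').
rewrite (bigD1 i)//= (bigD1 j)//= -addrA lerDl addr_ge0//.
  by apply: sumr_ge0.
by do 2 (apply: sumr_ge0 => ? _).
Qed.

Lemma AnM_bound r m n (A : (R * R) * R -> 'M[R[i]]_(m, n)) b q : 0 <= r -> AnM r A b ->
  ball p r q -> nm (A q) <= b.
Proof.
move=> r0 [M [h le]] hq; apply: le_trans le; do 2 (apply: ler_sum => ? _).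
exact: (AnC_bound r0 (h _ _) hq).
Qed.

Lemma AnM_cst r m n (A : 'M[R[i]]_(m, n)) : AnM r (fun=> A) (nm A).
Proof. by exists (fun i j => N1 (A i j)); split=> // i j; exact: AnC_cst. Qed.

Lemma AnMD r m n (A B : (R * R) * R -> 'M[R[i]]_(m, n)) b b' : 0 <= r -> AnM r A b -> AnM r B b' ->
  AnM r (fun q => A q + B q) (b + b').
Proof.
move=> r0 [M [h le]] [N [k le']]; exists (fun i j => M i j + N i j); split.
  by move=> i j; apply: AnC_ext (AnCD r0 (h i j) (k i j)) => q _; rewrite mxE.
apply: le_trans (lerD le le'); rewrite -big_split; apply: ler_sum => i _.
by rewrite -big_split.
Qed.

Lemma AnMZ r m n (f : (R * R) * R -> R[i]) (A : (R * R) * R -> 'M[R[i]]_(m, n)) b b' : 0 < r ->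
  AnC p r f b -> AnM r A b' -> AnM r (fun q => f q *: A q) (b * b').
Proof.
move=> r0 hf [M [h le]]; exists (fun i j => b * M i j); split.
  by move=> i j; apply: AnC_ext (AnCM r0 hf (h i j)) => q _; rewrite mxE.
apply: le_trans (ler_wpM2l (AnC_ge0 (ltW r0) hf) le).
by rewrite mulr_sumr; apply: ler_sum => i _; rewrite mulr_sumr.
Qed.

Lemma AnMM r m n k (A : (R * R) * R -> 'M[R[i]]_(m, n)) (B : (R * R) * R -> 'M[R[i]]_(n, k)) b b' :
  0 < r -> AnM r A b -> AnM r B b' -> AnM r (fun q => A q *m B q) (b * b').
Proof.
move=> r0 [M [h le]] [N [h' le']]; have r0' := ltW r0.
have M0 i j : 0 <= M i j by exact: AnC_ge0 (h i j).
have N0 i j : 0 <= N i j by exact: AnC_ge0 (h' i j).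
exists (fun i j => \sum_l M i l * N l j); split.
  move=> i j; apply: AnC_ext (AnC_sum (index_enum _) r0' (fun l _ => AnCM r0 (h i l) (h' l j))) => q _.
  by rewrite mxE.
apply: (@le_trans _ _ ((\sum_i (\sum_l M i l)) * (\sum_l (\sum_j N l j)))); last first.
  by apply: ler_pM => //; do 2 (apply: sumr_ge0 => ? _).
rewrite mulr_suml; apply: ler_sum => i _; rewrite exchange_big /= mulr_suml; apply: ler_sum => l _.
rewrite -mulr_sumr ler_wpM2l// [leRHS](bigD1 l)//= lerDl.
by do 2 (apply: sumr_ge0 => ? _).
Qed.

Lemma AnM_sum r m n (I : Type) (s : seq I) (A : I -> (R * R) * R -> 'M[R[i]]_(m, n)) (b : I -> R) :
  0 <= r -> (forall i, AnM r (A i) (b i)) ->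
  AnM r (fun q => \sum_(i <- s) A i q) (\sum_(i <- s) b i).
Proof.
move=> r0 h; elim: s => [|a s IH].
  rewrite big_nil; apply: (@AnM_le _ _ _ _ (nm (0 : 'M[R[i]]_(m, n)))).
    by rewrite /nm; do 2 (rewrite big1// => ? _); rewrite mxE N1_0.
  by apply: AnM_ext (AnM_cst _ _) => q; rewrite big_nil.
by rewrite big_cons; apply: AnM_ext (AnMD r0 (h a) IH) => q; rewrite big_cons.
Qed.

Lemma nm_scalar2 (a : R[i]) : nm (a%:M : 'M[R[i]]_2) = 2 * N1 a.
Proof. by rewrite /nm !big_ord_recl !big_ord0 !mxE /= N1_0; ring. Qed.

End MatrixNorm.

(** * Local solutions of the Fuchsian system *)

Section LocalSolution.
Variable R : realType.
Notation C := R[i].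
Notation M2 := 'M[C]_2.
Implicit Types (s : 'I_3 -> C) (B : 'I_3 -> M2) (p z : C) (d beta : R).

Definition Cm s B z : M2 := \sum_j (z - s j)^-1 *: B j.

(* Taylor coefficients at p of the solution W of dW = - W Cm dz with W p = 1,
   together with those of W / (z - s j). *)
Fixpoint WU s B p (k : nat) : M2 * ('I_3 -> M2) :=
  if k is k'.+1 then
    let W := (- (k'.+1%:R)^-1) *: \sum_j ((WU s B p k').2 j *m B j) in
    (W, fun j => (p - s j)^-1 *: (W - (WU s B p k').2 j))
  else (1%:M, fun j => (p - s j)^-1 *: 1%:M).

Definition Wl s B p z : M2 := \matrix_(i, j) PS (fun k => (WU s B p k).1 i j) (z - p).
Definition Ul s B p l z : M2 := \matrix_(i, j) PS (fun k => (WU s B p k).2 l i j) (z - p).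

Definition okd s B d beta p :=
  [/\ 0 < d, 0 <= beta, (forall j, d <= N1 (p - s j)) & \sum_j nm (B j) <= beta].

(** The coefficients grow at rate [K = 4 / d * (1 + beta)], and this is the radius with
    [4 * K * disc_radius = 1] that [PS_Qder] demands. *)
Definition disc_radius d beta : R := d / (16 * (1 + beta)).

(** Carrying the coefficients of [W / (z - s j)] along makes the recursion one step long: [W] is
    bounded by the previous [U], and [U] by the new [W] and the previous [U]. The constants [2] and
    [4 * rho] reproduce themselves, where [1 + beta] instead of [beta] in [K] absorbs the
    contribution of the previous [U]. *)
Lemma WU_AnM (q0 : (R * R) * R) r (s : (R * R) * R -> 'I_3 -> C) (B : (R * R) * R -> 'I_3 -> M2)
    (b : 'I_3 -> R) (rho beta : R) p : 0 < r -> 0 < rho -> 0 <= beta ->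
  (forall j, AnC q0 r (fun q => (p - s q j)^-1) rho) ->
  (forall j, AnM q0 r (fun q => B q j) (b j)) -> \sum_j b j <= beta ->
  forall k, AnM q0 r (fun q => (WU (s q) (B q) p k).1) (2 * (2 * rho * (1 + beta)) ^+ k) /\
    forall j, AnM q0 r (fun q => (WU (s q) (B q) p k).2 j) (4 * rho * (2 * rho * (1 + beta)) ^+ k).
Proof.
move=> r0 rho0 beta0 hs hB hb; set K := 2 * rho * (1 + beta).
have K0 : 0 <= K by rewrite !mulr_ge0//; lra.
elim=> [|k [IHW IHU]].
  rewrite !expr0 !mulr1; split=> [|j].
    by apply: AnM_le (AnM_cst q0 r 1%:M); rewrite nm_scalar2 N1_1; lra.
  apply: AnM_le (AnMZ r0 (hs j) (AnM_cst q0 r 1%:M)); rewrite nm_scalar2 N1_1; lra.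
have Kk : 0 <= K ^+ k by exact: exprn_ge0.
have HW : AnM q0 r (fun q => (WU (s q) (B q) p k.+1).1) (2 * K ^+ k.+1).
  have h := AnM_sum (index_enum _) (ltW r0) (fun j => AnMM r0 (IHU j) (hB j)).
  apply: AnM_le (AnMZ r0 (AnC_cst q0 r (- (k.+1%:R)^-1)) h).
  rewrite -mulr_sumr N1N.
  have -> : N1 ((k.+1%:R : C)^-1) = (k.+1%:R)^-1.
    rewrite -[k.+1%:R in LHS](rmorph_nat (real_complex R)) -fmorphV N1_real ger0_norm ?invr_ge0 ?ler0n//.
  apply: (@le_trans _ _ (1 * (4 * rho * K ^+ k * beta))).
    apply: ler_pM; rewrite ?invr_ge0 ?mulr_ge0//; try lra.
    - by apply: sumr_ge0 => j _; case: (hB j) => M [hM /(le_trans _)]; apply; 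
        do 2 (apply: sumr_ge0 => ? _); exact: AnC_ge0 (ltW r0) (hM _ _).
    - by rewrite invf_le1 ?ler1n// ltr0n.
    - by apply: ler_wpM2l => //; rewrite !mulr_ge0//; lra.
  rewrite exprS {2}/K mul1r.
  have -> : 2 * (2 * rho * (1 + beta) * K ^+ k) = 4 * rho * K ^+ k * (1 + beta) by ring.
  by apply: ler_wpM2l; [rewrite !mulr_ge0//; lra|lra].
split=> // j.
have := AnMZ r0 (hs j) (AnMD (ltW r0) HW (AnMZ r0 (AnC_cst q0 r (-1)) (IHU j))).
rewrite N1N N1_1 mul1r => h.
have h' : AnM q0 r (fun q => (WU (s q) (B q) p k.+1).2 j)
   (rho * (2 * K ^+ k.+1 + 4 * rho * K ^+ k)).
  by apply: AnM_ext h => q /=; rewrite scaleN1r.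
apply: AnM_le h'.
have -> : 4 * rho * K ^+ k.+1 = rho * (2 * K ^+ k.+1 + 2 * K ^+ k.+1) by ring.
apply: ler_wpM2l; first lra.
rewrite lerD2l [_ ^+ k.+1]exprS {2}/K.
have -> : 2 * (2 * rho * (1 + beta) * K ^+ k) = 4 * rho * K ^+ k * (1 + beta) by ring.
by rewrite ler_peMr ?mulr_ge0//; lra.
Qed.

Lemma Wl_AnC (q0 : (R * R) * R) r (s : (R * R) * R -> 'I_3 -> C) (B : (R * R) * R -> 'I_3 -> M2)
    (b : 'I_3 -> R) (rho beta : R) p z i j : 0 < r -> 0 < rho -> 0 <= beta ->
  (forall j, AnC q0 r (fun q => (p - s q j)^-1) rho) ->
  (forall j, AnM q0 r (fun q => B q j) (b j)) -> \sum_j b j <= beta ->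
  2 * rho * (1 + beta) * N1 (z - p) <= 1 / 2 ->
  AnC q0 r (fun q => Wl (s q) (B q) p z i j) 4.
Proof.
move=> r0 rho0 beta0 hs hB hb hz; set K := 2 * rho * (1 + beta).
have K0 : 0 <= K by rewrite !mulr_ge0//; lra.
have H k := AnM_entry i j (ltW r0) (proj1 (WU_AnM r0 rho0 beta0 hs hB hb k)).
have H2 k := AnCM r0 (H k) (AnCX k r0 (AnC_cst q0 r (z - p))).
refine (AnC_series r0 H2 _ _) => [N|q hq].
  rewrite (_ : 4 = 2 * 2 :> R); last by ring.
  apply: le_trans (@geom_le2w _ (K * N1 (z - p)) 2 N _ _) => //; last first.
    by rewrite mulr_ge0 ?N1_ge0.
  by apply: ler_sum => k _; rewrite [(K * _) ^+ k]exprMn mulrA.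
rewrite /Wl mxE; apply: (@PS_cvg _ _ 2 K) => // k.
exact: (AnC_bound (ltW r0) (H k) hq).
Qed.

Lemma WU_le s B d beta p k : okd s B d beta p ->
  nm (WU s B p k).1 <= 2 * (4 / d * (1 + beta)) ^+ k /\
  forall j, nm ((WU s B p k).2 j) <= 8 / d * (4 / d * (1 + beta)) ^+ k.
Proof.
move=> [d0 b0 hs hB].
pose q0 : (R * R) * R := (0, 0, 0).
have b0' : ball q0 1 q0 by exact: ballxx.
have hs' j : AnC q0 1 (fun=> (p - s j)^-1) (2 / d).
  apply: AnC_le (AnC_cst q0 1 _).
  have N0 : 0 < N1 (p - s j) by exact: lt_le_trans d0 (hs j).
  have n0 : p - s j != 0 by apply: contraTneq N0 => ->; rewrite N1_0 ltxx.
  by apply: le_trans (N1V n0) _; rewrite ler_pM2l// lef_pV2.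
have h := @WU_AnM q0 1 (fun=> s) (fun=> B) (fun j => nm (B j)) (2 / d) beta p ltr01
  (divr_gt0 (ltr0Sn _ 1) d0) b0 hs' (fun j => AnM_cst q0 1 (B j)) hB k.
have e1 : 2 * (2 / d) = 4 / d by ring.
have e2 : 4 * (2 / d) = 8 / d by ring.
rewrite e1 e2 in h; case: h => hW hU.
split=> [|j]; first exact: (AnM_bound ler01 hW b0').
exact: (AnM_bound ler01 (hU j) b0').
Qed.

Lemma eta_gt0 s B d beta p : okd s B d beta p -> 0 < disc_radius d beta.
Proof. by move=> [d0 b0 _ _]; rewrite divr_gt0//; lra. Qed.

Lemma eta_lt s B d beta p : okd s B d beta p -> disc_radius d beta < d.
Proof. by move=> [d0 b0 _ _]; rewrite ltr_pdivrMr; nra. Qed.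

Lemma eta_K s B d beta p : okd s B d beta p -> 4 * (4 / d * (1 + beta)) * disc_radius d beta = 1.
Proof. by move=> [d0 b0 _ _]; rewrite /disc_radius; field; apply/andP; split; rewrite gt_eqF//; lra. Qed.

Lemma Wl_refl s B p : Wl s B p p = 1%:M.
Proof. by apply/matrixP => i j; rewrite mxE subrr PS0. Qed.

Section OneDisc.
Variables (s : 'I_3 -> C) (B : 'I_3 -> M2) (d beta : R) (p : C).
Hypothesis ok : okd s B d beta p.

Let K := 4 / d * (1 + beta).

Let K0 : 0 < K.
Proof. by case: ok => d0 b0 _ _; rewrite /K mulr_gt0 ?divr_gt0//; lra. Qed.

Let Kz z : N1 (z - p) < disc_radius d beta -> 4 * K * N1 (z - p) < 1.
Proof. by move=> h; rewrite -[ltRHS](eta_K ok) -/K ltr_pM2l// mulr_gt0. Qed.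

Let W_le k i j : N1 ((WU s B p k).1 i j) <= 2 * K ^+ k.
Proof. exact: le_trans (N1_nm _ _ _) (proj1 (WU_le k ok)). Qed.

Let U_le k l i j : N1 ((WU s B p k).2 l i j) <= 8 / d * K ^+ k.
Proof. exact: le_trans (N1_nm _ _ _) (proj2 (WU_le k ok) l). Qed.

Let d8 : 0 <= 8 / d.
Proof. by case: ok => d0 _ _ _; rewrite divr_ge0// ltW. Qed.

Lemma disc_neq z l : N1 (z - p) < disc_radius d beta -> z - s l != 0.
Proof.
move=> hz; apply/eqP => /eqP; rewrite subr_eq0 => /eqP e.
have := eta_lt ok; have [d0 _ /(_ l) hs _] := ok.
by move: hz hs; rewrite e N1_distC; lra.
Qed.

(** The recursion for the second component of [WU] is multiplication by
    [z - s l = (p - s l) + (z - p)] read coefficient by coefficient. *)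
Lemma Ul_Wl z l : N1 (z - p) < disc_radius d beta -> Ul s B p l z = (z - s l)^-1 *: Wl s B p z.
Proof.
move=> hz; have z0 := disc_neq l hz.
have p0 : p - s l != 0.
  by apply: disc_neq; rewrite subrr N1_0 (eta_gt0 ok).
have Kz' : K * N1 (z - p) <= 1 / 2 by have := Kz hz; have := N1_ge0 (z - p); nra.
apply/matrixP => i j; rewrite !mxE; apply: (mulfI z0); rewrite mulrA mulfV// mul1r.
have cW := PS_cvg (ler0n _ _) (ltW K0) (fun k => W_le k i j) Kz'.
have cU := PS_cvg d8 (ltW K0) (fun k => U_le k l i j) Kz'.
symmetry; apply: ccvg_unique ((ccvg_shiftS _ _).2 cW) _.
have := ccvgD (ccvgM (ccvg_cst (p - s l)) ((ccvg_shiftS _ _).2 cU)) (ccvgM (ccvg_cst (z - p)) cU).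
rewrite -mulrDl (_ : p - s l + (z - p) = z - s l); last by ring.
apply: ccvg_ext => N; rewrite !big_ord_recl /= !mxE !expr0 !mulr1.
rewrite mulrDr mulrA mulfV// mul1r -addrA; congr (_ + _).
rewrite !mulr_sumr -big_split; apply: eq_bigr => k _; rewrite /bump /= ?add1n /= !mxE.
set u := (WU s B p k).2 l i j; set w := - _ * _.
rewrite !mulrA mulfV// mul1r exprS; ring.
Qed.

Lemma Wl_curve z (c : R -> C) t l : N1 (z - p) < disc_radius d beta -> c t = z -> cder c t l ->
  mder (fun x => Wl s B p (c x)) t (- (l *: (Wl s B p z *m Cm s B z))).
Proof.
move=> hz cz hc i j.
have Kz' : K * N1 (z - p) <= 1 / 2 by have := Kz hz; have := N1_ge0 (z - p); nra.
have hQ := PS_Qder (ler0n R 2) K0 (fun k => W_le k i j) (Kz hz).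
have hc' : cder (fun x => c x - p) t l.
  by apply: cder_eq (cderB hc (cder_cst p t)) _; rewrite subr0.
rewrite -cz in hQ.
apply: cder_eq (cder_ext _ (@cder_comp _ (PS (fun k => (WU s B p k).1 i j)) _ t _ l hQ hc')) _.
  by move=> x; rewrite mxE.
rewrite cz !mxE -mulrN; congr (_ * _).
have cU (a : 'I_3 * 'I_2) : ccvg (fun N => \sum_(k < N) (WU s B p k).2 a.1 i a.2 * (z - p) ^+ k)
    (Ul s B p a.1 z i a.2).
  by rewrite mxE; exact: (PS_cvg d8 (ltW K0) (fun k => U_le k a.1 i a.2) Kz').
have -> : - (\sum_j0 Wl s B p z i j0 * Cm s B z j0 j) =
   \sum_(a : 'I_3 * 'I_2) - B a.1 a.2 j * Ul s B p a.1 z i a.2.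
  rewrite -(pair_bigA _ (fun a b => - B a b j * Ul s B p a z i b)) exchange_big /= -sumrN.
  apply: eq_bigr => b _; rewrite /Cm summxE mulr_sumr -sumrN; apply: eq_bigr => a _.
  by rewrite Ul_Wl// !mxE; ring.
have hs : ccvg (fun N => \sum_(a : 'I_3 * 'I_2) - B a.1 a.2 j *
     \sum_(k < N) (WU s B p k).2 a.1 i a.2 * (z - p) ^+ k)
   (\sum_(a : 'I_3 * 'I_2) - B a.1 a.2 j * Ul s B p a.1 z i a.2).
  elim: (index_enum _) => [|a r IH].
    by rewrite big_nil; apply: ccvg_ext (ccvg_cst 0) => N; rewrite big_nil.
  rewrite big_cons; apply: ccvg_ext (ccvgD (ccvgM (ccvg_cst (- B a.1 a.2 j)) (cU a)) IH) => N.
  by rewrite big_cons.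
apply: climE; apply: ccvg_ext hs => N.
under eq_bigr do rewrite mulr_sumr.
rewrite exchange_big; apply: eq_bigr => k _.
rewrite /dcoef /= !mxE mulNr mulrN mulrA mulfV ?pnatr_eq0// mul1r summxE.
rewrite -[LHS](pair_bigA _ (fun a b => - B a b j * ((WU s B p k).2 a i b * (z - p) ^+ k))).
rewrite -sumrN mulr_suml; apply: eq_bigr => a _; rewrite mxE -sumrN mulr_suml.
by apply: eq_bigr => b _; ring.
Qed.

End OneDisc.

End LocalSolution.

(** * Parallel transport *)

Section Transport.
Variable R : realType.
Notation C := R[i].
Notation M2 := 'M[C]_2.
Variables (s : 'I_3 -> C) (B : 'I_3 -> M2).
Implicit Types (p z x y b : C) (d beta : R) (h : C -> M2).

(** The inverse of [Wl], obtained without inverting: transposing the solution for the negated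
    transposed residues gives a solution of [dV = Cm V dz]. *)
Definition Vl p z : M2 := (Wl s (fun j => - (B j)^T) p z)^T.

Lemma okd_tr d beta p : okd s B d beta p -> okd s (fun j => - (B j)^T) d beta p.
Proof.
move=> [d0 b0 hs hB]; split=> //; apply: le_trans hB; apply: ler_sum => j _.
rewrite /nm exchange_big; apply: ler_sum => a _; apply: ler_sum => b _.
by rewrite !mxE N1N.
Qed.

Lemma Vl_curve d beta p z (c : R -> C) t l : okd s B d beta p -> N1 (z - p) < disc_radius d beta ->
  c t = z -> cder c t l -> mder (fun u => Vl p (c u)) t (l *: (Cm s B z *m Vl p z)).
Proof.
move=> ok hz cz hc; apply: mder_eq (mder_tr (Wl_curve (okd_tr ok) hz cz hc)) _.
rewrite /Vl linearN linearZ /= trmx_mul -scalerN; congr (_ *: _); rewrite -mulNmx; congr (_ *m _).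
rewrite /Cm linear_sum /= -sumrN; apply: eq_bigr => j _.
by rewrite linearZ linearN /= trmxK scalerN opprK.
Qed.

Lemma Vl_refl p : Vl p p = 1%:M. Proof. by rewrite /Vl Wl_refl trmx1. Qed.

Lemma seg0 y z : y + (0 : R)%:C * (z - y) = y. Proof. by rewrite mul0r addr0. Qed.
Lemma seg1 y z : y + (1 : R)%:C * (z - y) = z. Proof. by rewrite mul1r addrC subrK. Qed.

Lemma seg_convex y z p t : 0 <= t <= 1 ->
  N1 (y + t%:C * (z - y) - p) <= (1 - t) * N1 (y - p) + t * N1 (z - p).
Proof.
move=> /andP[t0 t1].
have -> : y + t%:C * (z - y) - p = (1 - t)%:C * (y - p) + t%:C * (z - p).
  by rewrite rmorphB rmorph1; ring.
apply: le_trans (N1D _ _) _; apply: lerD; apply: le_trans (N1M _ _) _.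
  by rewrite N1_real ger0_norm// subr_ge0.
by rewrite N1_real ger0_norm.
Qed.

Lemma seg_ball y z p (e t : R) : 0 <= t <= 1 -> N1 (y - p) < e -> N1 (z - p) < e ->
  N1 (y + t%:C * (z - y) - p) < e.
Proof.
move=> ht hy hz; apply: le_lt_trans (seg_convex _ _ _ ht) _; case/andP: ht => t0 t1.
have [h|h] := ltP 0 t; last by (have -> : t = 0 by lra); rewrite subr0 mul1r mul0r addr0.
have h1 : t * N1 (z - p) < t * e by rewrite ltr_pM2l.
have : (1 - t) * N1 (y - p) <= (1 - t) * e by rewrite ler_wpM2l ?subr_ge0// ltW.
by lra.
Qed.

(** Along the segment from [y] to [z] the contributions [- W Cm V] and [W Cm V] to the derivative of
    the product cancel. *)
Lemma Wl_Vl d beta p y z : okd s B d beta p -> okd s B d beta y ->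
  N1 (y - p) < disc_radius d beta -> N1 (z - p) < disc_radius d beta -> N1 (z - y) < disc_radius d beta ->
  Wl s B p z *m Vl y z = Wl s B p y.
Proof.
move=> okp oky hy hz hzy.
pose c t := y + t%:C * (z - y).
have c1 : c 1 = z by exact: seg1.
have c0 : c 0 = y by exact: seg0.
suff E : Wl s B p (c 1) *m Vl y (c 1) = Wl s B p (c 0) *m Vl y (c 0).
  by move: E; rewrite c1 c0 Vl_refl => ->; exact: mulmx1.
apply: (@mder0_cst R 2 2 (fun t => Wl s B p (c t) *m Vl y (c t))) => t ht.
have h1 : N1 (c t - p) < disc_radius d beta by exact: seg_ball.
have h2 : N1 (c t - y) < disc_radius d beta.
  by apply: seg_ball => //; rewrite subrr N1_0 (eta_gt0 okp).
have hc : cder c t (z - y) by exact: cder_line.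
apply: mder_eq (mderM (Wl_curve okp h1 erefl hc) (Vl_curve oky h2 erefl hc)) _.
by rewrite -scalemxAr mulNmx -scalemxAl mulmxA addrC subrr.
Qed.

Lemma Wl_Vl1 d beta y z : okd s B d beta y -> N1 (z - y) < disc_radius d beta -> Wl s B y z *m Vl y z = 1%:M.
Proof.
by move=> ok hz; rewrite (Wl_Vl ok ok)// ?subrr ?N1_0 ?(eta_gt0 ok)// Wl_refl.
Qed.

Lemma Wl_cocycle d beta p y z : okd s B d beta p -> okd s B d beta y ->
  N1 (y - p) < disc_radius d beta -> N1 (z - p) < disc_radius d beta -> N1 (z - y) < disc_radius d beta ->
  Wl s B p y *m Wl s B y z = Wl s B p z.
Proof.
move=> okp oky hy hz hzy; rewrite -(Wl_Vl okp oky hy hz hzy) -mulmxA.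
by rewrite (mulmx1C (Wl_Vl1 oky hzy)) mulmx1.
Qed.

Definition dhl h x (l : C) : M2 := - (ctr (l *: Cm s B x) *m h x + h x *m (l *: Cm s B x)).

(** Two strengths of one equation: [ParL] looks only along straight lines, as the given directional
    derivatives do, while [ParC] allows every differentiable curve and can therefore be composed
    with [z / w]. *)
Definition ParC h x := forall (c : R -> C) t l, c t = x -> cder c t l ->
  mder (fun u => h (c u)) t (dhl h x l).

Definition ParL h x := forall v, mder (fun u : R => h (x + u%:C * v)) 0 (dhl h x v).

Lemma ParC_ParL h x : ParC h x -> ParL h x.
Proof.
move=> H v; apply: (H (fun u => x + u%:C * v)); last exact: cder_line.
by rewrite mul0r addr0.
Qed.

Lemma is_derive_shift (f : R -> R) t l : is_derive (0 : R) 1 (fun u => f (t + u)) l -> is_derive t 1 f l.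
Proof.
move=> /is_derive_eps h; apply/is_derive_eps => e e0; have [d d0 hd] := h e e0.
by exists d => // u u0 ud; have := hd u u0 ud; rewrite add0r addr0.
Qed.

Lemma ParL_line h y v t : ParL h (y + t%:C * v) ->
  mder (fun u : R => h (y + u%:C * v)) t (dhl h (y + t%:C * v) v).
Proof.
move=> /(_ v) H i j; have [a b] := H i j.
have E u : h (y + t%:C * v + u%:C * v) i j = h (y + (t + u)%:C * v) i j.
  by rewrite rmorphD mulrDl addrA.
split; apply: is_derive_shift.
  by move: a; under eq_fun do rewrite E.
by move: b; under eq_fun do rewrite E.
Qed.

Lemma conj_cancel (V X H : M2) :
  (ctr (X *m V) *m H + ctr V *m (- (ctr X *m H + H *m X))) *m V + ctr V *m H *m (X *m V) = 0.
Proof.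
by rewrite ctrM mulmxN mulmxDr opprD addrA !mulmxA subrr sub0r mulNmx addNr.
Qed.

(** Conjugating [h] by [Vl] gives a matrix that is constant along the segment, and [Wl] undoes the
    conjugation. *)
Lemma transport_disc d beta p z h : okd s B d beta p -> N1 (z - p) < disc_radius d beta ->
  (forall t, 0 <= t <= 1 -> ParL h (p + t%:C * (z - p))) ->
  h z = ctr (Wl s B p z) *m h p *m Wl s B p z.
Proof.
move=> ok hz hh; pose c t := p + t%:C * (z - p).
have c1 : c 1 = z by exact: seg1.
have c0 : c 0 = p by exact: seg0.
have E : ctr (Vl p (c 1)) *m h (c 1) *m Vl p (c 1) = ctr (Vl p (c 0)) *m h (c 0) *m Vl p (c 0).
  apply: (@mder0_cst R 2 2 (fun t => ctr (Vl p (c t)) *m h (c t) *m Vl p (c t))) => t ht.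
  have h2 : N1 (c t - p) < disc_radius d beta.
    by apply: seg_ball => //; rewrite subrr N1_0 (eta_gt0 ok).
  have hc : cder c t (z - p) by exact: cder_line.
  have hV := Vl_curve ok h2 erefl hc.
  apply: mder_eq (mderM (mderM (mder_ctr hV) (ParL_line (hh t ht))) hV) _.
  by rewrite /dhl -/(c t) scalemxAl conj_cancel.
move: E; rewrite c1 c0 Vl_refl ctr1 mulmx1 mul1mx => <-.
have VW := mulmx1C (Wl_Vl1 ok hz).
rewrite !mulmxA -ctrM VW ctr1 mul1mx -mulmxA VW mulmx1 //.
Qed.

Definition pt n b x (k : nat) : C := b + ((k%:R / n%:R : R))%:C * (x - b).

Fixpoint Wch n b x (k : nat) : M2 :=
  if k is k'.+1 then Wch n b x k' *m Wl s B (pt n b x k') (pt n b x k'.+1) else 1%:M.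

Definition Wseg n b x := Wch n b x n.

(** The factor [2] keeps each of the [n] steps within half a disc. The slack lets the end point move
    in [ladder] and the parameters move in [Wl_AnMAt]. *)
Definition good d beta n b x :=
  [/\ (forall t, 0 <= t <= 1 -> okd s B d beta (b + t%:C * (x - b))), (0 < n)%N &
      2 * N1 (x - b) < n%:R * disc_radius d beta].

Lemma ptS n b x k : pt n b x k.+1 - pt n b x k = ((n%:R : R)^-1)%:C * (x - b).
Proof.
rewrite /pt addrAC opprD addrA subrr add0r addrC -mulrBl -rmorphB -mulrBl.
by rewrite -natr1 [_ + 1]addrC addrK mul1r.
Qed.

Lemma frac01 n k : (0 < n)%N -> (k <= n)%N -> 0 <= (k%:R / n%:R : R) <= 1.
Proof. by move=> n0 kn; rewrite divr_ge0//= ler_pdivrMr ?ltr0n// mul1r ler_nat. Qed.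

Lemma pt_ok d beta n b x k : good d beta n b x -> (k <= n)%N -> okd s B d beta (pt n b x k).
Proof. by move=> [h n0 _] kn; apply: h; exact: frac01. Qed.

Lemma pt_step d beta n b x k : good d beta n b x -> 2 * N1 (pt n b x k.+1 - pt n b x k) < disc_radius d beta.
Proof.
move=> [h n0 hn]; rewrite ptS; have n0' : 0 < n%:R :> R by rewrite ltr0n.
have h1 := N1M (n%:R^-1)%:C (x - b).
have i0 : 0 < (n%:R : R)^-1 by rewrite invr_gt0.
rewrite N1_real ger0_norm ?(ltW i0)// in h1.
have : n%:R^-1 * (2 * N1 (x - b)) < n%:R^-1 * (n%:R * disc_radius d beta) by rewrite ltr_pM2l.
by rewrite mulKf ?gt_eqF//; lra.
Qed.

Lemma pt_n n b x : (0 < n)%N -> pt n b x n = x.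
Proof. by move=> n0; rewrite /pt divff ?seg1// pnatr_eq0 -lt0n. Qed.

Lemma pt_0 n b x : pt n b x 0 = b.
Proof. by rewrite /pt mul0r seg0. Qed.

Lemma transport_seg d beta n b x h : good d beta n b x ->
  (forall t, 0 <= t <= 1 -> ParL h (b + t%:C * (x - b))) ->
  h x = ctr (Wseg n b x) *m h b *m Wseg n b x.
Proof.
move=> hg hh; have n0 : (0 < n)%N by case: hg.
suff H k : (k <= n)%N -> h (pt n b x k) = ctr (Wch n b x k) *m h b *m Wch n b x k.
  by rewrite -[in LHS](pt_n b x n0) H.
elim: k => [|k IH] kn; first by rewrite pt_0 /= ctr1 mul1mx mulmx1.
rewrite (@transport_disc d beta (pt n b x k)).
- by rewrite IH ?(ltnW kn)//= ctrM !mulmxA.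
- by apply: pt_ok hg _; exact: ltnW.
- by have := pt_step k hg; have := N1_ge0 (pt n b x k.+1 - pt n b x k); lra.
move=> t /andP[t0 t1].
have -> : pt n b x k + t%:C * (pt n b x k.+1 - pt n b x k) = b + ((k%:R + t) / n%:R)%:C * (x - b).
  by rewrite ptS /pt mulrDl rmorphD mulrDl rmorphM /=; rewrite !rmorphM /=; ring.
apply: hh; have n0' : 0 < n%:R :> R by rewrite ltr0n.
rewrite divr_ge0 ?addr_ge0//= ler_pdivrMr// mul1r.
have : (k.+1%:R <= n%:R :> R) by rewrite ler_nat.
by rewrite -natr1; lra.
Qed.

Lemma Wseg_refl n b : Wseg n b b = 1%:M.
Proof.
rewrite /Wseg; elim: {2}n => //= k ->.
by rewrite mul1mx /pt subrr !mulr0 Wl_refl.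
Qed.

Lemma good_sub d beta n b x t : 0 <= t <= 1 -> good d beta n b x -> good d beta n b (b + t%:C * (x - b)).
Proof.
move=> /andP[t0 t1] [h n0 hn]; split=> //.
  move=> u /andP[u0 u1]; rewrite [b + t%:C * _]addrC addrK mulrA -rmorphM; apply: h.
  by rewrite mulr_ge0//= mulr_ile1.
rewrite [b + _]addrC addrK; apply: le_lt_trans hn; rewrite ler_wpM2l//.
apply: le_trans (N1M _ _) _; rewrite N1_real ger0_norm//.
by rewrite ler_piMl ?N1_ge0.
Qed.

Lemma mulmx_step (A P Q P' Q' T : M2) : P *m Q = T -> P' *m Q' = T -> A *m P *m Q = A *m P' *m Q'.
Proof. by move=> E1 E2; rewrite -!mulmxA E1 E2. Qed.

(** The subdivided segments towards [x] and [y] form a ladder with rungs shorter than [e]; in each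
    cell two applications of the cocycle rule push the rung one step further. *)
Lemma ladder d beta n b x : good d beta n b x -> exists2 e, 0 < e & forall y, N1 (y - x) < e ->
  (exists d', good d' beta n b y) /\ Wseg n b y = Wseg n b x *m Wl s B x y.
Proof.
move=> hg; have [h n0 hn] := hg.
have n0' : 0 < n%:R :> R by rewrite ltr0n.
have okx : okd s B d beta x by have := h 1; rewrite seg1; apply; rewrite ler01 lexx.
have [d0 b0 _ hB] := okx.
have eta0 := eta_gt0 okx; have etad := eta_lt okx.
pose D := n%:R * disc_radius d beta - 2 * N1 (x - b).
have D0 : 0 < D by rewrite /D; lra.
(* The first bound preserves [good] after the distance to the poles drops to [d - e] and the end
   point moves; the second keeps all cells inside the discs. *)
pose e := Num.min (D / (2 * (n%:R + 2))) (disc_radius d beta / 8).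
have eD : e * (n%:R + 2) < D.
  have : e <= D / (2 * (n%:R + 2)) by rewrite /e ge_min lexx.
  by rewrite ler_pdivlMr; nra.
have e8 : e <= disc_radius d beta / 8 by rewrite /e ge_min lexx orbT.
have e0 : 0 < e by rewrite /e lt_min !divr_gt0//; lra.
have disc_radius' : disc_radius (d - e) beta = disc_radius d beta - e / (16 * (1 + beta)) by rewrite /disc_radius mulrBl.
have ee : e / (16 * (1 + beta)) <= e by rewrite ler_pdivrMr; nra.
exists e => // y hy.
have okseg t z : 0 <= t <= 1 -> N1 (z - x) < e -> okd s B (d - e) beta (b + t%:C * (z - b)).
  move=> ht hz; have [_ _ ho _] := h t ht; split=> //; first by lra.
  move=> j; have := ho j; have := N1D (b + t%:C * (z - b) - s j) (t%:C * (x - z)).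
  have -> : b + t%:C * (z - b) - s j + t%:C * (x - z) = b + t%:C * (x - b) - s j by ring.
  have : N1 (t%:C * (x - z)) <= N1 (z - x).
    apply: le_trans (N1M _ _) _; rewrite N1_real N1_distC; case/andP: ht => t0 t1.
    by rewrite ger0_norm// ler_piMl ?N1_ge0.
  by lra.
have gy : good (d - e) beta n b y.
  split=> // [t ht|]; first exact: okseg.
  rewrite disc_radius'; have := N1D (y - x) (x - b); rewrite addrA subrK.
  by rewrite /D in eD; nra.
have gx : good (d - e) beta n b x.
  split=> // [t ht|]; first by apply: okseg => //; rewrite subrr N1_0.
  by rewrite disc_radius'; rewrite /D in eD; nra.
split; first by exists (d - e).
have pp k : (k <= n)%N -> N1 (pt n b y k - pt n b x k) <= N1 (y - x).
  move=> kn; have /andP[f0 f1] := frac01 n0 kn.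
  have -> : pt n b y k - pt n b x k = ((k%:R / n%:R : R))%:C * (y - x) by rewrite /pt; ring.
  apply: le_trans (N1M _ _) _; rewrite N1_real ger0_norm//.
  by rewrite ler_piMl ?N1_ge0.
have eh : 2 * e < disc_radius (d - e) beta by rewrite disc_radius'; lra.
have eg := N1_ge0.
rewrite /Wseg -[in Wl s B x y](pt_n b x n0) -[in X in Wl _ _ _ X](pt_n b y n0).
suff H k : (k <= n)%N -> Wch n b y k = Wch n b x k *m Wl s B (pt n b x k) (pt n b y k) by exact: H.
elim: k => [|k IH] kn; first by rewrite /= !pt_0 Wl_refl mulmx1.
have kn' := ltnW kn.
have s1 := pt_step k gx; have s2 := pt_step k gy.
have p1 := pp _ kn; have p2 := pp _ kn'.
have t1 := N1D (pt n b y k.+1 - pt n b x k.+1) (pt n b x k.+1 - pt n b x k).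
rewrite addrA subrK in t1.
have r1 := N1_ge0 (pt n b x k.+1 - pt n b x k).
have r2 := N1_ge0 (pt n b y k.+1 - pt n b y k).
have E1 : Wl s B (pt n b x k) (pt n b y k) *m Wl s B (pt n b y k) (pt n b y k.+1) =
    Wl s B (pt n b x k) (pt n b y k.+1).
  apply: (@Wl_cocycle (d - e) beta).
  - exact: (pt_ok gx).
  - exact: (pt_ok gy).
  - by clear -p2 hy eh e0; lra.
  - by clear -t1 p1 s1 hy eh e0 r1; lra.
  - by clear -s2 r2; lra.
have E2 : Wl s B (pt n b x k) (pt n b x k.+1) *m Wl s B (pt n b x k.+1) (pt n b y k.+1) =
    Wl s B (pt n b x k) (pt n b y k.+1).
  apply: (@Wl_cocycle (d - e) beta).
  - exact: (pt_ok gx).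
  - exact: (pt_ok gx).
  - by clear -s1 r1; lra.
  - by clear -t1 p1 s1 hy eh e0 r1; lra.
  - by clear -p1 hy eh e0; lra.
exact: (etrans (congr1 (fun M => M *m _) (IH kn')) (mulmx_step _ E1 E2)).
Qed.

Lemma conj_ParC d beta x (h : C -> M2) (e : R) : okd s B d beta x -> 0 < e ->
  (forall y, N1 (y - x) < e -> h y = ctr (Wl s B x y) *m h x *m Wl s B x y) -> ParC h x.
Proof.
move=> ok e0 he c t l ct hc.
have [d' d'0 hd'] := cder_cont hc e0.
apply: (@mder_near _ _ _ (fun u => ctr (Wl s B x (c u)) *m h x *m Wl s B x (c u))).
  by exists d' => // u hu; symmetry; apply: he; rewrite -ct; exact: hd'.
have hx : N1 (x - x) < disc_radius d beta by rewrite subrr N1_0 (eta_gt0 ok).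
have hW := Wl_curve ok hx ct hc; rewrite Wl_refl mul1mx in hW.
apply: mder_eq (mderM (mderM (mder_ctr hW) (mder_cst (h x) t)) hW) _.
by rewrite ct Wl_refl ctr1 !mul1mx mulmx1 addr0 ctrN /dhl opprD mulNmx mulmxN.
Qed.

Lemma min_dist b x : (forall t (j : 'I_3), 0 <= t <= 1 -> b + t%:C * (x - b) != s j) ->
  exists2 d, 0 < d & forall t j, 0 <= t <= 1 -> d <= N1 (b + t%:C * (x - b) - s j).
Proof.
move=> hne.
have one j : exists2 d, 0 < d & forall t, 0 <= t <= 1 -> d <= N1 (b + t%:C * (x - b) - s j).
  pose f t : R := N1 (b + t%:C * (x - b) - s j).
  have cf : continuous f.
    move=> t; have [h1 h2] := cderB (cder_line b (x - b) t) (cder_cst (s j) t).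
    apply: cvgD; apply: cvg_norm; [exact: is_derive_continuous h1|exact: is_derive_continuous h2].
  have [|t ht hmin] := @EVT_min R f 0 1 ler01; first by exact: continuous_subspaceT.
  have h01 : 0 <= t <= 1 by move: ht; rewrite in_itv.
  exists (f t); first by apply: N1_gt0; rewrite subr_eq0 hne.
  by move=> u hu; apply: hmin; rewrite in_itv.
have /choice[dd hdd] j : exists d, 0 < d /\ forall t, 0 <= t <= 1 -> d <= N1 (b + t%:C * (x - b) - s j).
  by have [d d0 hd] := one j; exists d.
exists (Num.min (dd ord0) (Num.min (dd (lift ord0 ord0)) (dd (lift ord0 (lift ord0 ord0))))).
  by rewrite !lt_min; do !(apply/andP; split); exact: (hdd _).1.
move=> t j ht; apply: le_trans ((hdd j).2 t ht).
case: j => -[|[|[|//]]] hj; rewrite !ge_min.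
- by rewrite (_ : Ordinal hj = ord0) ?lexx//; apply/val_inj.
- by rewrite (_ : Ordinal hj = lift ord0 ord0) ?lexx ?orbT//; apply/val_inj.
- by rewrite (_ : Ordinal hj = lift ord0 (lift ord0 ord0)) ?lexx ?orbT//; apply/val_inj.
Qed.

Lemma good_ex b x : (forall t j, 0 <= t <= 1 -> b + t%:C * (x - b) != s j) ->
  exists d n, good d (\sum_j nm (B j)) n b x.
Proof.
move=> /min_dist[d d0 hd].
have ok t : 0 <= t <= 1 -> okd s B d (\sum_j nm (B j)) (b + t%:C * (x - b)).
  by move=> ht; split=> // [|j]; [apply: sumr_ge0 => j _; exact: nm_ge0|exact: hd].
have e0 := eta_gt0 (ok 0 ltac:(rewrite lexx ler01 //)).
exists d, (Num.truncn (2 * N1 (x - b) / disc_radius d (\sum_j nm (B j)))).+1; split=> //.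
by rewrite -ltr_pdivrMr//; apply: truncnS_gt.
Qed.

(** On a star-shaped domain the form is transported along the rays from [b]. The number of steps
    depends on the point, and [hnE] removes this dependence: the form built with [n] steps is
    parallel along the whole ray, so transporting its value at [b] with [n'] steps gives it back. *)
Lemma ParC_exists (D : set C) b (g : M2) :
  (forall x t, D x -> 0 <= t <= 1 -> D (b + t%:C * (x - b))) ->
  (forall x, D x -> exists2 e, 0 < e & forall y, N1 (y - x) < e -> D y) ->
  (forall x j, D x -> x != s j) ->
  exists h, [/\ h b = g, (forall x, D x -> ParC h x) & (Defs.hermitian g -> forall x, Defs.hermitian (h x))].
Proof.
move=> Dstar Dopen Ds; set beta := \sum_j nm (B j).
have gx x : exists dn : R * nat, D x -> good dn.1 beta dn.2 b x.
  have [Dx|nDx] := pselect (D x); last by exists (0, 0%N).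
  have [|d [n hg]] := @good_ex b x; first by move=> t j ht; apply: Ds; exact: Dstar.
  by exists (d, n).
have [dn hdn] := choice gx.
pose hn n x : M2 := ctr (Wseg n b x) *m g *m Wseg n b x.
have hnP n d x : good d beta n b x -> ParC (hn n) x.
  move=> hg; have [e e0 he] := ladder hg.
  have okx : okd s B d beta x by case: hg => h _ _; have := h 1; rewrite seg1; apply; rewrite ler01 lexx.
  apply: (conj_ParC okx e0) => y hy; have [_ E] := he y hy.
  by rewrite /hn E ctrM !mulmxA.
have hnE n n' d d' x : good d beta n b x -> good d' beta n' b x -> hn n x = hn n' x.
  move=> hg hg'; have hb : hn n b = g by rewrite /hn Wseg_refl ctr1 mul1mx mulmx1.
  have E := @transport_seg d' beta n' b x (hn n) hg'.
  rewrite hb in E; apply: E => t ht; apply/ParC_ParL/(hnP n d); exact: good_sub.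
exists (fun x => hn (dn x).2 x); split.
- by rewrite /hn /= Wseg_refl ctr1 mul1mx mulmx1.
- move=> x Dx c t l ct hc; have hg := hdn x Dx.
  have [e e0 he] := ladder hg; have [e' e'0 he'] := Dopen x Dx.
  have m0 : 0 < Num.min e e' by rewrite lt_min e0.
  have [d1 d10 hd1] := cder_cont hc m0.
  apply: (@mder_near _ _ _ (fun u => hn (dn x).2 (c u))); last exact: (hnP _ _ _ hg c t l ct hc).
  exists d1 => // u hu; have := hd1 u hu; rewrite ct lt_min => /andP[h1 h2].
  have [[d' gd'] _] := he _ h1.
  exact: hnE gd' (hdn _ (he' _ h2)).
- by move=> hg x; rewrite /Defs.hermitian /hn !ctrM ctrK hg mulmxA.
Qed.

End Transport.

(** * Continuation of a parallel form across a pole *)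

Section Gluing.
Variable R : realType.
Notation C := R[i].
Notation M2 := 'M[C]_2.
Variables (s : 'I_3 -> C) (B : 'I_3 -> M2).

Lemma ParL_unique b x (h h' : C -> M2) :
  (forall t j, 0 <= t <= 1 -> b + t%:C * (x - b) != s j) ->
  (forall t, 0 <= t <= 1 -> ParL s B h (b + t%:C * (x - b))) ->
  (forall t, 0 <= t <= 1 -> ParL s B h' (b + t%:C * (x - b))) -> h b = h' b -> h x = h' x.
Proof.
move=> hs hh hh' e; have [d [n hg]] := good_ex B hs.
by rewrite (transport_seg hg hh) (transport_seg hg hh') e.
Qed.

Lemma ParC_near (h h' : C -> M2) x : (exists2 e, 0 < e & forall y, N1 (y - x) < e -> h y = h' y) ->
  ParC s B h x -> ParC s B h' x.
Proof.
move=> [e e0 he] H c t l ct hc; have [d d0 hd] := cder_cont hc e0.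
have := H c t l ct hc; rewrite /dhl he ?subrr ?N1_0//; apply: mder_near.
by exists d => // u hu; apply: he; rewrite -ct; exact: hd.
Qed.

Variable k : R.
(** A tilted real part. The slope [k] can separate the three poles even when [lam] has real part [0]
    or [1]; [phi] and the imaginary part serve as coordinates, with [point] as the inverse map. *)
Definition phi (z : C) : R := Rez z + k * Imz z.
Definition point (a b : R) : C := (a - k * b) +i* b.

Lemma phi_point a b : phi (point a b) = a. Proof. by rewrite /phi /= subrK. Qed.
Lemma Im_point a b : Imz (point a b) = b. Proof. by []. Qed.

Lemma Rez_seg (b x : C) (t : R) : Rez (b + t%:C * (x - b)) = Rez b + t * (Rez x - Rez b).
Proof. by rewrite RezD RezM RezD RezN /= mul0r subr0. Qed.
Lemma Imz_seg (b x : C) (t : R) : Imz (b + t%:C * (x - b)) = Imz b + t * (Imz x - Imz b).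
Proof. by rewrite ImzD ImzM ImzD ImzN /= mul0r addr0. Qed.
Lemma phi_seg b x t : phi (b + t%:C * (x - b)) = phi b + t * (phi x - phi b).
Proof. by rewrite /phi Rez_seg Imz_seg; ring. Qed.

Lemma phi_lip x y : `|phi y - phi x| <= (1 + `|k|) * N1 (y - x).
Proof.
have -> : phi y - phi x = Rez (y - x) + k * Imz (y - x).
  by rewrite /phi RezD ImzD RezN ImzN; ring.
apply: le_trans (ler_normD _ _) _; rewrite normrM mulrDl mul1r.
by apply: lerD; [exact: Rez_le|apply: ler_wpM2l => //; exact: Imz_le].
Qed.

Lemma phi_near (x : C) (e : R) : 0 < e -> exists2 d, 0 < d & forall y, N1 (y - x) < d -> `|phi y - phi x| < e.
Proof.
move=> e0; have k0 : 0 < 1 + `|k| by apply: ltr_pwDl.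
exists (e / (1 + `|k|)); first by rewrite divr_gt0.
move=> y; rewrite ltr_pdivlMr// mulrC => h; exact: le_lt_trans (phi_lip _ _) h.
Qed.

Lemma Im_near (x y : C) (e : R) : N1 (y - x) < e -> `|Imz y - Imz x| < e.
Proof. by move=> h; apply: le_lt_trans h; rewrite -ImzN -ImzD; exact: Imz_le. Qed.

(** Openness and convexity are what makes a product of two such sets, in the coordinates [phi] and
    [Imz], an open domain that is star-shaped about each of its points. *)
Definition interval_open (J : R -> Prop) :=
  (forall t, J t -> exists2 e, 0 < e & forall u, `|u - t| < e -> J u) /\
  (forall t u x, J t -> J u -> 0 <= x <= 1 -> J (t + x * (u - t))).

Lemma interval_openI J J' : interval_open J -> interval_open J' ->
  interval_open (fun t => J t /\ J' t).
Proof.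
move=> [a b] [c d]; split=> [t [Jt J't]|t u x [Jt J't] [Ju J'u] hx]; last by split; [exact: b|exact: d].
have [e e0 he] := a t Jt; have [e' e'0 he'] := c t J't.
exists (Num.min e e') => [|u]; first by rewrite lt_min e0.
by rewrite lt_min => /andP[h1 h2]; split; [exact: he|exact: he'].
Qed.

Lemma interval_open_lt a : interval_open (fun t => t < a).
Proof.
split=> [t ta|t u x ta ua /andP[x0 x1]].
  by exists (a - t) => [|u]; [lra|rewrite ltr_norml => /andP[_ ?]; lra].
have [->|xn] := eqVneq x 0; first by rewrite mul0r addr0.
have xp : 0 < x by rewrite lt_neqAle eq_sym xn.
have h1 : x * u < x * a by rewrite ltr_pM2l.
have h2 : 0 <= (a - t) * (1 - x) by rewrite mulr_ge0//; lra.
by lra.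
Qed.

Lemma interval_open_gt a : interval_open (fun t => a < t).
Proof.
have [h1 h2] := interval_open_lt (- a); split=> [t at_|t u x at_ au hx].
  have [|e e0 he] := h1 (- t); first by lra.
  exists e => // u hu; have := he (- u); rewrite -opprD normrN => /(_ hu); lra.
by have := h2 (- t) (- u) x ltac:(lra) ltac:(lra) hx; lra.
Qed.

Lemma interval_open_T : interval_open (fun=> True).
Proof. by split=> // t _; exists 1. Qed.

Lemma box_ParC (J J' : R -> Prop) b (g : M2) : interval_open J -> interval_open J' ->
  J (phi b) -> J' (Imz b) -> (forall x j, J (phi x) -> J' (Imz x) -> x != s j) ->
  exists h, [/\ h b = g, (forall x, J (phi x) -> J' (Imz x) -> ParC s B h x) &
    (Defs.hermitian g -> forall x, Defs.hermitian (h x))].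
Proof.
move=> [Jo Jc] [J'o J'c] Jb J'b hs.
have [| | |h [hb hh hherm]] := @ParC_exists R s B [set x | J (phi x) /\ J' (Imz x)] b g.
- by move=> x t [Jx J'x] ht; split; rewrite ?phi_seg ?Imz_seg; [exact: Jc|exact: J'c].
- move=> x [Jx J'x]; have [e e0 he] := Jo _ Jx; have [e' e'0 he'] := J'o _ J'x.
  have [d d0 hd] := phi_near x e0.
  exists (Num.min d e') => [|y]; first by rewrite lt_min d0.
  by rewrite lt_min => /andP[h1 h2]; split; [exact/he/hd|exact/he'/Im_near].
- by move=> x j [Jx J'x]; exact: hs.
by exists h; split=> // x Jx J'x; exact: hh.
Qed.

Lemma box_unique (J J' : R -> Prop) b x (h h' : C -> M2) : interval_open J -> interval_open J' ->
  J (phi b) -> J' (Imz b) -> J (phi x) -> J' (Imz x) ->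
  (forall x j, J (phi x) -> J' (Imz x) -> x != s j) ->
  (forall x, J (phi x) -> J' (Imz x) -> ParC s B h x) ->
  (forall x, J (phi x) -> J' (Imz x) -> ParC s B h' x) -> h b = h' b -> h x = h' x.
Proof.
move=> [_ Jc] [_ J'c] Jb J'b Jx J'x hs hh hh'.
have inb t : 0 <= t <= 1 -> J (phi (b + t%:C * (x - b))) /\ J' (Imz (b + t%:C * (x - b))).
  by move=> ht; split; rewrite ?phi_seg ?Imz_seg; [exact: Jc|exact: J'c].
apply: ParL_unique => [t j ht|t ht|t ht]; have [? ?] := inb t ht.
- exact: hs.
- exact/ParC_ParL/hh.
- exact/ParC_ParL/hh'.
Qed.

Definition nonpole x := forall j, x != s j.

(** Above and below the pole, [h1] continues into forms [u true] and [u false] on half strips, and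
    these continue into [v true] and [v false] on the part of the strip to the right of the pole.
    [G true = G false] compares the last two at one point; uniqueness spreads the equality, and all
    pieces glue. *)
Lemma cross_step (j : 'I_3) (J : R -> Prop) (h1 : C -> M2) (bl br T d beta : R) n :
  interval_open J -> J (phi (s j)) -> (forall l, l != j -> ~ J (phi (s l))) ->
  (forall l, phi (s l) < phi (s j) \/ l = j \/ phi (s j) < phi (s l)) ->
  J bl -> J br -> bl < phi (s j) -> phi (s j) < br -> - T < Imz (s j) < T ->
  (forall x, Defs.hermitian (h1 x)) -> (forall x, phi x < phi (s j) -> nonpole x -> ParC s B h1 x) ->
  (forall e : bool, good s B d beta n (point bl (if e then T else - T)) (point br (if e then T else - T)) /\
    good s B d beta n (point br (if e then T else - T)) (point br 0)) ->
  let G (e : bool) := let W := Wseg s B n (point bl (if e then T else - T)) (point br (if e then T else - T)) *m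
      Wseg s B n (point br (if e then T else - T)) (point br 0) in
      ctr W *m h1 (point bl (if e then T else - T)) *m W in
  G true = G false ->
  exists h2 : C -> M2, [/\ (forall x, Defs.hermitian (h2 x)),
    (forall x, phi x < phi (s j) -> h2 x = h1 x), h2 (point br 0) = G true &
    (forall x, nonpole x -> phi x < phi (s j) \/ J (phi x) -> ParC s B h2 x)].
Proof.
move=> Jo Jj Jl ltri Jbl Jbr blj jbr /andP[Tl Tr] herm1 hh1 hgood G GE.
pose tt (e : bool) := if e then T else - T.
pose Je (e : bool) := fun t => if e then Imz (s j) < t else t < Imz (s j).
have Jeo e : interval_open (Je e) by case: e; [exact: interval_open_gt|exact: interval_open_lt].
have Jet e : Je e (tt e) by case: e.
have npU e x l : J (phi x) -> Je e (Imz x) -> x != s l.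
  move=> Jx Jex; apply/eqP => xl; have [lj|lj] := eqVneq l j.
    by move: Jex; rewrite xl lj; case: e => /=; rewrite ltxx.
  by apply: (Jl _ lj); rewrite -xl.
pose Jp := fun t => J t /\ phi (s j) < t.
have Jpo : interval_open Jp by apply: interval_openI => //; exact: interval_open_gt.
pose Jm := fun t => J t /\ t < phi (s j).
have Jmo : interval_open Jm by apply: interval_openI => //; exact: interval_open_lt.
have npV x l : Jp (phi x) -> (fun=> True) (Imz x) -> x != s l.
  move=> [Jx Jex] _; apply/eqP => xl; have [lj|lj] := eqVneq l j.
    by move: Jex; rewrite xl lj ltxx.
  by apply: (Jl _ lj); rewrite -xl.
have hu e : exists h, [/\ h (point bl (tt e)) = h1 (point bl (tt e)),
   (forall x, J (phi x) -> Je e (Imz x) -> ParC s B h x) & (forall x, Defs.hermitian (h x))].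
  have [|||h [hb hh hherm]] := @box_ParC J (Je e) (point bl (tt e)) (h1 (point bl (tt e))) Jo (Jeo e).
  - by rewrite phi_point.
  - by rewrite Im_point.
  - exact: npU.
  by exists h; split=> //; apply: hherm.
have [u hu'] := choice hu.
have hv e : exists h, [/\ h (point br (tt e)) = u e (point br (tt e)),
   (forall x, Jp (phi x) -> True -> ParC s B h x) & (forall x, Defs.hermitian (h x))].
  have [|||h [hb hh hherm]] := @box_ParC Jp (fun=> True) (point br (tt e)) (u e (point br (tt e))) Jpo interval_open_T.
  - by rewrite phi_point.
  - by [].
  - exact: npV.
  by exists h; split=> //; apply: hherm; case: (hu' e).
have [v hv'] := choice hv.
have boxseg (J1 J2 : R -> Prop) b x (h : C -> M2) : interval_open J1 -> interval_open J2 ->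
   (forall x, J1 (phi x) -> J2 (Imz x) -> ParC s B h x) -> J1 (phi b) -> J1 (phi x) ->
   J2 (Imz b) -> J2 (Imz x) -> forall t, 0 <= t <= 1 -> ParL s B h (b + t%:C * (x - b)).
  move=> [_ c1] [_ c2] hh p1 p2 p3 p4 t ht; apply/ParC_ParL/hh.
    by rewrite phi_seg; exact: c1.
  by rewrite Imz_seg; exact: c2.
have vG e : v e (point br 0) = G e.
  have [g1 g2] := hgood e; have [v1 v2 v3] := hv' e; have [u1 u2 u3] := hu' e.
  rewrite (transport_seg g2); last first.
    by apply: (boxseg Jp (fun=> True) _ _ _ Jpo interval_open_T v2); rewrite ?phi_point; try exact: I; split.
  rewrite v1 (transport_seg g1); last first.
    by apply: (boxseg J (Je e)) => //; rewrite ?phi_point.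
  by rewrite u1 /G ctrM !mulmxA.
have vE x : Jp (phi x) -> v true x = v false x.
  move=> Jx; apply: (@box_unique Jp (fun=> True) (point br 0)).
  - exact: Jpo.
  - exact: interval_open_T.
  - by rewrite phi_point; split.
  - exact: I.
  - exact: Jx.
  - exact: I.
  - exact: npV.
  - by case: (hv' true).
  - by case: (hv' false).
  - rewrite (vG true) (vG false); exact: GE.
have uv e x : Jp (phi x) -> Je e (Imz x) -> v true x = u e x.
  move=> Jx Jex; have -> : v true x = v e x by case: e {Jex} => //; exact: vE.
  have [v1 v2 v3] := hv' e; have [u1 u2 u3] := hu' e.
  apply: (@box_unique Jp (Je e) (point br (tt e))).
  - exact: Jpo.
  - exact: Jeo.
  - by rewrite phi_point; split.
  - by rewrite Im_point.
  - exact: Jx.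
  - exact: Jex.
  - by move=> y l Jy _; exact: npV.
  - by move=> y Jy _; exact: v2.
  - by move=> y [Jy _]; exact: u2.
  - exact: v1.
have hu1 e x : Jm (phi x) -> Je e (Imz x) -> h1 x = u e x.
  move=> Jx Jex; have [u1 u2 u3] := hu' e.
  apply: (@box_unique Jm (Je e) (point bl (tt e))).
  - exact: Jmo.
  - exact: Jeo.
  - by rewrite phi_point; split.
  - by rewrite Im_point.
  - exact: Jx.
  - exact: Jex.
  - by move=> y l [Jy _]; exact: npU.
  - by move=> y [Jy yj] Jey; apply: hh1 => // l; exact: npU Jey.
  - by move=> y [Jy _]; exact: u2.
  - by rewrite u1.
pose h2 x := if phi x < phi (s j) then h1 x else if phi (s j) < phi x then v true x
   else if Imz (s j) < Imz x then u true x else u false x.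
(* On each half strip all branches of [h2] agree. This settles the points with [phi x = phi (s j)],
   whose neighbourhoods meet several branches. *)
have h2u e x : J (phi x) -> Je e (Imz x) -> h2 x = u e x.
  move=> Jx Jex; rewrite /h2; case: ltP => [xj|jx]; first exact: hu1.
  case: ltP => [jx'|xj]; first exact: uv.
  by case: e Jex => /= he; [rewrite he|rewrite ltNge (ltW he)].
exists h2; split.
- move=> x; rewrite /h2; do ![case: ifP => _] => //.
  + by case: (hv' true).
  + by case: (hu' true).
  + by case: (hu' false).
- by move=> x xj; rewrite /h2 xj.
- by rewrite /h2 phi_point ltNge (ltW jbr) /= jbr; exact: vG.
move=> x npx hx; have [xj|jx|xj] := ltgtP (phi x) (phi (s j)).
- have [d' d'0 hd'] := phi_near x (ltac:(lra) : 0 < phi (s j) - phi x).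
  apply: ParC_near (hh1 _ xj npx); exists d' => // y /hd'; rewrite ltr_norml => /andP[_ h].
  by rewrite /h2 ifT//; lra.
- have Jx : Jp (phi x) by split=> //; case: hx => //; lra.
  have [d' d'0 hd'] := phi_near x (ltac:(lra) : 0 < phi x - phi (s j)).
  have [_ v2 _] := hv' true.
  apply: ParC_near (v2 x Jx I); exists d' => // y /hd'; rewrite ltr_norml => /andP[h _].
  by rewrite /h2 ifF ?ifT//; lra.
- have Jx : J (phi x) by case: hx => //; rewrite xj ltxx.
  have Jx' : exists e, Je e (Imz x).
    have [h|h|h] := ltgtP (Imz x) (Imz (s j)); [by exists false|by exists true|].
    have := npx j; rewrite (_ : x = s j) ?eqxx//; apply: complex_eqP => //.
    by move: xj; rewrite /phi h => /addIr.
  have [e Jex] := Jx'; have [_ u2 _] := hu' e.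
  have [e1 e10 he1] := Jo.1 _ Jx; have [e2 e20 he2] := (Jeo e).1 _ Jex.
  have [d' d'0 hd'] := phi_near x e10.
  apply: ParC_near (u2 x Jx Jex); exists (Num.min d' e2) => [|y]; first by rewrite lt_min d'0.
  rewrite lt_min => /andP[y1 y2]; symmetry; apply: h2u; first exact/he1/hd'.
  exact/he2/Im_near.
Qed.

End Gluing.

(** * Hermitian forms on the punctured line *)

Section Criterion.
Variable R : realType.
Notation C := R[i].
Notation M2 := 'M[C]_2.
Variables (s : 'I_3 -> C) (B : 'I_3 -> M2) (k : R) (bt : nat -> R) (T d beta : R) (n : nat).

Lemma lt00 : (0 : R) < 0 -> False. Proof. by rewrite ltxx. Qed.

Definition o0 : 'I_3 := @Ordinal 3 0 isT.
Definition o1 : 'I_3 := @Ordinal 3 1 isT.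
Definition o2 : 'I_3 := @Ordinal 3 2 isT.

Definition bpt i : C := point k (bt i) 0.
Definition cpt (e : bool) i : C := point k (bt i) (if e then T else - T).

Definition crossing (e : bool) (i : nat) : M2 :=
  Wseg s B n (bpt i) (cpt e i) *m
    (Wseg s B n (cpt e i) (cpt e i.+1) *m Wseg s B n (cpt e i.+1) (bpt i.+1)).

Fixpoint upper (i : nat) : M2 := if i is i'.+1 then upper i' *m crossing true i' else 1%:M.

Lemma crossingE e i : crossing e i = Wseg s B n (bpt i) (cpt e i) *m
    (Wseg s B n (cpt e i) (cpt e i.+1) *m Wseg s B n (cpt e i.+1) (bpt i.+1)).
Proof. by []. Qed.

Opaque Wseg crossing.

Lemma upperS i : upper i.+1 = upper i *m crossing true i. Proof. by []. Qed.

(** The earlier poles are passed above in both cases, so the two transports differ by a loop around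
    the single pole number [i]; the three loops generate the fundamental group of the punctured
    plane. *)
Definition Xmat i : M2 := upper i *m crossing true i.
Definition Ymat i : M2 := upper i *m crossing false i.

Definition sorted_config :=
  [/\ bt 0 < phi k (s o0) < bt 1, bt 1 < phi k (s o1) < bt 2, bt 2 < phi k (s o2) < bt 3 &
      forall j, - T < Imz (s j) < T].

Definition good_config := forall (e : bool) (i : nat), (i < 3)%N ->
  [/\ good s B d beta n (bpt i) (cpt e i), good s B d beta n (cpt e i) (cpt e i.+1) &
      good s B d beta n (cpt e i.+1) (bpt i.+1)].

Definition holonomy_eq (g : M2) :=
  forall i, (i < 3)%N -> ctr (Xmat i) *m g *m Xmat i = ctr (Ymat i) *m g *m Ymat i.

Hypothesis hsort : sorted_config.
Hypothesis hgood : good_config.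

Lemma good_nonpole b x t : good s B d beta n b x -> 0 <= t <= 1 -> nonpole s (b + t%:C * (x - b)).
Proof.
move=> [h _ _] ht j; have [d0 _ hd _] := h t ht.
by apply: contraTneq d0 => e; have := hd j; rewrite e subrr N1_0 -leNgt.
Qed.

Lemma ord3P (j : 'I_3) : [\/ j = o0, j = o1 | j = o2].
Proof.
case: j => -[|[|[|//]]] h; [apply: Or31|apply: Or32|apply: Or33]; exact: val_inj.
Qed.

Lemma phi_sorted : phi k (s o0) < phi k (s o1) /\ phi k (s o1) < phi k (s o2).
Proof. by case: hsort => /andP[? ?] /andP[? ?] /andP[? ?] _; split; lra. Qed.

Lemma dhl0 (x l : C) : dhl s B (fun=> 0) x l = 0.
Proof. by rewrite /dhl mulmx0 mul0mx addr0 oppr0. Qed.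

(** [g] is the value of [h] at the first base point. It cannot vanish: zero would spread to every
    [bpt] and [cpt], and each point off the poles shares a vertical strip with some [bpt] or, if its
    [phi] is that of a pole, a half strip with some [cpt]. *)
Lemma criterion_necessary (h : C -> M2) :
  (forall x, nonpole s x -> Defs.hermitian (h x)) -> (forall x, nonpole s x -> ParL s B h x) ->
  (exists x, nonpole s x /\ h x != 0) -> exists g, [/\ Defs.hermitian g, g != 0 & holonomy_eq g].
Proof.
move=> hherm hpar [x0 [x0p hx0]].
have tr b x : good s B d beta n b x -> h x = ctr (Wseg s B n b x) *m h b *m Wseg s B n b x.
  by move=> hg; apply: (transport_seg hg) => t ht; apply/hpar/(good_nonpole hg).
have hb e i : (i < 3)%N -> h (bpt i.+1) = ctr (crossing e i) *m h (bpt i) *m crossing e i.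
  move=> i3; have [g1 g2 g3] := hgood e i3.
  by rewrite (tr _ _ g3) (tr _ _ g2) (tr _ _ g1) !crossingE !ctrM !mulmxA.
have hK i : (i <= 3)%N -> h (bpt i) = ctr (upper i) *m h (bpt 0) *m upper i.
  elim: i => [|i IH] i3; first by rewrite /= ctr1 mul1mx mulmx1.
  rewrite (hb true i i3) (IH (ltnW i3)) upperS ctrM !mulmxA; reflexivity.
have b0p : nonpole s (bpt 0).
  have [g1 _ _] := hgood true (isT : (0 < 3)%N).
  by have := good_nonpole g1 (t := 0) ltac:(rewrite lexx ler01 //); rewrite mul0r addr0.
exists (h (bpt 0)); split; first exact: hherm.
  apply: contra_neq hx0 => h0.
  have hbi i : (i <= 3)%N -> h (bpt i) = 0 by move=> /hK ->; rewrite h0 mulmx0 mul0mx.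
  have hci e i : (i < 3)%N -> h (cpt e i) = 0.
    by move=> i3; have [g1 _ _] := hgood e i3; rewrite (tr _ _ g1) hbi 1?ltnW// mulmx0 mul0mx.
  have zero (J J' : R -> Prop) b x : interval_open J -> interval_open J' -> J (phi k b) ->
     J' (Imz b) -> J (phi k x) -> J' (Imz x) -> (forall x j, J (phi k x) -> J' (Imz x) -> x != s j) ->
     h b = 0 -> h x = 0.
    move=> [_ Jc] [_ J'c] Jb J'b Jx J'x hs hb0.
    have inb t : 0 <= t <= 1 -> nonpole s (b + t%:C * (x - b)).
      by move=> ht j; apply: hs; rewrite ?phi_seg ?Imz_seg; [exact: Jc|exact: J'c].
    have := @ParL_unique R s B b x h (fun=> 0); apply=> // [t j ht|t ht|t ht].
    - exact: inb.
    - exact/hpar/inb.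
    - by move=> v; rewrite dhl0; exact: mder_cst.
  have [lt1 lt2] := phi_sorted; have [/andP[s1 s2] /andP[s3 s4] /andP[s5 s6] sT] := hsort.
  have strip (J : R -> Prop) i : (i <= 3)%N -> interval_open J -> J (bt i) -> (forall j, ~ J (phi k (s j))) ->
     J (phi k x0) -> h x0 = 0.
    move=> i3 Jo Jb Js Jx; apply: (zero J (fun=> True) (bpt i)) => //; first exact: interval_open_T.
    - by rewrite phi_point.
    - by move=> x j Jx' _; apply: contra_not_neq (Js j) => <-.
    - exact: hbi.
  have cross (J : R -> Prop) j i : (i < 3)%N -> interval_open J -> J (bt i) ->
     (forall l, l != j -> ~ J (phi k (s l))) -> J (phi k (s j)) -> phi k x0 = phi k (s j) -> h x0 = 0.
    move=> i3 Jo Jb Jl Jj xj.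
    have [e Jex] : exists e : bool, if e then Imz (s j) < Imz x0 else Imz x0 < Imz (s j).
      have [hh|hh|hh] := ltgtP (Imz x0) (Imz (s j)); [by exists false|by exists true|].
      have := x0p j; rewrite (_ : x0 = s j) ?eqxx//; apply: complex_eqP => //.
      by move: xj; rewrite /phi hh => /addIr.
    apply: (zero J (fun t => if e then Imz (s j) < t else t < Imz (s j)) (cpt e i)) => //.
    - by case: e {Jex}; [exact: interval_open_gt|exact: interval_open_lt].
    - by rewrite phi_point.
    - by rewrite Im_point; case: e {Jex}; case/andP: (sT j).
    - by rewrite xj.
    - move=> x l Jx Jx'; apply/eqP => xl; have [lj|lj] := eqVneq l j.
        by move: Jx'; rewrite xl lj; case: e {Jex} => /=; rewrite ltxx.
      by apply: (Jl _ lj); rewrite -xl.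
    - exact: hci.
  have [a0|a0|a0] := ltgtP (phi k x0) (phi k (s o0)).
  - apply: (strip (fun t => t < phi k (s o0)) 0%N) => //; first exact: interval_open_lt.
    by move=> j /=; case: (ord3P j) => ->; apply/negP; rewrite -leNgt; lra.
  - have [a1|a1|a1] := ltgtP (phi k x0) (phi k (s o1)).
    + apply: (strip (fun t => phi k (s o0) < t /\ t < phi k (s o1)) 1%N) => //.
        by apply: interval_openI; [exact: interval_open_gt|exact: interval_open_lt].
      by move=> j /=; case: (ord3P j) => -> [? ?]; apply: lt00; lra.
    + have [a2|a2|a2] := ltgtP (phi k x0) (phi k (s o2)).
      * apply: (strip (fun t => phi k (s o1) < t /\ t < phi k (s o2)) 2%N) => //.
          by apply: interval_openI; [exact: interval_open_gt|exact: interval_open_lt].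
        by move=> j /=; case: (ord3P j) => -> [? ?]; apply: lt00; lra.
      * apply: (strip (fun t => phi k (s o2) < t) 3%N) => //; first exact: interval_open_gt.
        by move=> j /=; case: (ord3P j) => ->; apply/negP; rewrite -leNgt; lra.
      * apply: (cross (fun t => phi k (s o1) < t) o2 2%N) => //; first exact: interval_open_gt.
        by move=> l /=; case: (ord3P l) => -> //; [|]; move=> _; apply/negP; rewrite -leNgt; lra.
    + apply: (cross (fun t => phi k (s o0) < t /\ t < phi k (s o2)) o1 1%N) => //.
      * by apply: interval_openI; [exact: interval_open_gt|exact: interval_open_lt].
      * by split; lra.
      * by move=> l /=; case: (ord3P l) => -> // _ [? ?]; apply: lt00; lra.
  - apply: (cross (fun t => t < phi k (s o1)) o0 0%N) => //; first exact: interval_open_lt.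
    + by lra.
    + by move=> l /=; case: (ord3P l) => -> // _; apply/negP; rewrite -leNgt; lra.
move=> i i3; have e1 := hb true i i3; have e2 := hb false i i3.
rewrite (hK i (ltnW i3)) in e1 e2.
have compose (U V w : M2) : ctr (U *m V) *m w *m (U *m V) = ctr V *m (ctr U *m w *m U) *m V.
  by rewrite ctrM !mulmxA.
exact: etrans (etrans (compose _ _ _) (esym e1)) (etrans e2 (esym (compose _ _ _))).
Qed.

(** The construction starts in the half plane left of all poles and crosses them in order;
    conjugation by [upper i] turns the condition of [cross_step] into equation number [i] of
    [holonomy_eq]. *)
Lemma criterion_sufficient (g : M2) : Defs.hermitian g -> holonomy_eq g ->
  exists h : C -> M2, [/\ (forall x, Defs.hermitian (h x)), (forall x, nonpole s x -> ParC s B h x) &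
    h (bpt 0) = g].
Proof.
move=> gherm hol; have [lt1 lt2] := phi_sorted.
have [/andP[s1 s2] /andP[s3 s4] /andP[s5 s6] sT] := hsort.
have tri l j : phi k (s l) < phi k (s j) \/ l = j \/ phi k (s j) < phi k (s l).
  by case: (ord3P l) => ->; case: (ord3P j) => ->;
    first [by right; left | by left; lra | by right; right; lra].
have step (i : nat) (j : 'I_3) (J : R -> Prop) (h : C -> M2) : (i < 3)%N -> interval_open J ->
   J (phi k (s j)) -> (forall l, l != j -> ~ J (phi k (s l))) -> J (bt i) -> J (bt i.+1) ->
   bt i < phi k (s j) < bt i.+1 ->
   (forall x, Defs.hermitian (h x)) -> (forall x, phi k x < phi k (s j) -> nonpole s x -> ParC s B h x) ->
   h (bpt i) = ctr (upper i) *m g *m upper i ->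
   exists h2 : C -> M2, [/\ (forall x, Defs.hermitian (h2 x)),
     (forall x, phi k x < phi k (s j) -> h2 x = h x),
     h2 (bpt i.+1) = ctr (upper i.+1) *m g *m upper i.+1 &
     (forall x, nonpole s x -> phi k x < phi k (s j) \/ J (phi k x) -> ParC s B h2 x)].
  move=> i3 Jo Jj Jl Jbl Jbr /andP[bj jb] hherm hh hbi.
  have hc e : h (cpt e i) = ctr (Wseg s B n (bpt i) (cpt e i)) *m h (bpt i) *m Wseg s B n (bpt i) (cpt e i).
    have [g1 _ _] := hgood e i3; apply: (transport_seg g1) => t ht; apply/ParC_ParL/hh.
      by rewrite phi_seg !phi_point subrr mulr0 addr0.
    exact: good_nonpole g1 ht.
  have [|||h2 [e1 e2 e3 e4]] := @cross_step R s B k j J h (bt i) (bt i.+1) T d beta n Jo Jj Jl _ Jbl Jbr bj jb (sT j) hherm hh.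
  - by move=> l; exact: tri.
  - by move=> e; have [_ g2 g3] := hgood e i3.
  - have compose (U V W w : M2) :
        ctr (U *m (V *m W)) *m w *m (U *m (V *m W)) = ctr W *m (ctr V *m (ctr U *m w *m U) *m V) *m W.
      by rewrite !ctrM !mulmxA.
    have eqh e : ctr (Wseg s B n (cpt e i) (cpt e i.+1) *m Wseg s B n (cpt e i.+1) (bpt i.+1)) *m
        h (cpt e i) *m (Wseg s B n (cpt e i) (cpt e i.+1) *m Wseg s B n (cpt e i.+1) (bpt i.+1)) =
        ctr (upper i *m crossing e i) *m g *m (upper i *m crossing e i).
      rewrite hc hbi crossingE compose !ctrM; move: (Wseg _ _ _ _ _) (Wseg _ _ _ _ _) (Wseg _ _ _ _ _) => W1 W2 W3.
      by rewrite !mulmxA.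
    exact: etrans (eqh true) (etrans (hol i i3) (esym (eqh false))).
  have e3' : h2 (bpt i.+1) =
    ctr (Wseg s B n (cpt true i) (cpt true i.+1) *m Wseg s B n (cpt true i.+1) (bpt i.+1)) *m
    h (cpt true i) *m (Wseg s B n (cpt true i) (cpt true i.+1) *m Wseg s B n (cpt true i.+1) (bpt i.+1)) := e3.
  exists h2; split=> //; rewrite e3' hc hbi upperS !crossingE !ctrM !mulmxA.
  reflexivity.
have [| | | | |h0 [h0b h0p h0h]] := @box_ParC R s B k (fun t => t < phi k (s o0)) (fun=> True) (bpt 0) g.
- exact: interval_open_lt.
- exact: interval_open_T.
- by rewrite phi_point.
- by [].
- move=> x j /= xs _; apply: contraTneq xs => ->; rewrite -leNgt.
  by case: (ord3P j) => ->; lra.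
have [||||||||h1 [h1h h12 h1b h1p]] := step 0%N o0 (fun t => t < phi k (s o1)) h0 isT (interval_open_lt _).
- exact: lt1.
- by move=> l /=; case: (ord3P l) => -> // _; apply/negP; rewrite -leNgt; lra.
- by rewrite /=; lra.
- by rewrite /=; lra.
- by rewrite s1.
- by move=> x; exact: h0h.
- by move=> x xs _; exact: h0p.
- by rewrite /= ctr1 mul1mx mulmx1.
have [||||||||h2 [h2h h22 h2b h2p]] := step 1%N o1 (fun t => phi k (s o0) < t /\ t < phi k (s o2)) h1 isT
  (interval_openI (interval_open_gt _) (interval_open_lt _)).
- by split.
- by move=> l /=; case: (ord3P l) => -> // _ [? ?]; apply: lt00; lra.
- by split; lra.
- by split; lra.
- by rewrite s3.
- exact: h1h.
- by move=> x xs xp; apply: h1p => //; right.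
- exact: h1b.
have [||||||||h3 [h3h h32 h3b h3p]] := step 2%N o2 (fun t => phi k (s o1) < t) h2 isT (interval_open_gt _).
- exact: lt2.
- by move=> l /=; case: (ord3P l) => -> // _; apply/negP; rewrite -leNgt; lra.
- by rewrite /=; lra.
- by rewrite /=; lra.
- by rewrite s5.
- exact: h2h.
- move=> x xs xp; apply: h2p => //; have [a|a] := ltP (phi k x) (phi k (s o1)); first by left.
  by right; split; lra.
- exact: h2b.
exists h3; split=> //.
  move=> x xp; apply: h3p => //; have [a|a] := ltP (phi k x) (phi k (s o2)); first by left.
  by right; lra.
by rewrite h32 ?h22 ?h12//; rewrite phi_point; lra.
Qed.

End Criterion.

(** * The projections in closed form *)

Section TwoByTwo.
Variable R : realType.
Notation C := R[i].
Notation M2 := 'M[C]_2.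

Lemma ord2P (i : 'I_2) : i = ord0 \/ i = ord_max.
Proof. by case: i => -[|[|//]] h; [left|right]; exact: val_inj. Qed.

Lemma sum2 (V : nmodType) (F : 'I_2 -> V) : \sum_i F i = F ord0 + F ord_max.
Proof. by rewrite big_ord_recl big_ord1; congr (_ + F _); exact: val_inj. Qed.

Lemma sum4 (V : nmodType) (F : 'I_4 -> V) :
  \sum_i F i = F (@Ordinal 4 0 isT) + F (@Ordinal 4 1 isT) + F (@Ordinal 4 2 isT) + F (@Ordinal 4 3 isT).
Proof.
by rewrite !big_ord_recl big_ord0 addr0 !addrA; congr (F _ + F _ + F _ + F _); exact: val_inj.
Qed.

Lemma matrix2P (A B : M2) : A ord0 ord0 = B ord0 ord0 -> A ord0 ord_max = B ord0 ord_max ->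
  A ord_max ord0 = B ord_max ord0 -> A ord_max ord_max = B ord_max ord_max -> A = B.
Proof. by move=> h1 h2 h3 h4; apply/matrixP => i j; case: (ord2P i) => ->; case: (ord2P j) => ->. Qed.

Lemma colvec2P (u v : 'cV[C]_2) : u ord0 ord0 = v ord0 ord0 -> u ord_max ord0 = v ord_max ord0 -> u = v.
Proof. by move=> h1 h2; apply/matrixP => i j; rewrite ord1; case: (ord2P i) => ->. Qed.

Definition mx22 (a b c d : C) : M2 :=
  \matrix_(i, j) if i == ord0 then (if j == ord0 then a else b) else (if j == ord0 then c else d).

Definition cv2 (a b : C) : 'cV[C]_2 := \col_i if i == ord0 then a else b.

Lemma mx22_00 a b c d : mx22 a b c d ord0 ord0 = a. Proof. by rewrite mxE. Qed.
Lemma mx22_01 a b c d : mx22 a b c d ord0 ord_max = b. Proof. by rewrite mxE. Qed.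
Lemma mx22_10 a b c d : mx22 a b c d ord_max ord0 = c. Proof. by rewrite mxE. Qed.
Lemma mx22_11 a b c d : mx22 a b c d ord_max ord_max = d. Proof. by rewrite mxE. Qed.
Lemma cv2_0 a b : cv2 a b ord0 ord0 = a. Proof. by rewrite mxE. Qed.
Lemma cv2_1 a b : cv2 a b ord_max ord0 = b. Proof. by rewrite mxE. Qed.
Definition mx22E := (mx22_00, mx22_01, mx22_10, mx22_11, cv2_0, cv2_1).

Lemma mul22 (A : M2) (v : 'M[C]_(2, 1)) i : (A *m v) i ord0 = A i ord0 * v ord0 ord0 + A i ord_max * v ord_max ord0.
Proof. by rewrite mxE sum2. Qed.

Lemma mulmx22 (A B : M2) i j : (A *m B) i j = A i ord0 * B ord0 j + A i ord_max * B ord_max j.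
Proof. by rewrite mxE sum2. Qed.

Lemma det22 (A : M2) : \det A = A ord0 ord0 * A ord_max ord_max - A ord0 ord_max * A ord_max ord0.
Proof.
rewrite (expand_det_row A ord0) sum2 /cofactor !det_mx11 !mxE /= expr0 expr1 mul1r mulN1r mulrN.
by congr (_ * A _ _ - _ * A _ _); exact: val_inj.
Qed.

Lemma hformE (H : M2) (v w : 'cV[C]_2) : hform H v w =
  conjc (w ord0 ord0) * (H ord0 ord0 * v ord0 ord0 + H ord0 ord_max * v ord_max ord0) +
  conjc (w ord_max ord0) * (H ord_max ord0 * v ord0 ord0 + H ord_max ord_max * v ord_max ord0).
Proof. by rewrite /hform /ctr mxE sum2 !mul22 !mxE. Qed.

Lemma hermitian_conj (H : M2) i j : Defs.hermitian H -> conjc (H j i) = H i j.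
Proof. by move=> h; rewrite -[in RHS]h !mxE. Qed.

Lemma hformC (H : M2) v w : Defs.hermitian H -> hform H w v = conjc (hform H v w).
Proof.
move=> h; rewrite !hformE !(rmorphD, rmorphM) /= !conjcK !(hermitian_conj _ _ h).
by ring.
Qed.

Lemma hformB (H : M2) u v w : hform H (u - v) w = hform H u w - hform H v w.
Proof. by rewrite !hformE !mxE; ring. Qed.

Definition lrow (lam : C) (i : 'I_4) : C * C :=
  match val i with 0 => (1, 0) | 1 => (0, 1) | 2 => (-1, 1) | _ => (1, - lam) end.

Lemma ellE lam i (v : 'cV[C]_2) : ell lam i v = (lrow lam i).1 * v ord0 ord0 + (lrow lam i).2 * v ord_max ord0.
Proof.
by rewrite /ell /lrow /zco /wco; case: i => -[|[|[|[|//]]]] h /=; ring.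
Qed.

(* H = [[q, -s], [-s^*, p]] with p q - |s|^2 = 1, so that H^-1 = [[p, s], [s^*, q]]. *)
Section Projections.
Variables (p q s : C) (lam : C).
Let H := mx22 q (- s) (- conjc s) p.
Hypothesis Hpos : posdef H.
Hypothesis Hdet : p * q - s * conjc s = 1.

(** The inverse of [H] applied to the adjoint of the row [l]: [gvec l] spans the orthogonal
    complement of the line [l = 0], and [dnorm l] is the squared length of [l] in the dual form. *)
Definition gvec (l : C * C) : C * C := (p * conjc l.1 + s * conjc l.2, conjc s * conjc l.1 + q * conjc l.2).
Definition dnorm (l : C * C) : C := l.1 * (gvec l).1 + l.2 * (gvec l).2.
Definition Pmat (l : C * C) : M2 :=
  mx22 ((gvec l).1 * l.1 / dnorm l) ((gvec l).1 * l.2 / dnorm l)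
       ((gvec l).2 * l.1 / dnorm l) ((gvec l).2 * l.2 / dnorm l).

Let pc : conjc p = p.
Proof. by case: Hpos => h _; have := hermitian_conj ord_max ord_max h; rewrite !mx22E. Qed.
Let qc : conjc q = q.
Proof. by case: Hpos => h _; have := hermitian_conj ord0 ord0 h; rewrite !mx22E. Qed.

Lemma lrow_neq0 i : lrow lam i != (0, 0).
Proof.
by rewrite /lrow; case: i => -[|[|[|[|//]]]] h /=; rewrite xpair_eqE ?oner_eq0 ?oppr_eq0 ?oner_eq0 ?andbF.
Qed.

Lemma hform_H_gvec l (v : 'cV[C]_2) : hform H v (cv2 (gvec l).1 (gvec l).2) = l.1 * v ord0 ord0 + l.2 * v ord_max ord0.
Proof.
rewrite hformE !mx22E /gvec /= !(rmorphD, rmorphM) /= !conjcK pc qc.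
transitivity ((p * q - s * conjc s) * (l.1 * v ord0 ord0 + l.2 * v ord_max ord0)); first by ring.
by rewrite Hdet mul1r.
Qed.

Lemma dnorm_gt0 l : l != (0, 0) -> 0 < dnorm l.
Proof.
move=> l0; have := Hpos.2 (cv2 (gvec l).1 (gvec l).2).
rewrite hform_H_gvec !mx22E; apply; apply: contra l0 => /eqP h.
have g1 : (gvec l).1 = 0 by have := congr1 (fun v : 'cV[C]_2 => v ord0 ord0) h; rewrite !mxE.
have g2 : (gvec l).2 = 0 by have := congr1 (fun v : 'cV[C]_2 => v ord_max ord0) h; rewrite !mxE.
have e1 : conjc l.1 = 0.
  transitivity (q * (gvec l).1 - s * (gvec l).2); last by rewrite g1 g2 !mulr0 subrr.
  rewrite /gvec /=; transitivity ((p * q - s * conjc s) * conjc l.1); last by ring.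
  by rewrite Hdet mul1r.
have e2 : conjc l.2 = 0.
  transitivity (p * (gvec l).2 - conjc s * (gvec l).1); last by rewrite g1 g2 !mulr0 subrr.
  rewrite /gvec /=; transitivity ((p * q - s * conjc s) * conjc l.2); last by ring.
  by rewrite Hdet mul1r.
by case: l e1 e2 {h g1 g2} => l1 l2 /= /eqP; rewrite conjc_eq0 => /eqP -> /eqP; rewrite conjc_eq0 => /eqP ->.
Qed.

(** Two orthogonal projections of [v] differ by a vector that lies in the subspace and is orthogonal
    to it, so it vanishes by positivity; this identifies the value chosen by [xget]. *)
Lemma projL_Pmat i : projL lam H i = Pmat (lrow lam i).
Proof.
set l := lrow lam i; have d0 := dnorm_gt0 (lrow_neq0 i); rewrite -/l in d0.
have dn0 : dnorm l != 0 by rewrite gt_eqF.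
have Hh := Hpos.1.
have Pv (v : 'cV[C]_2) : Pmat l *m v = ((l.1 * v ord0 ord0 + l.2 * v ord_max ord0) / dnorm l) *: cv2 (gvec l).1 (gvec l).2.
  by apply: colvec2P; rewrite mul22 !mxE /=; field.
have hP : is_orthproj H (orthc H (line lam i)) (Pmat l).
  move=> v; rewrite Pv; split.
    move=> u; rewrite /line /= ellE -/l => lu.
    rewrite hformC//.
    have -> : hform H u ((l.1 * v ord0 ord0 + l.2 * v ord_max ord0) / dnorm l *: cv2 (gvec l).1 (gvec l).2) =
      conjc ((l.1 * v ord0 ord0 + l.2 * v ord_max ord0) / dnorm l) * hform H u (cv2 (gvec l).1 (gvec l).2).
      by rewrite !hformE !mxE /= !rmorphM /=; ring.
    by rewrite hform_H_gvec lu mulr0 conjc0.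
  move=> u hu; rewrite hformC// hu ?conjc0//.
  rewrite /line /= ellE -/l !mxE /=.
  set c := l.1 * v _ _ + _.
  have -> : l.1 * (v ord0 ord0 - c / dnorm l * (gvec l).1) + l.2 * (v ord_max ord0 - c / dnorm l * (gvec l).2) =
    c - c / dnorm l * dnorm l by rewrite /dnorm /c; ring.
  by rewrite divfK// subrr.
rewrite /projL /orthproj; set Q := xget _ _.
have hQ : is_orthproj H (orthc H (line lam i)) Q by rewrite /Q; exact: (xgetPex (0 : M2) (ex_intro (fun P => is_orthproj H (orthc H (line lam i)) P) _ hP)).
apply/matrixP => a b.
suff E (v : 'cV[C]_2) : Q *m v = Pmat l *m v.
  by have /matrixP/(_ a ord0) := E (delta_mx b ord0); rewrite -!colE !mxE.
have [h1 h2] := hP v; have [h3 h4] := hQ v.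
have hd : orthc H (line lam i) (Q *m v - Pmat l *m v).
  by move=> u hu; rewrite hformB h1// h3// subrr.
have := h2 _ hd; have := h4 _ hd; rewrite !hformB => e1 e2.
have e3 : hform H (Q *m v - Pmat l *m v) (Q *m v - Pmat l *m v) = 0.
  rewrite hformB; move: e1 e2; set x := hform _ v _; set y := hform _ _ _; set z := hform _ _ _ => e1 e2.
  by transitivity ((x - z) - (x - y)); [ring|rewrite e1 e2 subrr].
apply/eqP; rewrite -subr_eq0; apply: contra_eqT e3 => nz.
by rewrite gt_eqF// Hpos.2.
Qed.

End Projections.

End TwoByTwo.

Arguments conjc : simpl never.

Section Conjugation.
Variable R : realType.
Implicit Types z w : R[i].
Lemma cjD z w : conjc (z + w) = conjc z + conjc w. Proof. exact: rmorphD. Qed.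
Lemma cjN z : conjc (- z) = - conjc z. Proof. exact: rmorphN. Qed.
Lemma cjB z w : conjc (z - w) = conjc z - conjc w. Proof. exact: rmorphB. Qed.
Lemma cjM z w : conjc (z * w) = conjc z * conjc w. Proof. exact: rmorphM. Qed.
Lemma cjV z : conjc z^-1 = (conjc z)^-1. Proof. exact: fmorphV. Qed.
Lemma cj1 : conjc (1 : R[i]) = 1. Proof. exact: rmorph1. Qed.
Lemma cj0 : conjc (0 : R[i]) = 0. Proof. exact: rmorph0. Qed.
Lemma cjR (x : R) : conjc (x%:C) = x%:C. Proof. exact: conjc_real. Qed.
Definition cjE := (cjD, cjN, cjM, cjV, cj1, cj0, cjR, conjcK).
End Conjugation.

(** * The balanced form and its four projections *)

Section Balanced.
Variable R : realType.
Notation C := R[i].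
Notation M2 := 'M[C]_2.

(* Each equation is one of the trace conditions tr (P_i (sum_j P_j)) = 2. *)
Lemma balanced_real (p q D3 D4 M N : R) : 0 < p -> 0 < q -> 0 < D3 -> 0 < D4 -> 0 < M -> 0 < N ->
  2 * p = q^-1 + D3^-1 + M / D4 -> 2 * q = p^-1 + D3^-1 + D4^-1 ->
  2 * D3 = p^-1 + q^-1 + N / D4 -> 2 * D4 = M / p + q^-1 + N / D3 ->
  [/\ p = Num.sqrt M * q, D3 = Num.sqrt N * q & D4 = Num.sqrt M * Num.sqrt N * q].
Proof.
move=> p0 q0 D30 D40 M0 N0 E1 E2 E3 E4.
set ip := p^-1 in E1 E2 E3 E4 *; set iq := q^-1 in E1 E2 E3 E4 *.
set i3 := D3^-1 in E1 E2 E3 E4 *; set i4 := D4^-1 in E1 E2 E3 E4 *.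
have pip : p * ip = 1 by rewrite mulfV ?gt_eqF.
have qiq : q * iq = 1 by rewrite mulfV ?gt_eqF.
have D3i : D3 * i3 = 1 by rewrite mulfV ?gt_eqF.
have D4i : D4 * i4 = 1 by rewrite mulfV ?gt_eqF.
have R1 : 2 = ip * iq + ip * i3 + M * ip * i4 :> R.
  by transitivity (2 * p * ip); [rewrite -mulrA pip mulr1|rewrite E1; ring].
have R2 : 2 = ip * iq + iq * i3 + iq * i4 :> R.
  by transitivity (2 * q * iq); [rewrite -mulrA qiq mulr1|rewrite E2; ring].
have R3 : 2 = ip * i3 + iq * i3 + N * i3 * i4 :> R.
  by transitivity (2 * D3 * i3); [rewrite -mulrA D3i mulr1|rewrite E3; ring].
have R4 : 2 = M * ip * i4 + iq * i4 + N * i3 * i4 :> R.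
  by transitivity (2 * D4 * i4); [rewrite -mulrA D4i mulr1|rewrite E4; ring].
(* The six products are weights on the edges of a complete graph with vertices [p], [q], [D3], [D4],
   and [R1] to [R4] say that the weights at each vertex add up to [2]. Adding two equations and
   subtracting the others shows that opposite edges have equal weight. *)
have F1 : ip * iq = N * i3 * i4 by lra.
have F2 : ip * i3 = iq * i4 by lra.
have F3 : M * ip * i4 = iq * i3 by lra.
have G1 : D3 * D4 = N * p * q.
  transitivity (D3 * D4 * p * q * (ip * iq)); last first.
    by rewrite F1; transitivity (N * p * q * (D3 * i3) * (D4 * i4)); [ring|rewrite D3i D4i; ring].
  by transitivity (D3 * D4 * (p * ip) * (q * iq)); [rewrite pip qiq; ring|ring].
have G2 : q * D4 = p * D3.
  transitivity (q * D4 * p * D3 * (ip * i3)).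
    by transitivity (q * D4 * (p * ip) * (D3 * i3)); [rewrite pip D3i; ring|ring].
  by rewrite F2; transitivity (p * D3 * (q * iq) * (D4 * i4)); [ring|rewrite qiq D4i; ring].
have G3 : M * q * D3 = p * D4.
  transitivity (p * q * D3 * D4 * (M * ip * i4)).
    by transitivity (M * q * D3 * (p * ip) * (D4 * i4)); [rewrite pip D4i; ring|ring].
  by rewrite F3; transitivity (p * D4 * (q * iq) * (D3 * i3)); [ring|rewrite qiq D3i; ring].
have sM := sqr_sqrtr (ltW M0); have sN := sqr_sqrtr (ltW N0).
have mp : 0 < Num.sqrt M by rewrite sqrtr_gt0.
have np : 0 < Num.sqrt N by rewrite sqrtr_gt0.
set m := Num.sqrt M in sM mp *; set n := Num.sqrt N in sN np *.
have Hp : p = m * q.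
  apply/eqP; rewrite -(eqrXn2 (n := 2))//; [apply/eqP|exact: ltW|exact: ltW (mulr_gt0 _ _)].
  rewrite exprMn sM; apply: (mulIf (x := D3)); first by rewrite gt_eqF.
  by transitivity (q * (M * q * D3)); [rewrite G3; transitivity (p * (p * D3)); [ring|rewrite -G2; ring]|ring].
have HD4 : D4 = m * D3.
  apply: (mulfI (x := q)); first by rewrite gt_eqF.
  by rewrite G2 Hp; ring.
have HD3 : D3 = n * q.
  apply/eqP; rewrite -(eqrXn2 (n := 2))//; [apply/eqP|exact: ltW|exact: ltW (mulr_gt0 _ _)].
  apply: (mulfI (x := m)); first by rewrite gt_eqF.
  by rewrite exprMn sN; transitivity (D3 * D4); [rewrite HD4; ring|rewrite G1 Hp; ring].
by split=> //; rewrite HD4 HD3; ring.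
Qed.

Definition cabs (z : C) : R := Num.sqrt (Rez z ^+ 2 + Imz z ^+ 2).

Lemma cabs_sqr (z : C) : (cabs z ^+ 2)%:C = z * conjc z.
Proof.
rewrite sqr_sqrtr ?addr_ge0 ?sqr_ge0//; case: z => x y /=.
by apply: complex_eqP => /=; ring.
Qed.

Lemma cabs_gt0 (z : C) : z != 0 -> 0 < cabs z.
Proof.
move=> z0; rewrite sqrtr_gt0 lt_neqAle addr_ge0 ?sqr_ge0// andbT eq_sym.
rewrite paddr_eq0 ?sqr_ge0// !sqrf_eq0; apply: contra z0 => /andP[/eqP h /eqP h'].
by apply/eqP/complex_eqP.
Qed.

(** The ratio [s / q] in the balanced form: with [m = |lam|] and [n = |1 - lam|], put [D3 = n q] and
    [D4 = m n q] into the off-diagonal equation [2 s = 1 / D3 + lam / D4] and use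
    [2 m n q^2 = 1 + m + n]. The projections depend only on ratios, so [q] disappears from them. *)
Definition uu (lam : C) : C := ((cabs lam)%:C + lam) / (1 + cabs lam + cabs (1 - lam))%:C.

Definition Aex (lam : C) (i : 'I_4) : M2 :=
  let m := (cabs lam)%:C in let n := (cabs (1 - lam))%:C in let u := uu lam in
  match val i with
  | 0 => mx22 1 0 (conjc u / m) 0
  | 1 => mx22 0 u 0 1
  | 2 => mx22 ((m - u) / n) ((u - m) / n) ((conjc u - 1) / n) ((1 - conjc u) / n)
  | _ => mx22 ((m - u * conjc lam) / (m * n)) (- (m - u * conjc lam) * lam / (m * n))
              ((conjc u - conjc lam) / (m * n)) (- (conjc u - conjc lam) * lam / (m * n))
  end.

Section Fixed.
Variable lam : C.
Hypotheses (lam0 : lam != 0) (lam1 : lam != 1).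
Let m := cabs lam.
Let n := cabs (1 - lam).
Let u := uu lam.

Let m0 : 0 < m. Proof. exact: cabs_gt0. Qed.
Let n0 : 0 < n. Proof. by apply: cabs_gt0; rewrite subr_eq0 eq_sym. Qed.
Let mC : m%:C != 0 :> C. Proof. by rewrite (inj_eq (@complexI R)) gt_eqF. Qed.
Let nC : n%:C != 0 :> C. Proof. by rewrite (inj_eq (@complexI R)) gt_eqF. Qed.
Let SC : 1 + m%:C + n%:C != 0 :> C.
Proof.
by rewrite -(rmorph1 (real_complex R)) -!rmorphD (inj_eq (@complexI R)) gt_eqF// !addr_gt0.
Qed.

Let mm : m%:C ^+ 2 = lam * conjc lam :> C.
Proof. by rewrite -rmorphXn; exact: cabs_sqr. Qed.

Let nn : n%:C ^+ 2 = 1 - lam - conjc lam + m%:C ^+ 2 :> C.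
Proof.
transitivity ((1 - lam) * conjc (1 - lam)); first by rewrite -rmorphXn; exact: cabs_sqr.
by rewrite mm !cjE; ring.
Qed.

Let uE : u = (m%:C + lam) / (1 + m%:C + n%:C).
Proof. by rewrite /u /uu !rmorphD. Qed.

Let ucE : conjc u = (m%:C + conjc lam) / (1 + m%:C + n%:C).
Proof. by rewrite uE !cjE. Qed.

Lemma Pmat_Aex (p q s : C) i : q != 0 -> p = m%:C * q -> s = u * q -> conjc q = q ->
  Pmat p q s (lrow lam i) = Aex lam i.
Proof.
move=> q0 -> -> qc.
have sc : conjc (u * q) = conjc u * q by rewrite cjM qc.
have d3 : dnorm (m%:C * q) q (u * q) (-1, 1) = n%:C * q.
  rewrite /dnorm /gvec /= sc ?cjN ?cj1 ?cj0 ucE uE.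
  transitivity (((1 + m%:C) * (1 + m%:C + n%:C) - (2 * m%:C + lam + conjc lam)) / (1 + m%:C + n%:C) * q).
    by field.
  congr (_ * _); apply: (mulIf SC); rewrite divfK//.
  transitivity (1 + m%:C ^+ 2 - lam - conjc lam + n%:C * (1 + m%:C)); first by ring.
  have -> : 1 + m%:C ^+ 2 - lam - conjc lam = n%:C ^+ 2 by rewrite nn; ring.
  by ring.
have d4 : dnorm (m%:C * q) q (u * q) (1, - lam) = m%:C * n%:C * q.
  rewrite /dnorm /gvec /= sc ?cjN ?cj1 ?cj0 ucE uE.
  transitivity ((m%:C * (1 + m%:C + n%:C) - (2 * (lam * conjc lam) + m%:C * (lam + conjc lam)) + lam * conjc lam * (1 + m%:C + n%:C)) / (1 + m%:C + n%:C) * q).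
    by field.
  congr (_ * _); apply: (mulIf SC); rewrite divfK// -mm.
  transitivity (m%:C * (1 + m%:C ^+ 2 - lam - conjc lam + n%:C * (1 + m%:C))); first by ring.
  have -> : 1 + m%:C ^+ 2 - lam - conjc lam = n%:C ^+ 2 by rewrite nn; ring.
  by ring.
rewrite /Pmat /Aex -/m -/n -/u; case: i => -[|[|[|[|//]]]] hi; rewrite /lrow /=.
- rewrite /dnorm /gvec /= sc ?cjN ?cj1 ?cj0; apply: matrix2P; rewrite !mx22E; field; do ?[apply/andP; split] => //.
- rewrite /dnorm /gvec /= sc ?cjN ?cj1 ?cj0; apply: matrix2P; rewrite !mx22E; field; do ?[apply/andP; split] => //.
- rewrite d3 /gvec /= sc ?cjN ?cj1 ?cj0; apply: matrix2P; rewrite !mx22E; field; do ?[apply/andP; split] => //.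
- rewrite d4 /gvec /= sc ?cjN ?cj1 ?cj0; apply: matrix2P; rewrite !mx22E; field; do ?[apply/andP; split] => //.
Qed.

Let uS : u * (1 + m%:C + n%:C) = m%:C + lam.
Proof. by rewrite uE divfK. Qed.

Let ucS : conjc u * (1 + m%:C + n%:C) = m%:C + conjc lam.
Proof. by rewrite ucE divfK. Qed.

Let key : (m%:C + lam) * (m%:C + conjc lam) = m%:C * (1 + m%:C - n%:C) * (1 + m%:C + n%:C).
Proof.
transitivity (m%:C * (2 * m%:C + lam + conjc lam)).
  by transitivity (m%:C ^+ 2 + m%:C * (lam + conjc lam) + lam * conjc lam); [ring|rewrite -mm; ring].
transitivity (m%:C * ((1 + m%:C) ^+ 2 - n%:C ^+ 2)); last by ring.
by rewrite nn; ring.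
Qed.

Let ku : u * (m%:C + conjc lam) = m%:C * (1 + m%:C - n%:C).
Proof. by apply: (mulIf SC); rewrite -key -uS; ring. Qed.

Let kuc : conjc u * (m%:C + lam) = m%:C * (1 + m%:C - n%:C).
Proof. by apply: (mulIf SC); rewrite -key -ucS; ring. Qed.

Lemma kuc_conj : uu lam * (m%:C + conjc lam) = m%:C * (1 + m%:C - n%:C).
Proof. exact: ku. Qed.

Lemma Aex_sum : \sum_i Aex lam i = 2%:M.
Proof.
rewrite sum4 /Aex /= -/m -/n -/u.
have mnC : m%:C * n%:C != 0 by rewrite mulf_neq0.
apply: matrix2P; rewrite !mxE /=; apply: (mulIf mnC).
- transitivity (m%:C * n%:C + m%:C ^+ 2 + m%:C - u * (m%:C + conjc lam)).
    by field; do ?[apply/andP; split] => //.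
  by rewrite ku; ring.
- transitivity (m%:C * (u * (1 + n%:C)) - m%:C ^+ 2 - m%:C * lam + u * (lam * conjc lam)).
    by field; do ?[apply/andP; split] => //.
  rewrite -mm; transitivity (m%:C * (u * (1 + m%:C + n%:C)) - m%:C * (m%:C + lam)); first by ring.
  by rewrite uS; ring.
- transitivity (conjc u * (1 + m%:C + n%:C) - (m%:C + conjc lam)).
    by field; do ?[apply/andP; split] => //.
  by rewrite ucS; ring.
- transitivity (m%:C * n%:C + m%:C - conjc u * (m%:C + lam) + lam * conjc lam).
    by field; do ?[apply/andP; split] => //.
  by rewrite kuc -mm; ring.
Qed.

End Fixed.

Lemma posdef22 (p q s : C) : 0 < q -> conjc p = p -> p * q - s * conjc s = 1 ->
  posdef (mx22 q (- s) (- conjc s) p).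
Proof.
move=> q0 pc det; have qc : conjc q = q.
  by move: q0; rewrite ltcE => /andP[/eqP h _]; apply: complex_eqP; rewrite ?RezJ// ImzJ h oppr0.
split.
  by apply: matrix2P; rewrite /ctr !mxE /= ?cjN ?conjcK.
move=> v v0; rewrite -(pmulr_rgt0 _ q0) hformE !mx22E.
set a := v ord0 ord0; set b := v ord_max ord0.
have -> : q * (conjc a * (q * a + - s * b) + conjc b * (- conjc s * a + p * b)) =
   (q * a - s * b) * conjc (q * a - s * b) + b * conjc b.
  rewrite cjB !cjM qc.
  transitivity ((q * a - s * b) * (q * conjc a - conjc s * conjc b) + (p * q - s * conjc s) * b * conjc b).
    by ring.
  by rewrite det mul1r.
have pos (z : C) : z != 0 -> 0 < z * conjc z.
  by move=> z0; rewrite lt_neqAle mulcJ_ge0 andbT eq_sym mulf_neq0// conjc_eq0.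
have [b0|b0] := eqVneq b 0; last by apply: ltr_wpDl; [exact: mulcJ_ge0|exact: pos].
rewrite b0 mul0r addr0 mulr0 subr0; apply: pos; apply: mulf_neq0; first by rewrite gt_eqF.
by apply: contra v0 => /eqP a0; apply/eqP/colvec2P; rewrite mxE.
Qed.

Lemma gt0_real (z : C) : 0 < z -> exists2 r : R, 0 < r & z = r%:C.
Proof.
rewrite ltcE => /andP[/eqP h1 h2]; exists (Rez z) => //.
by apply: complex_eqP.
Qed.

Lemma is_Hlam_exists (lam : C) : lam != 0 -> lam != 1 -> exists H, is_Hlam lam H.
Proof.
move=> lam0 lam1.
have m0 : 0 < cabs lam by exact: cabs_gt0.
have n0 : 0 < cabs (1 - lam) by apply: cabs_gt0; rewrite subr_eq0 eq_sym.
set m := cabs lam in m0; set n := cabs (1 - lam) in n0.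
(* This is the square of [q], forced by the determinant condition, since
   [m - |u|^2 = 2 m n / (1 + m + n)]. *)
pose Q := (1 + m + n) / (2 * m * n).
have Q0 : 0 < Q by rewrite divr_gt0 ?mulr_gt0//; lra.
pose q := (Num.sqrt Q)%:C : C.
have q0 : 0 < q by rewrite ltcR sqrtr_gt0.
have qq : q * q = Q%:C by rewrite -rmorphM -expr2 sqr_sqrtr// ltW.
have SC : (1 + m + n)%:C != 0 :> C by rewrite (inj_eq (@complexI R)) gt_eqF//; lra.
have mC : m%:C != 0 :> C by rewrite (inj_eq (@complexI R)) gt_eqF.
have nC : n%:C != 0 :> C by rewrite (inj_eq (@complexI R)) gt_eqF.
have qc : conjc q = q by exact: cjR.
pose p := m%:C * q; pose s := uu lam * q.
have pc : conjc p = p by rewrite cjM qc cjR.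
have det : p * q - s * conjc s = 1.
  rewrite /s cjM qc; transitivity (q * q * (m%:C - uu lam * conjc (uu lam))); first by rewrite /p; ring.
  have E : uu lam * conjc (uu lam) = m%:C * (1 + m%:C - n%:C) / (1 + m + n)%:C.
    rewrite {2}/uu cjM cjV cjD !cjR mulrA; congr (_ / _); exact: kuc_conj.
  rewrite qq E /Q !(rmorphM, fmorphV, rmorphD) /=.
  field; rewrite mC nC; move: SC; rewrite !rmorphD => ->.
  by [].
exists (mx22 q (- s) (- conjc s) p); have Hpos := posdef22 q0 pc det.
split=> //; split.
  by rewrite det22 !mx22E; move: det; rewrite mulrC mulrN mulNr opprK => <-; ring.
exists 2; rewrite -(Aex_sum lam0 lam1); apply: eq_bigr => i _.
by rewrite (projL_Pmat _ Hpos det) (Pmat_Aex lam0 lam1)// gt_eqF.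
Qed.

(** Multiplying by [H] makes the projection a rank one Hermitian matrix, so the balancing condition
    compares a multiple of [H] with a weighted sum of four explicit matrices. *)
Lemma Pmat_mulH (p q s : C) l : p * q - s * conjc s = 1 ->
  mx22 q (- s) (- conjc s) p *m Pmat p q s l =
  (dnorm p q s l)^-1 *: mx22 (conjc l.1 * l.1) (conjc l.1 * l.2) (conjc l.2 * l.1) (conjc l.2 * l.2).
Proof.
move=> det; apply: matrix2P; rewrite mulmx22 !mxE /=.
- transitivity ((dnorm p q s l)^-1 * ((p * q - s * conjc s) * (conjc l.1 * l.1))); first by rewrite /gvec /=; ring.
  by rewrite det mul1r.
- transitivity ((dnorm p q s l)^-1 * ((p * q - s * conjc s) * (conjc l.1 * l.2))); first by rewrite /gvec /=; ring.
  by rewrite det mul1r.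
- transitivity ((dnorm p q s l)^-1 * ((p * q - s * conjc s) * (conjc l.2 * l.1))); first by rewrite /gvec /=; ring.
  by rewrite det mul1r.
- transitivity ((dnorm p q s l)^-1 * ((p * q - s * conjc s) * (conjc l.2 * l.2))); first by rewrite /gvec /=; ring.
  by rewrite det mul1r.
Qed.

(** The entries of the balancing condition supply the four equations of [balanced_real]. As the
    conclusion holds for every [H] satisfying [is_Hlam], the choice made by [Hlam] does not
    matter. *)
Lemma projL_Aex (lam : C) H i : lam != 0 -> lam != 1 -> is_Hlam lam H -> projL lam H i = Aex lam i.
Proof.
move=> lam0 lam1 [Hpos [Hdet [c Hc]]].
pose q := H ord0 ord0; pose p := H ord_max ord_max; pose s := - H ord0 ord_max.
have HE : H = mx22 q (- s) (- conjc s) p.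
  apply: matrix2P; rewrite !mx22E ?/s ?opprK// cjN opprK.
  by rewrite (hermitian_conj _ _ Hpos.1).
have det : p * q - s * conjc s = 1.
  by rewrite -Hdet det22 HE !mx22E; ring.
rewrite HE in Hpos Hc |- *.
clear Hdet HE; clearbody p q s.
have dpos j := dnorm_gt0 Hpos det (lrow_neq0 lam j).
have [pr pr0 prE] := gt0_real (dpos (@Ordinal 4 0 isT)).
have [qr qr0 qrE] := gt0_real (dpos (@Ordinal 4 1 isT)).
have [d3 d30 d3E] := gt0_real (dpos (@Ordinal 4 2 isT)).
have [d4 d40 d4E] := gt0_real (dpos (@Ordinal 4 3 isT)).
have pE : p = pr%:C by rewrite -prE /dnorm /gvec /lrow /= !cjE; ring.
have qE : q = qr%:C by rewrite -qrE /dnorm /gvec /lrow /= !cjE; ring.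
have HS : c *: mx22 q (- s) (- conjc s) p = \sum_j (dnorm p q s (lrow lam j))^-1 *:
   (let l := lrow lam j in mx22 (conjc l.1 * l.1) (conjc l.1 * l.2) (conjc l.2 * l.1) (conjc l.2 * l.2)).
  rewrite -mul_mx_scalar -Hc mulmx_sumr; apply: eq_bigr => j _.
  by rewrite (projL_Pmat _ Hpos det) Pmat_mulH.
(* Each projection has trace one, so the trace of the sum gives [2 c = 4]. *)
have c2 : c = 2.
  have : \tr (\sum_j projL lam (mx22 q (- s) (- conjc s) p) j) = \tr (c%:M : M2) by rewrite Hc.
  rewrite mxtrace_scalar raddf_sum /= (eq_bigr (fun=> 1)).
    rewrite sumr_const card_ord => h; apply: (mulIf (x := 2)); first by rewrite pnatr_eq0.
    by rewrite mulr_natr -h -natrM.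
  move=> j _; rewrite (projL_Pmat _ Hpos det) /mxtrace sum2 !mx22E -mulrDl.
  rewrite (_ : _ + _ = dnorm p q s (lrow lam j)) ?divff ?gt_eqF//.
  by rewrite /dnorm; ring.
rewrite c2 sum4 /lrow /= in HS.
have e (j : 'I_4) := dpos j.
have entry (k k1 k2 k3 k4 : C) (A A1 A2 A3 A4 : M2) : k *: A = k1 *: A1 + k2 *: A2 + k3 *: A3 + k4 *: A4 ->
    forall a b, k * A a b = k1 * A1 a b + k2 * A2 a b + k3 * A3 a b + k4 * A4 a b.
  by move=> h a b; have := congr1 (fun M : M2 => M a b) h; rewrite !mxE.
have F := entry _ _ _ _ _ _ _ _ _ _ HS.
have F00 := F ord0 ord0; have F01 := F ord0 ord_max; have F10 := F ord_max ord0; have F11 := F ord_max ord_max.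
rewrite /lrow /= in prE qrE d3E d4E.
rewrite !mx22E prE qrE d3E d4E !cjE in F00 F01 F10 F11.
have mm := cabs_sqr lam; have nn := cabs_sqr (1 - lam).
rewrite cjB cj1 in nn.
have D3E : d3%:C = p + q - s - conjc s by rewrite -d3E /dnorm /gvec /= !cjE; ring.
have D4E : d4%:C = p + lam * conjc lam * q - s * conjc lam - lam * conjc s.
  by rewrite -d4E /dnorm /gvec /= !cjE; ring.
have real (x y : R) : x%:C = y%:C :> C -> x = y by move/complexI.
have sE : 2 * s = d3%:C^-1 + lam / d4%:C by apply: oppr_inj; rewrite -mulrN F01; ring.
have scE : 2 * conjc s = d3%:C^-1 + conjc lam / d4%:C by apply: oppr_inj; rewrite -mulrN F10; ring.
have D30 : d3%:C != 0 :> C by rewrite (inj_eq (@complexI R)) gt_eqF.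
have D40 : d4%:C != 0 :> C by rewrite (inj_eq (@complexI R)) gt_eqF.
have m0 : 0 < cabs lam by exact: cabs_gt0.
have n0 : 0 < cabs (1 - lam) by apply: cabs_gt0; rewrite subr_eq0 eq_sym.
have [M [M0 ME mE]] : exists M, [/\ 0 < M, M%:C = lam * conjc lam & Num.sqrt M = cabs lam].
  by exists (cabs lam ^+ 2); rewrite exprn_gt0// sqrtr_sqr gtr0_norm.
have [N [N0 NE nE]] : exists N, [/\ 0 < N, N%:C = (1 - lam) * (1 - conjc lam) & Num.sqrt N = cabs (1 - lam)].
  by exists (cabs (1 - lam) ^+ 2); rewrite exprn_gt0// sqrtr_sqr gtr0_norm.
have E1 : 2 * p = q^-1 + d3%:C^-1 + lam * conjc lam / d4%:C by rewrite F11 qE; ring.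
have E2 : 2 * q = p^-1 + d3%:C^-1 + d4%:C^-1 by rewrite F00 pE; ring.
have [||||h1 h2 h3] := @balanced_real pr qr d3 d4 M N pr0 qr0 d30 d40 M0 N0.
- by apply: real; rewrite !(rmorphM, rmorphD, fmorphV, rmorph_nat) /= -pE -qE ME.
- by apply: real; rewrite !(rmorphM, rmorphD, fmorphV, rmorph_nat) /= -pE -qE.
- apply: real; rewrite !(rmorphM, rmorphD, fmorphV, rmorph_nat) /= NE [in LHS]D3E -pE -qE.
  transitivity (2 * p + 2 * q - 2 * s - 2 * conjc s); first by ring.
  by rewrite E1 E2 sE scE; ring.
- apply: real; rewrite !(rmorphM, rmorphD, fmorphV, rmorph_nat) /= ME NE [in LHS]D4E -pE -qE.
  transitivity (2 * p + lam * conjc lam * (2 * q) - (2 * s) * conjc lam - lam * (2 * conjc s)); first by ring.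
  by rewrite E1 E2 sE scE; ring.
rewrite mE nE in h1 h2 h3.
set m := cabs lam in m0 h1 h2 h3; set n := cabs (1 - lam) in n0 h1 h2 h3.
have mC : m%:C != 0 :> C by rewrite (inj_eq (@complexI R)) gt_eqF.
have nC : n%:C != 0 :> C by rewrite (inj_eq (@complexI R)) gt_eqF.
have q0 : q != 0 by rewrite qE (inj_eq (@complexI R)) gt_eqF.
have SC : (1 + m + n)%:C != 0 :> C by rewrite (inj_eq (@complexI R)) gt_eqF//; lra.
have S' : 1 + m%:C + n%:C != 0 :> C by move: SC; rewrite !rmorphD.
have pm : p = m%:C * q by rewrite pE qE h1 rmorphM.
have d3q : d3%:C = n%:C * q by rewrite h2 qE rmorphM.
have d4q : d4%:C = m%:C * n%:C * q by rewrite h3 qE !rmorphM.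
have qq : 2 * m%:C * n%:C * q * q = 1 + m%:C + n%:C.
  transitivity (m%:C * n%:C * q * (2 * q)); first by ring.
  by rewrite E2 pm d3q d4q; field; do ?[apply/andP; split] => //.
have su : s = uu lam * q.
  apply: (mulfI (x := 2 * m%:C * n%:C * q)); first by rewrite !mulf_neq0// pnatr_eq0.
  transitivity (m%:C * n%:C * q * (2 * s)); first by ring.
  rewrite sE d3q d4q; transitivity (m%:C + lam); first by field; do ?[apply/andP; split] => //.
  rewrite /uu -/m -/n; transitivity ((2 * m%:C * n%:C * q * q) * ((m%:C + lam) / (1 + m%:C + n%:C))).
    by rewrite qq; field.
  by rewrite !rmorphD; ring.
rewrite (projL_Pmat _ Hpos det); apply: (Pmat_Aex lam0 lam1) => //.
by rewrite qE cjR.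
Qed.

Lemma Amat_Aex (lam : C) i : lam != 0 -> lam != 1 -> Amat lam i = Aex lam i.
Proof.
move=> lam0 lam1; rewrite /Amat; apply: projL_Aex => //.
by have [H hH] := is_Hlam_exists lam0 lam1; rewrite /Hlam; exact: (xgetPex 1%:M (ex_intro _ H hH)).
Qed.

End Balanced.

(** * Restriction to the slice w = 1 *)

Section Slice.
Variable R : realType.
Notation C := R[i].
Notation M2 := 'M[C]_2.
Notation V := 'cV[C]_2.

Lemma Qder_inv (z : C) : z != 0 -> Qder (fun x => x^-1) z (- z^-1 ^+ 2).
Proof.
move=> z0; have N0 := N1_gt0 z0.
exists (N1 (z^-1 ^+ 2) * (4 / N1 z)), (N1 z / 2); split; first by lra.
  by rewrite mulr_ge0 ?N1_ge0// divr_ge0 ?N1_ge0.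
move=> s hs.
have zs : N1 z / 2 <= N1 (z + s).
  by have := N1B (z + s) s; rewrite addrK; lra.
have zs0 : z + s != 0.
  by apply: contraTneq zs => ->; rewrite N1_0 -ltNge; lra.
have -> : (z + s)^-1 - z^-1 - s * - z^-1 ^+ 2 = z^-1 ^+ 2 * (z + s)^-1 * s ^+ 2.
  by field; rewrite z0 zs0.
apply: le_trans (N1M _ _) _; apply: ler_pM; rewrite ?N1_ge0//; last exact: N1X.
apply: le_trans (N1M _ _) _; apply: ler_wpM2l; first exact: N1_ge0.
apply: le_trans (N1V zs0) _; have N2 : 0 < N1 z / 2 by lra.
have -> : 4 / N1 z = 2 / (N1 z / 2) by field; rewrite gt_eqF.
by rewrite ler_pM2l// lef_pV2// posrE (lt_le_trans N2).
Qed.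

Lemma cderV (f : R -> C) t l : f t != 0 -> cder f t l -> cder (fun x => (f x)^-1) t (- l / f t ^+ 2).
Proof.
move=> f0 hf; have Q := Qder_inv f0.
apply: cder_eq (cder_comp Q hf) _.
by rewrite mulrN mulNr exprVn.
Qed.

Lemma has_dderivP (f : V -> C) (x v : V) L :
  has_dderiv f x v L <-> cder (fun t : R => f (x + t%:C *: v)) 0 L.
Proof.
have E0 : f (x + (0 : R)%:C *: v) = f x by rewrite scale0r addr0.
have Ere (t : R) : complex.Re ((f (x + t%:C *: v) - f x) / t%:C) =
   (Rez (f (x + t%:C *: v)) - Rez (f x)) / t.
  rewrite -fmorphV RezM /= mulr0 subr0 RezD RezN; congr (_ * _).
have Eim (t : R) : complex.Im ((f (x + t%:C *: v) - f x) / t%:C) =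
   (Imz (f (x + t%:C *: v)) - Imz (f x)) / t.
  by rewrite -fmorphV ImzM /= mulr0 add0r ImzD ImzN.
have key (g : R -> R) (l : R) : ((g t - g 0) / t) @[t --> (0 : R)^'] --> l <-> is_derive (0 : R) 1 g l.
  rewrite is_derive_eps; split=> [/cvgrPdist_le h e e0|h].
    have := h e e0; rewrite near_withinE => /nbhs_ballP[d /= d0 hd].
    exists d => // y y0 yd; rewrite add0r distrC; apply: hd => //.
    by rewrite /ball /= sub0r normrN.
  apply/cvgrPdist_le => e e0; have [d d0 hd] := h e e0.
  rewrite near_withinE; apply/nbhs_ballP; exists d => //= y; rewrite /ball /= sub0r normrN => yd y0.
  by have := hd y y0 yd; rewrite add0r distrC.
have k1 := key (fun t => Rez (f (x + t%:C *: v))) (Rez L).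
have k2 := key (fun t => Imz (f (x + t%:C *: v))) (Imz L).
rewrite /= E0 in k1 k2.
have e1 : (fun t : R => complex.Re ((f (x + t%:C *: v) - f x) / t%:C)) =
  (fun t : R => (Rez (f (x + t%:C *: v)) - Rez (f x)) / t) by apply/funext.
have e2 : (fun t : R => complex.Im ((f (x + t%:C *: v) - f x) / t%:C)) =
  (fun t : R => (Imz (f (x + t%:C *: v)) - Imz (f x)) / t) by apply/funext.
rewrite /has_dderiv e1 e2.
by split=> -[h1 h2]; split; [exact/k1|exact/k2|exact/k1|exact/k2].
Qed.

Definition par1 (lam : C) (a : R) (h : V -> M2) (x : V) :=
  forall v : V, mder (fun t : R => h (x + t%:C *: v)) 0
    (- (ctr (Omega lam a x v) *m h x + h x *m Omega lam a x v)).

Lemma hform_deriv (A Om : M2) (X Y : V) :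
  hform A (- (Om *m X)) Y + hform A X (- (Om *m Y)) =
  hform (- (ctr Om *m A + A *m Om)) X Y.
Proof.
rewrite /hform ctrN ctrM.
transitivity ((ctr Y *m (A *m - (Om *m X)) + - (ctr Y *m ctr Om) *m (A *m X)) ord0 ord0).
  by rewrite [RHS]mxE.
congr (fun_of_matrix _ ord0 ord0).
by rewrite !mulmxN !mulNmx mulmxN mulmxDl mulmxDr opprD addrC !mulmxA.
Qed.

Lemma par1P lam a (h : V -> M2) (x : V) : par1 lam a h x <->
  forall v X Y, has_dderiv (fun y => hform (h y) X Y) x v
      (hform (h x) (nablaD lam a x v X) Y + hform (h x) X (nablaD lam a x v Y)).
Proof.
split=> [H v X Y|H v i j].
  apply/has_dderivP; rewrite /nablaD hform_deriv.
  have := mderM (mder_cst (ctr Y) 0) (mderM (H v) (mder_cst X 0)).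
  by rewrite mul0mx add0r mulmx0 addr0 => /(_ ord0 ord0).
have := H v (delta_mx j ord0) (delta_mx i ord0).
rewrite /nablaD hform_deriv => /has_dderivP.
have E (A : M2) : hform A (delta_mx j ord0) (delta_mx i ord0) = A i j.
  rewrite /hform; have -> : ctr (delta_mx i ord0 : V) = delta_mx ord0 i.
    by apply/matrixP => k l; rewrite !mxE andbC; case: (_ && _); rewrite ?cj1 ?cj0.
  by rewrite -colE -rowE !mxE.
by rewrite E; apply: cder_ext => t; rewrite E.
Qed.

Lemma parallel_hformP lam a h : parallel_hform lam a h <->
  forall x, Ucomp lam x -> Defs.hermitian (h x) /\ par1 lam a h x.
Proof.
split=> [[H1 H2] x Ux|H].
  by split; [exact: H1|apply/par1P => v X Y; exact: H2].
split=> [x Ux|x v X Y Ux]; first by case: (H x Ux).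
by have [_ /par1P] := H x Ux; apply.
Qed.

Section Fixed.
Variables (lam : C) (a : R).
Hypotheses (lam0 : lam != 0) (lam1 : lam != 1).

Definition pole (j : 'I_3) : C := match val j with 0 => 0 | 1 => 1 | _ => lam end.
(** The line [w = 0], of index [1], meets the slice [w = 1] only at infinity, hence its absence. *)
Definition poleA (j : 'I_3) : 'I_4 :=
  match val j with 0 => @Ordinal 4 0 isT | 1 => @Ordinal 4 2 isT | _ => @Ordinal 4 3 isT end.
Definition resid (j : 'I_3) : M2 := a%:C *: Amat lam (poleA j).

Lemma sum3 (W : nmodType) (F : 'I_3 -> W) : \sum_j F j = F (o0) + F (o1) + F (o2).
Proof. by rewrite !big_ord_recl big_ord0 addr0 addrA; congr (F _ + F _ + F _); exact: val_inj. Qed.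

Lemma nonpoleP z : nonpole pole z <-> [/\ z != 0, z != 1 & z != lam].
Proof.
split=> [H|[h0 h1 h2] j].
  by split; [exact: (H o0)|exact: (H o1)|exact: (H o2)].
by case: (ord3P j) => ->.
Qed.

Lemma Ucomp_cv2 z w : Ucomp lam (cv2 z w) <-> w != 0 /\ nonpole pole (z / w).
Proof.
have E (w0 : w != 0) : (z / w != 0) = (z != 0) /\ (z / w != 1) = (w - z != 0) /\
   (z / w != lam) = (z - lam * w != 0).
  split; [|split].
  - by rewrite mulf_eq0 invr_eq0 (negbTE w0) orbF.
  - by rewrite -(inj_eq (mulIf w0)) divfK// mul1r subr_eq0 eq_sym.
  - by rewrite -(inj_eq (mulIf w0)) divfK// subr_eq0.
split=> [H|[w0 /nonpoleP[h1 h2 h3]]].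
  have w0 : w != 0 by have := H (@Ordinal 4 1 isT); rewrite /ell /= /wco mx22E.
  split=> //; apply/nonpoleP; have [-> [-> ->]] := E w0; split.
  - by have := H (@Ordinal 4 0 isT); rewrite /ell /= /zco mx22E.
  - by have := H (@Ordinal 4 2 isT); rewrite /ell /= /zco /wco !mx22E.
  - by have := H (@Ordinal 4 3 isT); rewrite /ell /= /zco /wco !mx22E.
have [e1 [e2 e3]] := E w0; rewrite e1 in h1; rewrite e2 in h2; rewrite e3 in h3.
by move=> i; rewrite /ell /zco /wco !mx22E; case: i => -[|[|[|[|//]]]].
Qed.

Lemma Amat_sum : \sum_i Amat lam i = 2%:M.
Proof. by rewrite -(Aex_sum lam0 lam1); apply: eq_bigr => i _; exact: Amat_Aex. Qed.

(** Since the four projections sum to [2], the one for [w = 0] can be eliminated, and the connection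
    splits into the pullback of [Cm] under [z / w] and the scalar form [2 a dw / w]. *)
Lemma Omega_cv2 z w v1 v2 : w != 0 -> nonpole pole (z / w) ->
  Omega lam a (cv2 z w) (cv2 v1 v2) =
  ((v1 * w - z * v2) / w ^+ 2) *: Cm pole resid (z / w) + (2 * a%:C * v2 / w)%:M.
Proof.
move=> w0 np.
have /nonpoleP[h0 h1 h2] := np.
have z0 : z != 0 by apply: contra h0 => /eqP ->; rewrite mul0r.
have zw : w - z != 0.
  by apply: contra h1; rewrite subr_eq0 => /eqP <-; rewrite divff.
have zl : z - lam * w != 0.
  by apply: contra h2; rewrite subr_eq0 => /eqP ->; rewrite mulfK.
have A1 : Amat lam (@Ordinal 4 1 isT) = 2%:M - (Amat lam (@Ordinal 4 0 isT) + Amat lam (@Ordinal 4 2 isT) + Amat lam (@Ordinal 4 3 isT)).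
  by rewrite -Amat_sum sum4; apply/matrixP => i j; rewrite !mxE; ring.
rewrite /Omega sum4 /Cm sum3 /resid /poleA /pole /ell /zco /wco /= !mx22E A1.
set A0 := Amat _ _; set A2 := Amat _ (@Ordinal 4 2 isT); set A3 := Amat _ (@Ordinal 4 3 isT).
apply/matrixP => i j; rewrite !mxE.
set d := (i == j); have -> : (2 * a%:C * v2 / w) *+ d = 2 *+ d * (a%:C * v2 / w).
  by case: d; ring.
set x := A0 i j; set y := A2 i j; set u := A3 i j; set e := 2 *+ d.
have h1' : z - w != 0 by rewrite -opprB oppr_eq0.
field; do ?[apply/andP; split] => //; by rewrite ?mulNr ?mul1r.
Qed.

Lemma Omega_slice z v1 : nonpole pole z -> Omega lam a (cv2 z 1) (cv2 v1 0) = v1 *: Cm pole resid z.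
Proof.
move=> np; have np' : nonpole pole (z / 1) by rewrite divr1.
rewrite (Omega_cv2 _ _ (oner_neq0 _) np') divr1.
have -> : (v1 * 1 - z * 0) / 1 ^+ 2 = v1 by rewrite mulr1 mulr0 subr0 expr1n divr1.
by rewrite mulr0 mul0r scalemx0 || rewrite mulr0 mul0r raddf0 addr0.
Qed.

Lemma Omega_radial (x : V) (c : C) : Ucomp lam x -> Omega lam a x (c *: x) = (2 * a%:C * c)%:M.
Proof.
move=> Ux; rewrite /Omega (eq_bigr (fun i => (a%:C * c) *: Amat lam i)).
  by rewrite -scaler_sumr Amat_sum scale_scalar_mx; congr (_%:M); ring.
move=> i _; congr (_ *: _).
have -> : ell lam i (c *: x) = c * ell lam i x by rewrite !ellE !mxE; ring.
by rewrite mulrA mulfK.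
Qed.

Lemma cv2_line (z w v1 v2 : C) (t : R) : cv2 z w + t%:C *: cv2 v1 v2 = cv2 (z + t%:C * v1) (w + t%:C * v2).
Proof. by apply: colvec2P; rewrite !mxE. Qed.

Lemma cv2_eta (x : V) : x = cv2 (x ord0 ord0) (x ord_max ord0).
Proof. by apply: colvec2P; rewrite mxE. Qed.

Lemma par1_slice (h : V -> M2) z : nonpole pole z -> par1 lam a h (cv2 z 1) ->
  ParL pole resid (fun y => h (cv2 y 1)) z.
Proof.
move=> np H v; have := H (cv2 v 0); rewrite (Omega_slice v np); apply: mder_ext => t.
by rewrite cv2_line mulr0 addr0.
Qed.

(* Along the ray the connection is -4a times the logarithmic derivative of the length. *)
Lemma radial_zero (h : V -> M2) (y : V) (c : C) : (forall x, Ucomp lam x -> par1 lam a h x) ->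
  Ucomp lam y -> 0 < Rez c -> h y = 0 -> h (c *: y) = 0.
Proof.
move=> H Uy c0 hy.
(* The segment from [1] to [c] stays in the right half plane and so avoids [0]. *)
pose g (t : R) : C := 1 + t%:C * (c - 1).
have gre (t : R) : 0 <= t <= 1 -> 0 < Rez (g t).
  move=> /andP[t0 t1]; rewrite /g RezD RezM RezD RezN /= mul0r subr0.
  have [->|tn] := eqVneq t 0; first by lra.
  have : 0 < t * Rez c by rewrite mulr_gt0// lt_neqAle eq_sym tn.
  by lra.
have g0 (t : R) : 0 <= t <= 1 -> g t != 0.
  by move=> ht; apply: contraTneq (gre t ht) => ->; rewrite ltxx.
have Ug (t : R) : 0 <= t <= 1 -> Ucomp lam (g t *: y).
  move=> ht i; have -> : ell lam i (g t *: y) = g t * ell lam i y by rewrite !ellE !mxE; ring.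
  by rewrite mulf_neq0 ?g0//; exact: Uy.
pose rho (t : R) : R := Rez (g t) ^+ 2 + Imz (g t) ^+ 2.
have rhopos (t : R) : 0 <= t <= 1 -> 0 < rho t.
  by move=> ht; rewrite ltr_pwDl ?sqr_ge0// exprn_gt0// gre.
have dg (t : R) : cder g t (c - 1) by exact: cder_line.
pose drho (t : R) : R := 2 * (Rez (g t) * Rez (c - 1) + Imz (g t) * Imz (c - 1)).
have dr (t : R) : is_derive t 1 rho (drho t).
  have [h1 h2] := dg t.
  have := is_deriveD (is_deriveM_mul h1 h1) (is_deriveM_mul h2 h2) => H'.
  by rewrite /rho; under eq_fun do rewrite !expr2; apply: is_derive_eq H' _; rewrite /drho; ring.
have dH (t : R) : 0 <= t <= 1 -> mder (fun t => h (g t *: y)) t (- ((2 * a * (drho t / rho t))%:C *: h (g t *: y))).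
  move=> ht i j; have := H _ (Ug t ht) ((c - 1) *: y).
  have Ec : (c - 1) *: y = ((c - 1) / g t) *: (g t *: y) by rewrite scalerA divfK// g0.
  rewrite Ec.
  rewrite (Omega_radial _ (Ug t ht)).
  have E : - (ctr (2 * a%:C * ((c - 1) / g t))%:M *m h (g t *: y) + h (g t *: y) *m (2 * a%:C * ((c - 1) / g t))%:M) =
    - ((2 * a * (drho t / rho t))%:C *: h (g t *: y)).
    congr (- _); rewrite -scalemx1 ctrZ ctr1 -scalemxAl mul1mx -scalemxAr mulmx1 -scalerDl; congr (_ *: _).
    apply: complex_eqP; rewrite /rho /drho.
      have := rhopos t ht; rewrite /rho; have := gre t ht.
      case: (g t) => g1 g2 /=; case: (c - 1) => d1 d2 /= p1 p2; rewrite /conjc /=.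
      by field; rewrite gt_eqF.
    have := rhopos t ht; rewrite /rho; have := gre t ht.
    case: (g t) => g1 g2 /=; case: (c - 1) => d1 d2 /= p1 p2; rewrite /conjc /=.
    by field; rewrite gt_eqF.
  rewrite E => /(_ i j) [k1 k2].
  have Eg u : g t *: y + u%:C *: (((c - 1) / g t) *: (g t *: y)) = g (t + u) *: y.
    rewrite -Ec scalerA -scalerDl; congr (_ *: _).
    by rewrite /g rmorphD; ring.
  split; apply: is_derive_shift.
    by move: k1; under eq_fun do rewrite Eg.
  by move: k2; under eq_fun do rewrite Eg.
have dp (t : R) : 0 <= t <= 1 -> is_derive t 1 (fun t => rho t `^ (2 * a)) (2 * a * rho t `^ (2 * a - 1) * drho t).
  move=> ht; have := is_derive1_comp (f := fun x : R => x `^ (2 * a)) (g := rho) (is_derive1_powR (2 * a) (rhopos t ht)) (dr t).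
  by move=> H'; apply: is_derive_eq H' _; rewrite /GRing.scale /= mulrC.
(* [rho] is the squared modulus of [g], and its power [2 a] cancels the logarithmic derivative found
   in [dH]. *)
have := @mder0_cst R 2 2 (fun t => (rho t `^ (2 * a))%:C *: h (g t *: y)).
have -> : g 1 = c by rewrite /g mul1r addrC subrK.
have -> : g 0 = 1 by rewrite /g mul0r addr0.
rewrite scale1r hy scaler0 => E.
have {E} /eqP : (rho 1 `^ (2 * a))%:C *: h (c *: y) = 0.
  apply: E => t ht.
  apply: mder_eq (mderZ (cder_real (dp t ht)) (dH t ht)) _.
  rewrite scalerN scalerA -scalerBl -!rmorphM -rmorphB.
  have -> : 2 * a * rho t `^ (2 * a - 1) * drho t - rho t `^ (2 * a) * (2 * a * (drho t / rho t)) = 0.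
    have r0 := rhopos t ht.
    have -> : rho t `^ (2 * a) = rho t `^ (2 * a - 1) * rho t.
      rewrite -{3}(powRr1 (ltW r0)) -powRD ?subrK//.
      by rewrite (gt_eqF r0) implybT.
    by field; rewrite gt_eqF.
  by rewrite scale0r.
rewrite scaler_eq0 => /orP[|/eqP//].
rewrite (inj_eq (@complexI R)) => /eqP h0.
have : 0 < rho 1 `^ (2 * a) by rewrite powR_gt0// rhopos// ler01 lexx.
by rewrite h0 ltxx.
Qed.

End Fixed.

End Slice.

Section SliceEquivalence.
Variable R : realType.
Notation C := R[i].
Notation M2 := 'M[C]_2.
Notation V := 'cV[C]_2.
Variables (lam : C) (a : R).
Hypotheses (lam0 : lam != 0) (lam1 : lam != 1).

Lemma UcompZ (c : C) (x : V) : c != 0 -> Ucomp lam x -> Ucomp lam (c *: x).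
Proof.
move=> c0 Ux i; have -> : ell lam i (c *: x) = c * ell lam i x by rewrite !ellE !mxE; ring.
by rewrite mulf_neq0//; exact: Ux.
Qed.

(** [radial_zero] covers multipliers in the right half plane; since [(1 + i)^2 = 2 i], a few of
    these compose to any nonzero multiplier. *)
Lemma radial_zero_all (h : V -> M2) (y : V) (c : C) : (forall x, Ucomp lam x -> par1 lam a h x) ->
  Ucomp lam y -> c != 0 -> h y = 0 -> h (c *: y) = 0.
Proof.
move=> H Uy c0 hy.
have step x (d : C) : 0 < Rez d -> Ucomp lam x -> h x = 0 -> Ucomp lam (d *: x) /\ h (d *: x) = 0.
  move=> d0 Ux hx; split; last exact: (radial_zero lam0 lam1 H).
  by apply: UcompZ => //; apply: contraTneq d0 => ->; rewrite ltxx.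
have twice x (d e : C) : 0 < Rez d -> 0 < Rez e -> Ucomp lam x -> h x = 0 ->
    Ucomp lam ((d * d * e) *: x) /\ h ((d * d * e) *: x) = 0.
  move=> d0 e0 Ux hx; rewrite -!scalerA.
  have [U1 h1] := step _ _ e0 Ux hx; have [U2 h2] := step _ _ d0 U1 h1; exact: step.
pose d : C := 1 +i* 1; pose d' : C := 1 -i* 1.
have d0 : 0 < Rez d by rewrite /= ltr01.
have d'0 : 0 < Rez d' by rewrite /= ltr01.
have [h2|h2|h2] := ltgtP 0 (Imz c).
- have e0 : 0 < Rez (c * (0 -i* (1 / 2))) by rewrite RezM /=; lra.
  have [_] := twice y d _ d0 e0 Uy hy; congr (h (_ *: y) = 0).
  by case: (c) => x z; apply: complex_eqP; rewrite /d /=; field.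
- have e0 : 0 < Rez (c * (0 +i* (1 / 2))) by rewrite RezM /=; lra.
  have [_] := twice y d' _ d'0 e0 Uy hy; congr (h (_ *: y) = 0).
  by case: (c) => x z; apply: complex_eqP; rewrite /d' /=; field.
have [h1|h1|h1] := ltgtP 0 (Rez c).
- by case: (step y c h1 Uy hy).
- have e0 : 0 < Rez (c * (- (1 / 4) +i* 0)) by rewrite RezM /=; lra.
  have [U1 k1] := twice y d _ d0 e0 Uy hy.
  have o0' : 0 < Rez (1 : C) by rewrite /= ltr01.
  have [_] := twice _ d 1 d0 o0' U1 k1; rewrite scalerA; congr (h (_ *: y) = 0).
  by case: (c) => x z; apply: complex_eqP; rewrite /d /=; field.
by move: c0; rewrite (_ : c = 0) ?eqxx//; apply: complex_eqP.
Qed.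

Lemma slice_necessary : preserves_hform lam a -> exists h1 : C -> M2,
  [/\ forall z, nonpole (pole lam) z -> Defs.hermitian (h1 z),
      forall z, nonpole (pole lam) z -> ParL (pole lam) (resid lam a) h1 z &
      exists z, nonpole (pole lam) z /\ h1 z != 0].
Proof.
move=> [h [/parallel_hformP H [x [Ux hx]]]].
have Us z : nonpole (pole lam) z -> Ucomp lam (cv2 z 1).
  by move=> np; apply/Ucomp_cv2; rewrite oner_eq0 divr1.
exists (fun z => h (cv2 z 1)); split.
- by move=> z /Us /H[].
- by move=> z np; apply: (par1_slice lam0 lam1) => //; have [] := H _ (Us _ np).
move: Ux hx; rewrite (cv2_eta x); set z := x _ _; set w := x _ _ => Ux hx.
have [w0 np] := (Ucomp_cv2 lam z w).1 Ux.
exists (z / w); split=> //; apply: contra_neq hx => h0.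
have -> : cv2 z w = w *: cv2 (z / w) 1.
  by apply: colvec2P; rewrite !mxE /= ?mulr1// mulrC divfK.
apply: radial_zero_all => // [y Uy|]; first by have [] := H y Uy.
exact: Us.
Qed.

Lemma slice_sufficient (h1 : C -> M2) : (forall z, Defs.hermitian (h1 z)) ->
  (forall z, nonpole (pole lam) z -> ParC (pole lam) (resid lam a) h1 z) ->
  (exists z, nonpole (pole lam) z /\ h1 z != 0) -> preserves_hform lam a.
Proof.
move=> hherm hpar [z0 [np0 hz0]].
pose rho (w : C) : R := Rez w ^+ 2 + Imz w ^+ 2.
have rhopos w : w != 0 -> 0 < rho w.
  move=> w0; rewrite lt_neqAle addr_ge0 ?sqr_ge0// andbT eq_sym.
  rewrite paddr_eq0 ?sqr_ge0// !sqrf_eq0; apply: contra w0 => /andP[/eqP e /eqP e'].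
  by apply/eqP/complex_eqP.
(* The factor is [|w|] to the power [- 4 a]: its logarithmic derivative accounts for the scalar part
   [2 a dw / w] of the connection together with its conjugate. *)
pose h (x : V) : M2 := (rho (x ord_max ord0) `^ (- (2 * a)))%:C *: h1 (x ord0 ord0 / x ord_max ord0).
exists h; split; last first.
  exists (cv2 z0 1); split; first by apply/Ucomp_cv2; rewrite oner_eq0 divr1.
  rewrite /h !mx22E divr1 scaler_eq0 negb_or hz0 andbT (inj_eq (@complexI R)) gt_eqF//.
  by rewrite powR_gt0// rhopos// oner_eq0.
apply/parallel_hformP => x Ux; split.
  by rewrite /Defs.hermitian /h ctrZ cjR hherm.
move: Ux; rewrite (cv2_eta x); set z := x _ _; set w := x _ _ => Ux v.
have [w0 np] := (Ucomp_cv2 lam z w).1 Ux.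
rewrite (cv2_eta v); set v1 := v _ _; set v2 := v _ _.
rewrite (Omega_cv2 a lam0 lam1 _ _ w0 np).
have cw := cder_line w v2 0; have cz := cder_line z v1 0.
have w0' : w + (0 : R)%:C * v2 != 0 by rewrite mul0r addr0.
have czw : cder (fun t : R => (z + t%:C * v1) / (w + t%:C * v2)) 0 ((v1 * w - z * v2) / w ^+ 2).
  apply: cder_eq (cderM cz (cderV w0' cw)) _.
  by rewrite !mul0r !addr0; field.
have e0 : (z + (0 : R)%:C * v1) / (w + (0 : R)%:C * v2) = z / w by rewrite !mul0r !addr0.
have ch := hpar _ np _ _ _ e0 czw.
pose r (t : R) := rho (w + t%:C * v2).
have r0 : r 0 = rho w by rewrite /r mul0r addr0.
pose dr : R := 2 * (Rez w * Rez v2 + Imz w * Imz v2).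
have hr : is_derive (0 : R) 1 r dr.
  have [k1 k2] := cw.
  have H' := is_deriveD (is_deriveM_mul k1 k1) (is_deriveM_mul k2 k2).
  rewrite /r /rho; under eq_fun do rewrite !expr2; apply: is_derive_eq H' _.
  by rewrite !mul0r !addr0 /dr; ring.
have rpos : 0 < r 0 by rewrite r0 rhopos.
have hp : is_derive (0 : R) 1 (fun t => r t `^ (- (2 * a))) (- (2 * a) * rho w `^ (- (2 * a) - 1) * dr).
  have H' := is_derive1_comp (f := fun x : R => x `^ (- (2 * a))) (g := r) (is_derive1_powR (- (2 * a)) rpos) hr.
  by apply: is_derive_eq H' _; rewrite r0 /GRing.scale /= mulrC.
apply: mder_eq (mder_ext _ (mderZ (cder_real hp) ch)) _.
  by move=> t; rewrite /h cv2_line !mx22E.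
rewrite r0 e0 /h !mx22E /dhl; set A := h1 (z / w); set P := _ *: Cm _ _ _; clearbody P.
set t := rho w `^ (- (2 * a)); set t' := rho w `^ (- (2 * a) - 1).
have tE : t' = t / rho w.
  rewrite /t' /t powRD; last by rewrite (gt_eqF (rhopos _ w0)) implybT.
  by rewrite (powRN _ 1) powRr1 ?(ltW (rhopos _ w0)).
have wC : w != 0 by [].
have mu : (2 * a%:C * v2 / w) + conjc (2 * a%:C * v2 / w) = (2 * a * (dr / rho w))%:C.
  have := rhopos w w0; rewrite /rho /dr; case: (w) => w1 w2 /=; case: (v2) => x1 x2 /= p.
  by apply: complex_eqP; rewrite /conjc /=; field; rewrite gt_eqF.
rewrite -scalemx1 ctrD ctrZ ctr1 mulmxDl mulmxDr -!scalemxAr -!scalemxAl mul1mx mulmx1 !scalerA.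
set m := 2 * a%:C * v2 / w in mu *.
have -> : t%:C * conjc m = ((2 * a * (dr / rho w))%:C - m) * t%:C by rewrite -mu; ring.
apply/matrixP => i j; rewrite !mxE tE.
set x1 := (ctr P *m A) i j; set x2 := (A *m P) i j.
rewrite !(rmorphM, rmorphN, fmorphV, rmorph_nat, rmorphB) /=.
have rC : (rho w)%:C != 0 :> C by rewrite (inj_eq (@complexI R)) gt_eqF// rhopos.
by field.
Qed.

End SliceEquivalence.

(** * A pair outside Z *)

Section NonMember.
Variable R : realType.
Notation C := R[i].
Notation M2 := 'M[C]_2.

(** In a disc around [x], transport along radii expresses [h] through [Wl], and such an expression
    is differentiable along every curve. *)
Lemma ParL_ParC (s : 'I_3 -> C) (B : 'I_3 -> M2) (h : C -> M2) x :
  (forall y, nonpole s y -> ParL s B h y) -> nonpole s x -> ParC s B h x.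
Proof.
move=> H np.
have d0 j : 0 < N1 (x - s j) by apply: N1_gt0; rewrite subr_eq0; exact: np.
pose d := Num.min (N1 (x - s o0)) (Num.min (N1 (x - s o1)) (N1 (x - s o2))).
have dp : 0 < d by rewrite /d !lt_min !d0.
have ok : okd s B d (\sum_j nm (B j)) x.
  split=> //; first by apply: sumr_ge0 => j _; exact: nm_ge0.
  by move=> j; case: (ord3P j) => ->; rewrite /d !ge_min lexx ?orbT.
apply: (conj_ParC ok (eta_gt0 ok)) => y hy.
apply: (transport_disc ok hy) => t ht; apply: H => j; rewrite -subr_eq0.
apply: (disc_neq ok); apply: seg_ball => //; rewrite subrr N1_0; exact: (eta_gt0 ok).
Qed.

Lemma nondecreasing_derive (f df : R -> R) : (forall t : R, is_derive t 1 f (df t)) ->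
  (forall t, 0 <= df t) -> forall x y, x <= y -> f x <= f y.
Proof.
move=> hf h0 x y xy; have [c _ E] := is_derive_MVT xy (fun t _ => hf t).
by rewrite -subr_ge0 E mulr_ge0// subr_ge0.
Qed.

(** Equal values at [- T], [0] and [T] make a nondecreasing function constant near [0]. *)
Lemma periodic_monotone (f df : R -> R) (T : R) : 0 < T -> (forall t : R, is_derive t 1 f (df t)) ->
  (forall t, 0 <= df t) -> (forall t, f (t + T) = f t) -> df 0 = 0.
Proof.
move=> T0 hf h0 hT; have mono := nondecreasing_derive hf h0.
have fT : f (- T) = f 0 by rewrite -hT addNr.
have fT' : f T = f 0 by rewrite -[in LHS](add0r T) hT.
apply: is_derive_unique (hf 0) _; have hc : is_derive (0 : R) 1 (cst (f 0)) 0 by exact: is_derive_cst.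
apply: (is_derive_near _ hc).
exists T => // u; rewrite subr0 ltr_norml => /andP[u1 u2].
by apply/le_anti/andP; split; [rewrite -fT|rewrite -fT']; apply: mono; exact: ltW.
Qed.

(* (2 b x, y) rotates with angular speed 2 b g, by a total angle less than one. *)
Lemma small_rotation (x y g : R -> R) (b T G : R) : 0 < b -> 0 < T -> 2 * b * G * T < 1 ->
  (forall t, 0 < g t <= G) -> (forall t : R, is_derive t 1 x (g t * y t)) ->
  (forall t : R, is_derive t 1 y (- (4 * b ^+ 2 * (g t * x t)))) ->
  x T = x 0 -> y T = y 0 -> x 0 = 0 /\ y 0 = 0.
Proof.
move=> b0 T0 small hg hx hy xT yT.
pose E t := 4 * b ^+ 2 * (x t * x t) + y t * y t.
have hE (t : R) : is_derive t 1 E 0.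
  have H1 := is_deriveZ (4 * b ^+ 2) (is_deriveM_mul (hx t) (hx t)).
  have := is_deriveD H1 (is_deriveM_mul (hy t) (hy t)) => H.
  by apply: is_derive_eq H _; rewrite /GRing.scale /=; ring.
have EC t : E t = E 0 by apply: is_derive_0_is_cst.
pose I t := 4 * b ^+ 2 * x 0 * x t + y 0 * y t.
pose J t := y 0 * x t - x 0 * y t.
have hI (t : R) : is_derive t 1 I (- (4 * b ^+ 2 * (g t * J t))).
  have H := is_deriveD (is_deriveZ (4 * b ^+ 2 * x 0) (hx t)) (is_deriveZ (y 0) (hy t)).
  by apply: is_derive_eq H _; rewrite /GRing.scale /= /J; ring.
have hJ (t : R) : is_derive t 1 J (g t * I t).
  have H := is_deriveB (is_deriveZ (y 0) (hx t)) (is_deriveZ (x 0) (hy t)).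
  by apply: is_derive_eq H _; rewrite /GRing.scale /= /I; ring.
(* [I] and [J] are the scalar and the cross product with the initial vector. [J] vanishes at both
   ends, so [I] vanishes at some time [c]; but [I] starts at [E 0] and moves at speed at most
   [2 b G] times [E 0], which forces [E 0 = 0]. *)
have [c /andP[c0 cT] Jc] := is_derive_MVT (ltW T0) (fun t _ => hJ t).
have {}Jc : I c = 0.
  have g0 : 0 < g c by case/andP: (hg c).
  have : J T - J 0 = 0 by rewrite /J xT yT; ring.
  rewrite Jc subr0 => /eqP; rewrite !mulf_eq0 (gt_eqF g0) (gt_eqF T0) orbF /=.
  by move/eqP.
have [e _ Ie] := is_derive_MVT c0 (fun t _ => hI t).
have I0 : I 0 = E 0 by rewrite /I /E; ring.
rewrite Jc I0 sub0r subr0 in Ie.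
have E0 : 0 <= E 0.
  have q1 := sqr_ge0 (x 0); have q2 := sqr_ge0 (y 0); rewrite !expr2 in q1 q2.
  by rewrite /E addr_ge0// mulr_ge0// mulr_ge0// sqr_ge0.
have Jle : 2 * b * `|J e| <= E 0.
  have b2 : 0 <= 2 * b by lra.
  rewrite -[2 * b]ger0_norm// -normrM ler_norml.
  have Ee := EC e; rewrite /E in Ee; rewrite /E /J.
  have q1 := sqr_ge0 (2 * b * x 0 - y e); have q2 := sqr_ge0 (2 * b * x 0 + y e).
  have q3 := sqr_ge0 (2 * b * x e - y 0); have q4 := sqr_ge0 (2 * b * x e + y 0).
  by apply/andP; split; lra.
have EE : E 0 = 0.
  have /andP[ge0 geG] := hg e.
  have : E 0 <= 2 * b * (G * T) * E 0.
    have -> : E 0 = 2 * b * (g e * c) * (2 * b * J e) by lra.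
    apply: (@le_trans _ _ (2 * b * (g e * c) * (2 * b * `|J e|))).
      rewrite !ler_wpM2l ?mulr_ge0 ?(ltW ge0) ?(ltW b0)// ?ler_norm//.
    apply: (@le_trans _ _ (2 * b * (G * T) * (2 * b * `|J e|))).
      apply: ler_wpM2r; first by rewrite !mulr_ge0// ltW.
      by rewrite ler_wpM2l ?mulr_ge0 ?(ltW b0)// ler_pM// ltW.
    have -> : 2 * b * (g e * c) * (2 * b * J e) = E 0 by lra.
    by apply: ler_wpM2l Jle; rewrite !mulr_ge0 ?(ltW b0) ?(ltW T0)// (le_trans (ltW ge0)).
  by nra.
move: EE; rewrite /E -!expr2 => EE.
have h1 := sqr_ge0 (x 0); have h2 := sqr_ge0 (y 0); have h3 : 0 < b ^+ 2 by rewrite exprn_gt0.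
have yy : y 0 ^+ 2 = 0 by nra.
have xx : x 0 ^+ 2 = 0 by nra.
by split; apply/eqP; rewrite -sqrf_eq0; apply/eqP.
Qed.

Lemma pullback_alg (F H O N : M2) :
  (ctr (O *m F + F *m N) *m H + ctr F *m (- (ctr O *m H + H *m O))) *m F + ctr F *m H *m (O *m F + F *m N) =
  ctr N *m (ctr F *m H *m F) + ctr F *m H *m F *m N.
Proof.
have zmod4 (V : zmodType) (X1 X2 X3 X4 : V) : X1 + X2 - (X1 + X3) + (X3 + X4) = X2 + X4.
  by rewrite opprD [X1 + X2 + _]addrACA subrr add0r addrA subrK.
rewrite ctrD !ctrM !mulmxDl !mulmxDr mulmxN mulNmx mulmxDr mulmxDl !mulmxA.
exact: zmod4.
Qed.

(** * A gauge that makes the system constant on an elliptic curve *)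

Section Frame.
Variable (mu : R).
Hypothesis mu0 : 0 < mu.
Let lam : C := (- mu)%:C.

Definition Pol (z : C) : C := z * (z - 1) * (z + mu%:C).
Definition dPol (z : C) : C := 3 * z ^+ 2 + 2 * (mu%:C - 1) * z - mu%:C.

Let lam0 : lam != 0.
Proof. by rewrite (inj_eq (@complexI R)) oppr_eq0 gt_eqF. Qed.
Let lam1 : lam != 1.
Proof. by rewrite (inj_eq (@complexI R)); apply/eqP => h; have := mu0; lra. Qed.

(** For negative [lam] the number [uu lam] vanishes, so the balanced form is diagonal and the
    residues are rational in [mu]. *)
Lemma negative_ratio_Cm (z : C) : Cm (pole lam) (resid lam (3 / 2)) z =
  (3 / 2)%:C *: (z^-1 *: mx22 1 0 0 0 +
    ((z - 1)^-1 / (1 + mu%:C)) *: mx22 mu%:C (- mu%:C) (- 1) 1 +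
    ((z + mu%:C)^-1 / (1 + mu%:C)) *: mx22 1 mu%:C 1 mu%:C).
Proof.
have ca : cabs lam = mu by rewrite /cabs /= expr0n addr0 sqrtr_sqr normrN gtr0_norm.
have cb : cabs (1 - lam) = 1 + mu.
  by rewrite /cabs /= oppr0 addr0 expr0n addr0 sqrtr_sqr opprK gtr0_norm// ltr_wpDl.
have u0 : uu lam = 0 by rewrite /uu ca /lam rmorphN subrr mul0r.
have mC : mu%:C != 0 :> C by rewrite (inj_eq (@complexI R)) gt_eqF.
have nC : 1 + mu%:C != 0 :> C.
  by rewrite -(rmorph1 (real_complex R)) -rmorphD (inj_eq (@complexI R)) gt_eqF// ltr_wpDl.
rewrite /Cm sum3 /resid !Amat_Aex// /Aex /pole /= ca cb u0 !cjE !subr0 rmorphD rmorph1.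
have -> : z - lam = z + mu%:C by rewrite /lam rmorphN opprK.
rewrite /lam !rmorphN.
set x := z^-1; set y := (z - 1)^-1; set w := (z + mu%:C)^-1; set r := (3 / 2)%:C.
have entry (k a1 a2 a3 b1 b2 b3 : C) (A1 A2 A3 B1 B2 B3 : M2) :
    (forall i j, a1 * (k * A1 i j) + a2 * (k * A2 i j) + a3 * (k * A3 i j) =
      k * (b1 * B1 i j + b2 * B2 i j + b3 * B3 i j)) ->
    a1 *: (k *: A1) + a2 *: (k *: A2) + a3 *: (k *: A3) = k *: (b1 *: B1 + b2 *: B2 + b3 *: B3).
  by move=> h; apply/matrixP => i j; have := h i j; rewrite !mxE.
apply: entry => i j; case: (ord2P i) => ->; case: (ord2P j) => ->; rewrite !mx22E; field.
all: by do ?[apply/andP; split].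
Qed.

(** A gauge matrix on the curve [rho^2 = Pol z]. Its first column is [- rho / 2] times [(z, 1)]; the
    second is forced by the first through the equation of [frame_ode], and with [a = 3/2] the
    equation for the second closes up with constant coefficients. *)
Definition frame (z rho : C) : M2 :=
  mx22 (- (rho * z / 2)) (Pol z - z * dPol z / 4) (- (rho / 2)) (- (dPol z / 4)).

(** Its square is the scalar [c^2 (mu - 1)], so for [mu > 1] the flow is hyperbolic for real [c] and
    elliptic for imaginary [c]. *)
Definition Nmat (c : C) : M2 := mx22 0 (c * (mu%:C - 1)) c 0.

(** [c] is the speed of the curve measured by [dz / rho]; with respect to this differential the
    gauged system has the constant matrix [Nmat 1]. *)
Lemma frame_ode (zeta rho : R -> C) (c : C) t : zeta t != 0 -> zeta t != 1 -> zeta t != lam ->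
  rho t ^+ 2 = Pol (zeta t) ->
  cder zeta t (c * rho t) -> cder rho t (dPol (zeta t) * c / 2) ->
  mder (fun u => frame (zeta u) (rho u)) t
    ((c * rho t) *: (Cm (pole lam) (resid lam (3 / 2)) (zeta t) *m frame (zeta t) (rho t)) +
     frame (zeta t) (rho t) *m Nmat c).
Proof.
move=> z0 z1 z2 rr hz hr.
have nC : 1 + mu%:C != 0 :> C.
  by rewrite -(rmorph1 (real_complex R)) -rmorphD (inj_eq (@complexI R)) gt_eqF// ltr_wpDl.
have z1' : zeta t - 1 != 0 by rewrite subr_eq0.
have z2' : zeta t + mu%:C != 0.
  by apply: contra z2; rewrite addr_eq0 => /eqP ->; rewrite /lam rmorphN.
set z := zeta t in z0 z1 z2 rr hr z1' z2' *; set r := rho t in rr hz *.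
have dP : cder (fun u => Pol (zeta u)) t (dPol z * (c * r)).
  have h1 := cderM (cderM hz (cderB hz (cder_cst 1 t))) (cderD hz (cder_cst mu%:C t)).
  by apply: cder_eq h1 _; rewrite /dPol -/z; ring.
have ddP : cder (fun u => dPol (zeta u)) t ((6 * z + 2 * (mu%:C - 1)) * (c * r)).
  have h1 := cderB (cderD (cderZ 3 (cderM hz hz)) (cderZ (2 * (mu%:C - 1)) hz)) (cder_cst mu%:C t).
  apply: (cder_ext (f := fun u => 3 * (zeta u * zeta u) + 2 * (mu%:C - 1) * zeta u - mu%:C)).
    by move=> u; rewrite /dPol expr2.
  by apply: cder_eq h1 _; rewrite -/z; ring.
set dd := 6 * z + 2 * (mu%:C - 1) in ddP.
have E i j : cder (fun u => frame (zeta u) (rho u) i j) t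
   (mx22 (- ((dPol z * c / 2 * z + r * (c * r)) / 2)) (dPol z * (c * r) - (c * r * dPol z + z * (dd * (c * r))) / 4)
     (- (dPol z * c / 2 / 2)) (- (dd * (c * r) / 4)) i j).
  case: (ord2P i) => ->; case: (ord2P j) => ->; rewrite mx22E.
  - apply: (cder_ext (f := fun u => - (rho u * zeta u / 2))) => [u|]; first by rewrite mx22E.
    by apply: cder_eq (cderN (cderM (cderM hr hz) (cder_cst (2^-1) t))) _; rewrite mulr0 addr0.
  - apply: (cder_ext (f := fun u => Pol (zeta u) - zeta u * dPol (zeta u) / 4)) => [u|]; first by rewrite mx22E.
    by apply: cder_eq (cderB dP (cderM (cderM hz ddP) (cder_cst (4^-1) t))) _; rewrite mulr0 addr0.
  - apply: (cder_ext (f := fun u => - (rho u / 2))) => [u|]; first by rewrite mx22E.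
    by apply: cder_eq (cderN (cderM hr (cder_cst (2^-1) t))) _; rewrite mulr0 addr0.
  - apply: (cder_ext (f := fun u => - (dPol (zeta u) / 4))) => [u|]; first by rewrite mx22E.
    by apply: cder_eq (cderN (cderM ddP (cder_cst (4^-1) t))) _; rewrite mulr0 addr0.
apply: mder_eq E _; rewrite negative_ratio_Cm.
have c32 : (3 / 2)%:C = 3 / 2 :> C by rewrite rmorphM fmorphV !rmorph_nat.
apply: matrix2P; rewrite !mx22E [RHS]mxE [X in _ = X + _]mxE !mulmx22 !mxE /= c32;
  apply/eqP; rewrite -subr_eq0; apply/eqP.
(* The equation of the curve enters only here; the other three entries are identities of rational
   functions. *)
- transitivity (c * (r ^+ 2 - Pol z)); last by rewrite rr subrr mulr0.
  by rewrite /Pol /dPol; field; do ?[apply/andP; split].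
- by rewrite /Pol /dPol /dd; field; do ?[apply/andP; split].
- by rewrite /Pol /dPol; field; do ?[apply/andP; split].
- by rewrite /Pol /dPol /dd; field; do ?[apply/andP; split].
Qed.

Lemma frame_pullback (h : C -> M2) (zeta rho : R -> C) (c : C) t :
  (forall x, nonpole (pole lam) x -> ParC (pole lam) (resid lam (3 / 2)) h x) ->
  zeta t != 0 -> zeta t != 1 -> zeta t != lam -> rho t ^+ 2 = Pol (zeta t) ->
  cder zeta t (c * rho t) -> cder rho t (dPol (zeta t) * c / 2) ->
  let k u := ctr (frame (zeta u) (rho u)) *m h (zeta u) *m frame (zeta u) (rho u) in
  mder k t (ctr (Nmat c) *m k t + k t *m Nmat c).
Proof.
move=> hp z0 z1 z2 rr hz hr k.
have hF := frame_ode z0 z1 z2 rr hz hr.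
have np : nonpole (pole lam) (zeta t) by apply/nonpoleP.
have hh := hp _ np _ _ _ erefl hz.
apply: mder_eq (mderM (mderM (mder_ctr hF) hh) hF) _.
rewrite /dhl /k; set F := frame _ _; set H := h _; set Om := Cm _ _ _; set l := c * rho t.
rewrite scalemxAl; set O := l *: Om; clearbody O F H.
exact: pullback_alg.
Qed.

End Frame.
End NonMember.

(** * Periodic Hermitian solutions along loops *)

Section Loops.
Variable R : realType.
Notation C := R[i].
Notation M2 := 'M[C]_2.

Section HermitianFlow.
Variables (mu : R) (k : R -> M2) (c : R -> C).
Hypothesis kherm : forall t, Defs.hermitian (k t).
Hypothesis kder : forall t, mder k t (ctr (Nmat mu (c t)) *m k t + k t *m Nmat mu (c t)).

Let al t := Rez (k t ord0 ord0).
Let ga t := Rez (k t ord_max ord_max).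
Let kk t := k t ord0 ord_max.

Let k00 t : k t ord0 ord0 = (al t)%:C.
Proof.
have := hermitian_conj ord0 ord0 (kherm t); rewrite /al; case: (k t _ _) => x y [] h.
by apply: complex_eqP => //=; lra.
Qed.

Let k11 t : k t ord_max ord_max = (ga t)%:C.
Proof.
have := hermitian_conj ord_max ord_max (kherm t); rewrite /ga; case: (k t _ _) => x y [] h.
by apply: complex_eqP => //=; lra.
Qed.

Let k10 t : k t ord_max ord0 = conjc (kk t).
Proof. by rewrite (hermitian_conj ord_max ord0 (kherm t)). Qed.

Lemma flow_diag0 (t : R) : is_derive t 1 al (2 * Rez (c t * kk t)).
Proof.
have [h _] := kder t ord0 ord0; apply: is_derive_eq h _.
rewrite mxE !mulmx22 !mxE /= !k10 -/(kk t) !cjE /=; case: (c t) => x y; case: (kk t) => z w.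
by rewrite !(RezD, RezM, ImzM) /=; ring.
Qed.

Lemma flow_off (t : R) : cder kk t (conjc (c t) * (ga t)%:C + (c t * (mu - 1)%:C) * (al t)%:C).
Proof.
apply: cder_eq (kder t ord0 ord_max) _.
rewrite mxE !mulmx22 !mxE /= k00 k11 !cjE mul0r mulr0 add0r addr0 rmorphB rmorph1.
by rewrite [RHS]addrC; congr (_ + _); [|ring] || ring.
Qed.

Lemma flow_diag1 (t : R) : is_derive t 1 ga (2 * (mu - 1) * Rez (conjc (c t) * kk t)).
Proof.
have [h _] := kder t ord_max ord_max; apply: is_derive_eq h _.
rewrite mxE !mulmx22 !mxE /= !k10 -/(kk t) !cjE /=.
have -> : mu%:C - 1 = (mu - 1)%:C by rewrite rmorphB rmorph1.
case: (c t) => x y; case: (kk t) => z w; rewrite /conjc.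
by rewrite !(RezD, RezM, ImzM) /=; ring.
Qed.

(** The product [sg * et] is monotone and periodic; its derivative is [g] times a positive definite
    form in [sg] and [et], so both vanish at [0]. *)
Lemma hyperbolic_loop (g : R -> R) (T : R) : 1 < mu -> 0 < T -> (forall t, c t = (g t)%:C) ->
  (forall t, 0 < g t) -> (forall t, k (t + T) = k t) ->
  Rez (kk 0) = 0 /\ ga 0 + (mu - 1) * al 0 = 0.
Proof.
move=> mu1 T0 cg g0 kT.
pose sg t := Rez (kk t); pose et t := ga t + (mu - 1) * al t.
have dsg (t : R) : is_derive t 1 sg (g t * et t).
  have [h _] := flow_off t; apply: is_derive_eq h _.
  by rewrite cg cjR !(RezD, RezM, ImzM) /= /et; ring.
have det (t : R) : is_derive t 1 et (4 * (mu - 1) * g t * sg t).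
  have H := is_deriveD (flow_diag1 t) (is_deriveZ (mu - 1) (flow_diag0 t)).
  apply: is_derive_eq H _; rewrite /GRing.scale /= cg cjR !RezM /= /sg; ring.
have := @periodic_monotone R (fun t => sg t * et t) (fun t => g t * (et t ^+ 2 + 4 * (mu - 1) * sg t ^+ 2)) T T0.
move=> H; have {}H : g 0 * (et 0 ^+ 2 + 4 * (mu - 1) * sg 0 ^+ 2) = 0.
  apply: H => [t|t|t].
  - by apply: is_derive_eq (is_deriveM_mul (dsg t) (det t)) _; ring.
  - by rewrite mulr_ge0 ?(ltW (g0 t))// addr_ge0 ?sqr_ge0// mulr_ge0 ?sqr_ge0//; lra.
  - by rewrite /sg /et /kk /ga /al kT.
move/eqP: H; rewrite mulf_eq0 (gt_eqF (g0 0)) /= => /eqP H.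
have s1 := sqr_ge0 (et 0); have s2 := sqr_ge0 (sg 0).
have s3 : 0 <= (mu - 1) * sg 0 ^+ 2 by rewrite mulr_ge0//; lra.
have e0 : et 0 ^+ 2 = 0 by lra.
have m0 : 0 < mu - 1 by lra.
have g2 : (mu - 1) * sg 0 ^+ 2 = 0 by lra.
split; apply/eqP.
  by move/eqP: g2; rewrite mulf_eq0 (gt_eqF m0) /= sqrf_eq0.
by move/eqP: e0; rewrite sqrf_eq0.
Qed.

(** For imaginary [c] the pair of [ta] and [et], suitably scaled, turns by [2 b] times the integral
    of [g]; a positive angle below one leaves only the zero vector fixed. *)
Lemma elliptic_loop (g : R -> R) (b T G : R) : mu - 1 = b ^+ 2 -> 0 < b -> 0 < T ->
  2 * b * G * T < 1 -> (forall t, c t = 0 +i* g t) -> (forall t, 0 < g t <= G) -> k T = k 0 ->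
  Imz (kk 0) = 0 /\ (mu - 1) * al 0 - ga 0 = 0.
Proof.
move=> mub b0 T0 small cg g0 kT.
pose ta t := Imz (kk t); pose et t := (mu - 1) * al t - ga t.
have dta (t : R) : is_derive t 1 ta (g t * et t).
  have [_ h] := flow_off t; apply: is_derive_eq h _.
  by rewrite cg /conjc !(ImzD, RezM, ImzM) /= /et; ring.
have det (t : R) : is_derive t 1 et (- (4 * b ^+ 2 * (g t * ta t))).
  have H := is_deriveB (is_deriveZ (mu - 1) (flow_diag0 t)) (flow_diag1 t).
  apply: is_derive_eq H _; rewrite /GRing.scale /= cg /conjc !RezM /= -mub /ta; ring.
apply: (small_rotation b0 T0 small g0 dta det); first by rewrite /ta /kk kT.
by rewrite /et /al /ga kT.
Qed.

End HermitianFlow.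

Definition ee (t : R) : C := cos t +i* sin t.
Definition ci : C := 0 +i* 1.

Lemma ee_der t : cder ee t (ci * ee t).
Proof.
split=> /=.
  by apply: is_derive_eq (is_derive_cos t) _; rewrite mul0r sub0r mul1r.
by apply: is_derive_eq (is_derive_sin t) _; rewrite mul0r add0r mul1r.
Qed.

Lemma eeJ t : ee t * conjc (ee t) = 1.
Proof.
rewrite /ee /conjc; apply: complex_eqP => /=; last by ring.
by rewrite -(cos2Dsin2 t); ring.
Qed.

Lemma ee0 : ee 0 = 1. Proof. by rewrite /ee cos0 sin0. Qed.

Lemma ee_period t : ee (t + pi *+ 2) = ee t.
Proof. by rewrite /ee cosD2pi sinD2pi. Qed.

End Loops.

Section CircleLoops.
Variable R : realType.
Notation C := R[i].
Notation M2 := 'M[C]_2.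
Variables (mu : R) (h : C -> M2).
Hypothesis mu0 : 0 < mu.
Let lam : C := (- mu)%:C.
Hypothesis hherm : forall x, nonpole (pole lam) x -> Defs.hermitian (h x).
Hypothesis hpar : forall x, nonpole (pole lam) x -> ParC (pole lam) (resid lam (3 / 2)) h x.

Section Circle.
Variables (z0 ka th : C).
(** On a circle along which the square root of [Pol] is [th] times [ka * ee t] times the modulus of
    [zeta], the speed [c = i / (th r)] has constant phase. This is the constant direction of the
    flow. *)
Let zeta (t : R) : C := z0 + ka * ee t.
Let r (t : R) : R := cabs (zeta t).
Let rho (t : R) : C := th * (ka * ee t) * (r t)%:C.
Let c (t : R) : C := ci R / (th * (r t)%:C).
Hypothesis th0 : th != 0.
Hypothesis ka0 : ka != 0.
Hypothesis zeta0 : forall t, zeta t != 0.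
Hypothesis rhoP : forall t, rho t ^+ 2 = Pol mu (zeta t).

Let r0 t : 0 < r t. Proof. exact: cabs_gt0. Qed.
Let rC t : (r t)%:C != 0 :> C. Proof. by rewrite (inj_eq (@complexI R)) gt_eqF. Qed.
Let e0 t : ee t != 0 :> C.
Proof.
by apply/eqP => h0; have := eeJ t; rewrite h0 mul0r => /esym/eqP; rewrite oner_eq0.
Qed.
Let rho0 t : rho t != 0.
Proof. by rewrite /rho !mulf_neq0. Qed.

Let np t : [/\ zeta t != 0, zeta t != 1 & zeta t != lam].
Proof.
have : Pol mu (zeta t) != 0 by rewrite -rhoP expf_neq0.
rewrite /Pol !mulf_eq0 !negb_or -andbA => /and3P[h0 h1 h2]; split=> //.
  by rewrite -subr_eq0.
by apply: contra h2 => /eqP ->; rewrite /lam rmorphN addNr.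
Qed.

Let dzeta t : cder zeta t (c t * rho t).
Proof.
apply: cder_eq (cderD (cder_cst z0 t) (cderZ ka (ee_der t))) _.
by rewrite /c /rho add0r; field; rewrite th0 rC.
Qed.

(** For the square root [r] only differentiability is established; the value of the derivative of
    [rho] comes from differentiating [rho^2 = Pol zeta]. *)
Let drho t : cder rho t (dPol mu (zeta t) * c t / 2).
Proof.
have [k1 k2] := dzeta t.
have r2 : 0 < Rez (zeta t) ^+ 2 + Imz (zeta t) ^+ 2 by have := r0 t; rewrite /r /cabs sqrtr_gt0.
have H2 := is_deriveD (is_deriveM_mul k1 k1) (is_deriveM_mul k2 k2).
have [d2 hd2] : exists d2 : R, is_derive t 1 (fun u => Rez (zeta u) ^+ 2 + Imz (zeta u) ^+ 2) d2.
  eexists; have <- : (fun u => Rez (zeta u) * Rez (zeta u)) \+ (fun u => Imz (zeta u) * Imz (zeta u)) =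
    (fun u => Rez (zeta u) ^+ 2 + Imz (zeta u) ^+ 2) by apply/funext => u; rewrite !expr2.
  exact: H2.
have [dr hr] : exists dr : R, is_derive t 1 r dr.
  have hs := is_derive1_sqrt r2.
  exists ((2 * Num.sqrt (Rez (zeta t) ^+ 2 + Imz (zeta t) ^+ 2))^-1 * d2).
  exact: (@is_derive1_comp R (@Num.sqrt R) (fun u => Rez (zeta u) ^+ 2 + Imz (zeta u) ^+ 2) t _ _ hs hd2).
have [d hd] : exists d, cder rho t d.
  by eexists; exact: (cderM (cderM (cder_cst th t) (cderZ ka (ee_der t))) (cder_real hr)).
apply: (cder_eq hd).
have hz := dzeta t.
have h1 := cderM (cderM hz (cderB hz (cder_cst 1 t))) (cderD hz (cder_cst mu%:C t)).
have E : d * rho t + rho t * d = (c t * rho t * (zeta t - 1) + zeta t * (c t * rho t - 0)) * (zeta t + mu%:C) +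
    zeta t * (zeta t - 1) * (c t * rho t + 0).
  apply: cder_unique (cderM hd hd) _; apply: cder_ext h1 => u.
  by rewrite -expr2 rhoP /Pol.
apply: (mulfI (rho0 t)); apply: (mulfI (x := 2)); first by rewrite pnatr_eq0.
transitivity (d * rho t + rho t * d); first by ring.
by rewrite E /dPol; field.
Qed.

Definition pulled (t : R) : M2 := ctr (frame mu (zeta t) (rho t)) *m h (zeta t) *m frame mu (zeta t) (rho t).

Lemma pulled_herm t : Defs.hermitian (pulled t).
Proof.
rewrite /Defs.hermitian /pulled !ctrM ctrK (hherm (x := zeta t)) ?mulmxA//.
exact/nonpoleP/np.
Qed.

Lemma pulled_der t : mder pulled t (ctr (Nmat mu (c t)) *m pulled t + pulled t *m Nmat mu (c t)).
Proof.
have [n0 n1 n2] := np t.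
exact: (frame_pullback mu0 hpar n0 n1 n2 (rhoP t) (dzeta t) (drho t)).
Qed.

Lemma pulled_period t : pulled (t + pi *+ 2) = pulled t.
Proof. by rewrite /pulled /rho /r /zeta ee_period. Qed.

End Circle.

Variable nu : R.
Hypothesis nu0 : 0 < nu.
Hypothesis numu : nu ^+ 2 = mu.
Variable b : R.
Hypothesis b0 : 0 < b.
Hypothesis bmu : mu - 1 = b ^+ 2.
Hypothesis bsmall : b <= 1 / 100.

(** [base] lies on both circles, with centers [1] and [- mu] and squared radii [1 + mu] and
    [mu (1 + mu)]. Inversion in the first exchanges [0] and [- mu], inversion in the second
    exchanges [0] and [1]; so on each circle [Pol] is a constant times the square of
    [ka * ee t * |zeta|]. The square root of that constant is [1] on the first circle and [th2] on
    the second. *)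
Let base : C := 0 +i* nu.
Let ka1 : C := -1 +i* nu.
Let ka2 : C := mu +i* nu.
Let th2 : C := 0 +i* nu^-1.

Let zeta1 t : C := 1 + ka1 * ee t.
Let zeta2 t : C := - mu%:C + ka2 * ee t.

Let mu1 : 1 < mu. Proof. by have := exprn_gt0 2 b0; rewrite -bmu; lra. Qed.

Let ka1J : ka1 * conjc ka1 = 1 + mu%:C.
Proof.
rewrite -numu; apply: complex_eqP; rewrite /conjc ?(RezD,ImzD,RezM,ImzM) /=; first by ring.
by rewrite mulN1r opprK mulrN1 subrr addr0.
Qed.

Let ka2J : ka2 * conjc ka2 = mu%:C * (1 + mu%:C).
Proof. by rewrite /ka2 -numu; apply: complex_eqP; rewrite /conjc ?(RezD,ImzD,RezM,ImzM) /=; ring. Qed.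

Let cab2 (z : C) : (cabs z)%:C ^+ 2 = z * conjc z.
Proof. by rewrite -rmorphXn; exact: cabs_sqr. Qed.

Let sq_re_le (z : C) : Rez z ^+ 2 <= Rez z ^+ 2 + Imz z ^+ 2.
Proof. by rewrite lerDl sqr_ge0. Qed.

Let norm_ka1 t : Rez (ka1 * ee t) ^+ 2 + Imz (ka1 * ee t) ^+ 2 = 1 + mu.
Proof.
rewrite /ka1 /ee /= -numu.
transitivity ((1 + nu ^+ 2) * (cos t ^+ 2 + sin t ^+ 2)); first by ring.
by rewrite cos2Dsin2 mulr1.
Qed.

Let norm_ka2 t : Rez (ka2 * ee t) ^+ 2 + Imz (ka2 * ee t) ^+ 2 = mu ^+ 2 + mu.
Proof.
rewrite /ka2 /ee /= -[X in _ = _ + X]numu.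
transitivity ((mu ^+ 2 + nu ^+ 2) * (cos t ^+ 2 + sin t ^+ 2)); first by ring.
by rewrite cos2Dsin2 mulr1.
Qed.

(** The center is [1] and the radius exceeds [sqrt 2], so the distance to [0] is at least
    [sqrt 2 - 1 > 2/5]. This bounds the speed [1 / |zeta1|] by [5/2]. *)
Let zeta1_lower t : 2 / 5 <= cabs (zeta1 t).
Proof.
have h1 := norm_ka1 t; have h2 := sq_re_le (ka1 * ee t); rewrite h1 in h2.
have -> : 2 / 5 = Num.sqrt ((2 / 5 : R) ^+ 2) by rewrite sqrtr_sqr ger0_norm//; lra.
rewrite /cabs; apply: ler_wsqrtr; rewrite /zeta1 RezD ImzD.
move: h1 h2; set x := Rez (ka1 * ee t); set y := Imz (ka1 * ee t) => h1 h2.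
rewrite [Rez 1]/= [Imz 1]/= add0r; clearbody x y.
have m1 := mu1; rewrite leNgt; apply/negP => hlt.
have c1 : x < - ((2 + mu - 4 / 25) / 2) by move: h1 hlt; rewrite !expr2; lra.
have c2 : ((2 + mu - 4 / 25) / 2) ^+ 2 <= x ^+ 2.
  rewrite -(sqrrN x) ler_pXn2r ?nnegrE//; lra.
by apply: lt00; move: c2 h2; rewrite !expr2; nra.
Qed.

Let zeta1_neq0 t : zeta1 t != 0.
Proof.
apply: contraTneq (zeta1_lower t) => ->; rewrite /cabs /= expr0n addr0 sqrtr0 -ltNge; lra.
Qed.

Let zeta2_neq0 t : zeta2 t != 0.
Proof.
have h1 := norm_ka2 t; have h2 := sq_re_le (ka2 * ee t); rewrite h1 in h2.
apply/eqP => hz; have := congr1 (@complex.Re R) hz; rewrite /zeta2 RezD RezN => h3.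
have m1 := mu1.
have h4 : Rez (ka2 * ee t) = mu by move: h3; rewrite [Rez mu%:C]/= [Rez 0]/=; lra.
have := congr1 (@complex.Im R) hz; rewrite /zeta2 ImzD ImzN [Imz mu%:C]/= oppr0 add0r [Imz 0]/= => h5.
apply: lt00; move: h1; rewrite h4 h5 expr0n addr0; have := mu0; lra.
Qed.

Let rho1P t : (1 * (ka1 * ee t) * (cabs (zeta1 t))%:C) ^+ 2 = Pol mu (zeta1 t).
Proof.
rewrite mul1r exprMn cab2 /Pol.
have -> : zeta1 t - 1 = ka1 * ee t by rewrite /zeta1; ring.
have -> : zeta1 t + mu%:C = ka1 * ee t * conjc (zeta1 t).
  rewrite /zeta1 !cjE; transitivity (ka1 * ee t + (ka1 * conjc ka1) * (ee t * conjc (ee t))); last by ring.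
  by rewrite ka1J eeJ; ring.
by ring.
Qed.

Let th2E : th2 ^+ 2 = - (mu%:C)^-1.
Proof.
have n0 : nu != 0 by rewrite gt_eqF.
rewrite -numu -fmorphV; apply: complex_eqP; rewrite /th2 /=; last by ring.
by field.
Qed.

Let rho2P t : (th2 * (ka2 * ee t) * (cabs (zeta2 t))%:C) ^+ 2 = Pol mu (zeta2 t).
Proof.
have mC : mu%:C != 0 :> C by rewrite (inj_eq (@complexI R)) gt_eqF.
rewrite exprMn cab2 exprMn th2E /Pol.
have -> : zeta2 t + mu%:C = ka2 * ee t by rewrite /zeta2; ring.
have -> : zeta2 t - 1 = - (mu%:C)^-1 * (ka2 * ee t) * conjc (zeta2 t).
  rewrite /zeta2 !cjE.
  transitivity (ka2 * ee t - (mu%:C)^-1 * (ka2 * conjc ka2) * (ee t * conjc (ee t))); last by field.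
  by rewrite ka2J eeJ; field.
by ring.
Qed.

Let base_np : nonpole (pole lam) base.
Proof.
by apply/nonpoleP; split; apply/eqP => /(congr1 (@complex.Im R)) /= h0; have := nu0; rewrite h0 ltxx.
Qed.

Lemma zero_at_base : h base = 0.
Proof.
have n0 : nu != 0 by rewrite gt_eqF.
have th20 : th2 != 0 by apply/eqP => -[] /eqP; rewrite invr_eq0 (negbTE n0).
have ka10 : ka1 != 0 by apply/eqP => -[]; lra.
have ka20 : ka2 != 0 by apply/eqP => -[] ? ?; have := nu0; lra.
have cb : cabs base = nu by rewrite /cabs /base /= expr0n add0r sqrtr_sqr gtr0_norm.
have z1 : zeta1 0 = base.
  by rewrite /zeta1 ee0 mulr1; apply: complex_eqP; rewrite /= ?add0r//; ring.
have z2 : zeta2 0 = base.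
  by rewrite /zeta2 ee0 mulr1; apply: complex_eqP; rewrite /=; ring.
pose k1 := pulled 1 ka1 1; pose k2 := pulled (- mu%:C) ka2 th2.
(* Both circles start at [base] with the same value of [rho], so the two pulled back forms share
   their initial value. *)
have r12 : 1 * (ka1 * ee 0) * (cabs (zeta1 0))%:C = th2 * (ka2 * ee 0) * (cabs (zeta2 0))%:C.
  rewrite z1 z2 cb ee0 !mulr1 mul1r; congr (_ * _); apply: complex_eqP; rewrite /th2 /ka1 /ka2 /= -?numu; field => //.
have k12 : k1 0 = k2 0.
  by rewrite /k1 /k2 /pulled -/(zeta1 0) -/(zeta2 0) r12 z1 z2.
have c1 t : ci R / (1 * (cabs (zeta1 t))%:C) = 0 +i* (cabs (zeta1 t))^-1.
  rewrite mul1r -fmorphV; apply: complex_eqP; rewrite /ci /=; ring.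
have c2 t : ci R / (th2 * (cabs (zeta2 t))%:C) = (nu / cabs (zeta2 t))%:C.
  have q0 : cabs (zeta2 t) != 0 by rewrite gt_eqF// cabs_gt0.
  have -> : ci R = th2 * nu%:C by apply: complex_eqP; rewrite /ci /th2 /=; field.
  rewrite rmorphM fmorphV; field; rewrite th20 (inj_eq (@complexI R)) q0//.
have pip : 0 < pi *+ 2 :> R by rewrite pmulrn_lgt0// pi_gt0.
have [s1 s2] := hyperbolic_loop (pulled_herm th20 ka20 zeta2_neq0 rho2P) (pulled_der th20 ka20 zeta2_neq0 rho2P)
   mu1 pip c2 (fun t => divr_gt0 nu0 (cabs_gt0 (zeta2_neq0 t))) (pulled_period (- mu%:C) ka2 th2).
(* With [pi < 4] and [b <= 1/100] the angle stays below [2/5]. *)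
have small : 2 * b * (5 / 2) * (pi *+ 2) < 1 :> R.
  have := pihalf_lt2 R; have := pi_gt0 R; have := b0; have := bsmall; rewrite -mulr_natr; nra.
have g1 t : 0 < (cabs (zeta1 t))^-1 <= 5 / 2.
  have := zeta1_lower t => hl; have cp : 0 < cabs (zeta1 t) by lra.
  rewrite invr_gt0 cp /= -[leRHS]invf_div lef_pV2 ?posrE//; lra.
have kT : pulled 1 ka1 1 (pi *+ 2) = pulled 1 ka1 1 0 by rewrite -[in LHS](add0r (pi *+ 2)) pulled_period.
have H1 := pulled_herm (oner_neq0 _) ka10 zeta1_neq0 rho1P.
have [t1 t2] := elliptic_loop H1 (pulled_der (oner_neq0 _) ka10 zeta1_neq0 rho1P)
   bmu b0 pip small c1 g1 kT.
move: s1 s2; rewrite -/k2 -k12; move: t1 t2; rewrite -/k1 => t1 t2 s1 s2.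
have bp : 0 < mu - 1 by rewrite bmu exprn_gt0.
have diag j : Imz (k1 0 j j) = 0.
  by have := hermitian_conj j j (H1 0); rewrite -/k1; case: (k1 0 j j) => x y [] /= hh; lra.
(* The hyperbolic loop kills the real part of the off-diagonal entry and one combination of the
   diagonal entries, the elliptic loop the imaginary part and another combination; the two
   combinations are independent because [mu > 1]. *)
have k01 : k1 0 ord0 ord_max = 0 by apply: complex_eqP.
have k00 : k1 0 ord0 ord0 = 0.
  apply: complex_eqP; last exact: diag.
  by apply: (mulfI (lt0r_neq0 bp)); rewrite mulr0; lra.
have k11 : k1 0 ord_max ord_max = 0.
  by apply: complex_eqP; [move: t2; rewrite k00 /= mulr0 sub0r => /eqP; rewrite oppr_eq0 => /eqP|exact: diag].
have k0 : k1 0 = 0.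
  apply: matrix2P; rewrite [RHS]mxE//.
  have := hermitian_conj ord_max ord0 (H1 0); rewrite -/k1 k01 => <-; exact: conjc0.
have P0 : Pol mu base != 0.
  have [q0 q1 q2] := (nonpoleP lam base).1 base_np.
  rewrite /Pol !mulf_neq0//; first by rewrite subr_eq0.
  by rewrite -[mu%:C]opprK -rmorphN subr_eq0.
have r0 : 1 * (ka1 * ee 0) * (cabs (zeta1 0))%:C != 0.
  by apply: contra P0 => /eqP e; rewrite -z1 -rho1P e expr0n.
(* The frame has determinant [rho * Pol / 2], which does not vanish off the poles. *)
have U : frame mu base (1 * (ka1 * ee 0) * (cabs (zeta1 0))%:C) \in unitmx.
  rewrite unitmxE unitfE det22 /frame !mx22E.
  rewrite [X in X != 0](_ : _ = (1 * (ka1 * ee 0) * (cabs (zeta1 0))%:C) * Pol mu base / 2); last by field.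
  by rewrite mulf_neq0 ?invr_neq0 ?pnatr_eq0// mulf_neq0.
move: k0; rewrite /k1 /pulled -/(zeta1 0) z1 in U *; move: (frame _ _ _) U => F U k0.
have e1 : ctr F *m h base = 0 by rewrite -[LHS](mulmxK U) k0 mul0mx.
have e2 : ctr (h base) *m F = 0 by rewrite -[F in LHS]ctrK -ctrM e1 /ctr raddf0 trmx0.
by rewrite -(hherm base_np) -[LHS](mulmxK U) e2 mul0mx.
Qed.

End CircleLoops.

Section NonMember.
Variable R : realType.
Notation C := R[i].
Notation M2 := 'M[C]_2.

Lemma ParL_zero (s : 'I_3 -> C) (B : 'I_3 -> M2) x : ParL s B (fun=> 0) x.
Proof.
move=> v; have h := @mder_cst R 2 2 0 0; apply: (mder_eq h).
by rewrite /dhl !(mulmx0, mul0mx) addr0 oppr0.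
Qed.

Lemma nonmember : exists x0 : R, [/\ x0 != 0, x0 != 1 & ~ Zset ((x0, 0), 3 / 2)].
Proof.
pose b : R := 1 / 100; pose mu : R := 1 + b ^+ 2; pose nu := Num.sqrt mu.
have mu0 : 0 < mu by rewrite /mu /b expr2; lra.
exists (- mu); split; [by rewrite lt_eqF// oppr_lt0|by rewrite lt_eqF//; lra|].
move=> [[/= lam0 lam1] /= /(slice_necessary lam0 lam1)[h [herm par [z [npz hz]]]]].
move: herm par npz; rewrite /lamof /= -/((- mu)%:C) => herm par npz.
have parC x : nonpole (pole (- mu)%:C) x -> ParC (pole (- mu)%:C) (resid (- mu)%:C (3 / 2)) h x.
  by move=> npx; exact: (ParL_ParC par npx).
have nu0 : 0 < nu by rewrite sqrtr_gt0.
have h0 : h (0 +i* nu) = 0.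
  have numu : nu ^+ 2 = mu by rewrite sqr_sqrtr// ltW.
  have b0 : 0 < b by rewrite /b; lra.
  have bmu : mu - 1 = b ^+ 2 by rewrite /mu; ring.
  exact: (zero_at_base mu0 herm parC nu0 numu b0 bmu (lexx _)).
have npI x : Imz x != 0 -> nonpole (pole (- mu)%:C) x.
  by move=> hx; apply/nonpoleP; split; apply: contra hx => /eqP ->.
have seg p x : (forall t, 0 <= t <= 1 -> nonpole (pole (- mu)%:C) (p + t%:C * (x - p))) ->
    h p = 0 -> h x = 0.
  move=> np hp; apply: (ParL_unique (s := pole (- mu)%:C) (B := resid (- mu)%:C (3 / 2)) (h' := fun=> 0) (b := p)).
  - by move=> t j ht; apply: np.
  - by move=> t ht; apply: par; apply: np.
  - by move=> t ht; apply: ParL_zero.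
  - by [].
(* The base point is on the upper imaginary axis, so the segment to [x] can touch the real axis only
   at its end. *)
have up x : nonpole (pole (- mu)%:C) x -> 0 <= Imz x -> h x = 0.
  move=> npx hx; apply: (seg (0 +i* nu)) => // t /andP[t0 t1].
  have [->|t1'] := eqVneq t 1; first by rewrite mul1r addrC subrK.
  apply: npI; rewrite ImzD ImzM ImzD ImzN /= mul0r addr0.
  have : 0 < nu * (1 - t) by rewrite mulr_gt0// subr_gt0 lt_neqAle t1'.
  by move=> h1; rewrite gt_eqF//; have := mulr_ge0 t0 hx; lra.
case/eqP: hz; have [hi|hi] := lerP 0 (Imz z); first exact: up.
(* The lower half plane is entered through the real point [1/2], which lies between the poles [0]
   and [1]. *)
have hf : nonpole (pole (- mu)%:C) (2^-1)%:C.
  by apply/nonpoleP; split; apply/eqP => /(congr1 (@complex.Re R)) /=; lra.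
apply: (seg (2^-1)%:C) => [t /andP[t0 t1]|]; last exact: up.
have [->|t0'] := eqVneq t 0; first by rewrite mul0r addr0.
apply: npI; rewrite ImzD ImzM ImzD ImzN /= mul0r addr0 oppr0 !addr0 add0r.
by rewrite mulf_neq0// lt_eqF.
Qed.

End NonMember.

(** * The local equation of Z *)

Section MatrixGerms.
Variables (R : realType) (p : (R * R) * R).
Notation C := R[i].
Notation M2 := 'M[C]_2.
Notation Q := ((R * R) * R)%type.

Lemma AnCAtV (f : Q -> C) : AnCAt p f -> f p != 0 -> AnCAt p (fun q => (f q)^-1).
Proof.
move=> [a b] fp; have n0 : Rez (f p) * Rez (f p) + Imz (f p) * Imz (f p) != 0.
  apply: contra fp; rewrite -!expr2 paddr_eq0 ?sqr_ge0// !sqrf_eq0 => /andP[/eqP h /eqP h'].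
  exact/eqP/complex_eqP.
have hV := AnAtV (AnAtD (AnAtM a a) (AnAtM b b)) n0.
split.
  by under eq_fun do rewrite RezV !expr2; exact: AnAtM.
by under eq_fun do rewrite ImzV !expr2; apply: AnAtN; exact: AnAtM.
Qed.

Definition AnMAt m n (A : Q -> 'M[C]_(m, n)) := forall i j, AnCAt p (fun q => A q i j).

Lemma AnMAt_cst m n (A : 'M[C]_(m, n)) : AnMAt (fun=> A).
Proof. by move=> i j; exact: AnCAt_cst. Qed.

Lemma AnMAt_ext m n (A B : Q -> 'M[C]_(m, n)) :
  (exists2 r, 0 < r & forall q, ball p r q -> A q = B q) -> AnMAt A -> AnMAt B.
Proof.
by move=> [r r0 h] hA i j; apply: AnCAt_ext (hA i j); exists r => // q hq; rewrite h.
Qed.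

Lemma AnMAtB m n (A B : Q -> 'M[C]_(m, n)) : AnMAt A -> AnMAt B -> AnMAt (fun q => A q - B q).
Proof. by move=> hA hB i j; under eq_fun do rewrite !mxE; exact: AnCAtB. Qed.

Lemma AnMAtZ m n (f : Q -> C) (A : Q -> 'M[C]_(m, n)) : AnCAt p f -> AnMAt A ->
  AnMAt (fun q => f q *: A q).
Proof. by move=> hf hA i j; under eq_fun do rewrite mxE; exact: AnCAtM. Qed.

Lemma AnMAtM m n k (A : Q -> 'M[C]_(m, n)) (B : Q -> 'M[C]_(n, k)) : AnMAt A -> AnMAt B ->
  AnMAt (fun q => A q *m B q).
Proof.
move=> hA hB i j; under eq_fun do rewrite mxE.
by apply: AnCAt_sum => l _; exact: AnCAtM.
Qed.

Lemma AnMAt_sum m n (I : Type) (s : seq I) (A : I -> Q -> 'M[C]_(m, n)) :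
  (forall i, AnMAt (A i)) -> AnMAt (fun q => \sum_(i <- s) A i q).
Proof.
by move=> hA i j; under eq_fun do rewrite summxE; apply: AnCAt_sum => l _; exact: hA.
Qed.

Lemma AnMAt_ctr m n (A : Q -> 'M[C]_(m, n)) : AnMAt A -> AnMAt (fun q => ctr (A q)).
Proof. by move=> hA i j; under eq_fun do rewrite !mxE; exact: AnCAtJ. Qed.

Lemma AnCAt_det n (A : Q -> 'M[C]_n) : AnMAt A -> AnCAt p (fun q => \det (A q)).
Proof.
move=> hA; apply: AnCAt_sum => s _; apply: AnCAtM; first exact: AnCAt_cst.
by apply: AnCAt_prod => i _; exact: hA.
Qed.

Lemma AnMAt_lin_conj (X : Q -> M2) : AnMAt X ->
  AnMAt (fun q => lin_mx (mulmx (ctr (X q)) \o mulmxr (X q)) : 'M[C]_(2 * 2)).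
Proof.
move=> hX i j; under eq_fun do rewrite mxE /=.
by case/mxvec_indexP: j => a b; under eq_fun do rewrite mxvecE /=;
  apply: AnMAtM; [exact: AnMAt_ctr|apply: AnMAtM => //; exact: AnMAt_cst].
Qed.

Lemma finite_radius (I : finType) (P : I -> R -> Prop) :
  (forall i, exists2 r0, 0 < r0 & forall r, 0 < r -> r <= r0 -> P i r) ->
  exists2 r0, 0 < r0 & forall r i, 0 < r -> r <= r0 -> P i r.
Proof.
move=> h; have {}h i : exists r0, 0 < r0 /\ forall r, 0 < r -> r <= r0 -> P i r.
  by have [r0 ? ?] := h i; exists r0.
have [f hf] := choice h.
exists (\big[Num.min/1]_i f i) => [|r i r0 rle].
  by elim/big_ind: _ => // [x y x0 y0|i _]; [rewrite lt_min x0|case: (hf i)].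
case: (hf i) => _; apply => //; apply: le_trans rle _.
exact: bigmin_le_cond.
Qed.

Lemma AnMAt_norm m n (A : Q -> 'M[C]_(m, n)) e : AnMAt A -> 0 < e ->
  exists2 r0, 0 < r0 & forall r, 0 < r -> r <= r0 -> AnM p r A (nm (A p) + e).
Proof.
move=> hA e0; pose N : R := (m * n)%:R + 1.
have N0 : 0 < N by rewrite ltr_wpDl.
have [r0 r00 hr0] := @finite_radius ('I_m * 'I_n)%type
  (fun ij r => AnC p r (fun q => A q ij.1 ij.2) (N1 (A p ij.1 ij.2) + e / N))
  (fun ij => let: ex_intro2 r r0 h := AnCAt_norm (hA ij.1 ij.2) (divr_gt0 e0 N0) in
     ex_intro2 _ _ r r0 (fun r' r'0 => h r' (ltW r'0))).
exists r0 => // r r1 rle; exists (fun i j => N1 (A p i j) + e / N); split=> [i j|].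
  exact: (hr0 r (i, j)).
rewrite /nm; under eq_bigr do rewrite big_split /= sumr_const card_ord.
rewrite big_split /= sumr_const card_ord lerD2l -mulrnA -[X in X <= _]mulr_natr.
rewrite mulrAC ler_pdivrMr// ler_pM2l// /N mulnC lerDl//.
Qed.

Variables (s : Q -> 'I_3 -> C) (B : Q -> 'I_3 -> M2) (d beta : R).
Hypothesis hs : forall j, AnCAt p (fun q => s q j).
Hypothesis hB : forall j, AnMAt (fun q => B q j).

(** Near [p] the bounds worsen slightly, to [3 / d] for the inverse distances and [beta + 1] for the
    residues; the factor [2] in the hypothesis pays for the smaller radius of convergence. *)
Lemma Wl_AnMAt x z : okd (s p) (B p) d beta x -> 2 * N1 (z - x) < disc_radius d beta ->
  AnMAt (fun q => Wl (s q) (B q) x z).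
Proof.
move=> [d0 b0 hd hb] hz i j.
have x0 l : x - s p l != 0.
  by apply: contraTneq d0 => e; have := hd l; rewrite e N1_0 leNgt.
have hV l : AnCAt p (fun q => (x - s q l)^-1).
  by apply: (@AnCAtV (fun q => x - s q l)) => //; apply: AnCAtB; [exact: AnCAt_cst|exact: hs].
have hN l : N1 (x - s p l)^-1 + 1 / d <= 3 / d.
  have : N1 (x - s p l)^-1 <= 2 / d.
    by apply: le_trans (N1V (x0 l)) _; rewrite ler_pM2l// lef_pV2 ?posrE ?N1_gt0 ?hd.
  lra.
have [r1 r10 h1] := @finite_radius _ (fun l r => AnC p r (fun q => (x - s q l)^-1) (3 / d))
  (fun l => let: ex_intro2 r r0 h := AnCAt_norm (hV l) (divr_gt0 ltr01 d0) in
     ex_intro2 _ _ r r0 (fun r' r'0 r'le => AnC_le (hN l) (h r' (ltW r'0) r'le))).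
have [r2 r20 h2] := @finite_radius _ (fun l r => AnM p r (fun q => B q l) (nm (B p l) + 1 / 3))
  (fun l => AnMAt_norm (hB l) (ltac:(lra) : 0 < 1 / 3 :> R)).
pose r := Num.min r1 r2; have r0 : 0 < r by rewrite lt_min r10.
apply: (AnC_AnCAt r0 (M := 4)).
apply: (Wl_AnC (b := fun l => nm (B p l) + 1 / 3) (rho := 3 / d) (beta := beta + 1)) => //.
- by rewrite divr_gt0.
- by lra.
- by move=> l; apply: (h1 r l r0); rewrite ge_min lexx.
- by move=> l; apply: (h2 r l r0); rewrite ge_min lexx orbT.
- by rewrite big_split /= sumr_const card_ord -mulr_natr; lra.
move: hz; rewrite /disc_radius ltr_pdivlMr; last by lra.
move=> hz; rewrite (_ : 2 * (3 / d) * (1 + (beta + 1)) * N1 (z - x) = 6 * (2 + beta) * N1 (z - x) / d); last by ring.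
rewrite ler_pdivrMr//; have := N1_ge0 (z - x); nra.
Qed.

Lemma Wseg_AnMAt n b x : good (s p) (B p) d beta n b x ->
  AnMAt (fun q => Wseg (s q) (B q) n b x).
Proof.
move=> hg; have [_ n0 _] := hg; rewrite /Wseg.
suff H k : (k <= n)%N -> AnMAt (fun q => Wch (s q) (B q) n b x k) by exact: H.
elim: k => [|k IH] kn; first exact: AnMAt_cst.
apply: AnMAtM; first exact: IH (ltnW kn).
by apply: Wl_AnMAt; [exact: pt_ok hg (ltnW kn)|exact: pt_step hg].
Qed.

Variables (k : R) (bt : nat -> R) (T : R) (n : nat).
Hypothesis hgood : good_config (s p) (B p) k bt T d beta n.

Lemma crossing_AnMAt e i : (i < 3)%N -> AnMAt (fun q => crossing (s q) (B q) k bt T n e i).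
Proof.
move=> i3; have [g1 g2 g3] := hgood e i3; under eq_fun do rewrite crossingE.
apply: AnMAtM; first exact: Wseg_AnMAt.
by apply: AnMAtM; exact: Wseg_AnMAt.
Qed.

Lemma upper_AnMAt i : (i <= 3)%N -> AnMAt (fun q => upper (s q) (B q) k bt T n i).
Proof.
elim: i => [|i IH] i3; first exact: AnMAt_cst.
under eq_fun do rewrite upperS.
by apply: AnMAtM; [exact: IH (ltnW i3)|exact: crossing_AnMAt].
Qed.

Lemma Xmat_AnMAt i : (i < 3)%N -> AnMAt (fun q => Xmat (s q) (B q) k bt T n i).
Proof. by move=> i3; apply: AnMAtM; [exact: upper_AnMAt (ltnW i3)|exact: crossing_AnMAt]. Qed.

Lemma Ymat_AnMAt i : (i < 3)%N -> AnMAt (fun q => Ymat (s q) (B q) k bt T n i).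
Proof. by move=> i3; apply: AnMAtM; [exact: upper_AnMAt (ltnW i3)|exact: crossing_AnMAt]. Qed.

End MatrixGerms.

(** * One system of paths for all nearby parameters *)

Section Configuration.
Variable R : realType.
Notation C := R[i].
Notation M2 := 'M[C]_2.
Variables (k m : R) (sp : 'I_3 -> C).
Hypothesis m0 : 0 < m.
Hypothesis m4 : m <= 1 / 4.
Hypothesis gap01 : phi k (sp o0) + 4 * m <= phi k (sp o1).
Hypothesis gap12 : phi k (sp o1) + 4 * m <= phi k (sp o2).

(** The base points sit [2 m] to the side of the unperturbed poles, which are at least [4 m] apart
    in [phi]; poles that move by less than [m] keep the distance [m] from every path of constant
    [phi]. *)
Definition abscissa (i : nat) : R :=
  match i with
  | 0 => phi k (sp o0) - 2 * m | 1 => phi k (sp o0) + 2 * m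
  | 2 => phi k (sp o1) + 2 * m | _ => phi k (sp o2) + 2 * m
  end.

Definition height : R := `|Imz (sp o0)| + `|Imz (sp o1)| + `|Imz (sp o2)| + 1.

Let near_pole (s : 'I_3 -> C) := forall j,
  `|phi k (s j) - phi k (sp j)| < m /\ `|Imz (s j) - Imz (sp j)| < m.

Let norm_bounds (x y : R) : `|x| < y -> - y < x /\ x < y.
Proof. by rewrite ltr_norml => /andP[]. Qed.

Let phi_near s j : near_pole s -> phi k (sp j) - m < phi k (s j) < phi k (sp j) + m.
Proof. by move=> /(_ j)[/norm_bounds[? ?] _]; apply/andP; split; lra. Qed.

Let Im_near s j : near_pole s -> - height + 3 / 4 <= Imz (s j) <= height - 3 / 4.
Proof.
move=> /(_ j)[_ /norm_bounds[h1 h2]].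
have h3 : - Imz (sp j) <= `|Imz (sp j)| by rewrite -normrN; exact: ler_norm.
have h4 : Imz (sp j) <= `|Imz (sp j)| by exact: ler_norm.
have h5 : `|Imz (sp j)| <= height - 1.
  rewrite /height; have := normr_ge0 (Imz (sp o0)); have := normr_ge0 (Imz (sp o1)).
  by have := normr_ge0 (Imz (sp o2)); case: (ord3P j) => ->; lra.
move: h1 h2 h3 h4 h5 m4; move: (Imz (s j)) (Imz (sp j)) `|Imz (sp j)| height => a b c e h1 h2 h3 h4 h5 h6.
clear -h1 h2 h3 h4 h5 h6.
apply/andP; split. 
have : b - m < a by lra.
have : 1 - e <= b. lra.
lra.
lra.
Qed.

Let abscissa_far s i j : near_pole s -> m <= `|abscissa i - phi k (s j)|.
Proof.
move=> hs; rewrite ler_normr.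
have /andP[h1 h2] := phi_near o0 hs; have /andP[h3 h4] := phi_near o1 hs.
have /andP[h5 h6] := phi_near o2 hs; move: gap01 gap12 m0 h1 h2 h3 h4 h5 h6.
have -> : abscissa i = match i with
  | 0 => phi k (sp o0) - 2 * m | 1 => phi k (sp o0) + 2 * m
  | 2 => phi k (sp o1) + 2 * m | _ => phi k (sp o2) + 2 * m end by [].
have [->|->|->] := ord3P j;
  move: (phi k (sp o0)) (phi k (sp o1)) (phi k (sp o2)) (phi k (s o0)) (phi k (s o1)) (phi k (s o2));
  clear=> a0 a1 a2 b0 b1 b2 g1 g2 g3 h1 h2 h3 h4 h5 h6; apply/orP; case: i => [|[|[|i]]];
  first [by left; lra | by right; lra].
Qed.

Let sorted_near s : near_pole s -> sorted_config s k abscissa height.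
Proof.
move=> hs; have /andP[h1 h2] := phi_near o0 hs; have /andP[h3 h4] := phi_near o1 hs.
have /andP[h5 h6] := phi_near o2 hs; split; last first.
  move=> j; have /andP[k1 k2] := Im_near j hs; move: k1 k2; move: (Imz (s j)) height.
  by move=> a b k1 k2; apply/andP; split; lra.
all: move: gap01 gap12 m0 h1 h2 h3 h4 h5 h6; rewrite /abscissa.
all: move: (phi k (sp o0)) (phi k (sp o1)) (phi k (sp o2)) (phi k (s o0)) (phi k (s o1)) (phi k (s o2)).
all: move=> a0 a1 a2 b0 b1 b2 g1 g2 g3 h1 h2 h3 h4 h5 h6.
all: by apply/andP; split; lra.
Qed.

Let phi_dist (x y : C) : m <= `|phi k x - phi k y| -> m / (1 + `|k|) <= N1 (x - y).
Proof.
move=> h; rewrite ler_pdivrMr; last by have := normr_ge0 k; lra.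
by rewrite mulrC; apply: le_trans h (phi_lip _ _ _).
Qed.

Let Im_dist (x y : C) : m <= `|Imz x - Imz y| -> m / (1 + `|k|) <= N1 (x - y).
Proof.
move=> h; apply: (@le_trans _ _ m); last first.
  by apply: le_trans h _; rewrite -ImzN -ImzD; exact: Imz_le.
by rewrite ler_pdivrMr ?ltr_wpDr// ler_peMr ?(ltW m0)// lerDl.
Qed.

Let d : R := m / (1 + `|k|).

Let d0 : 0 < d. Proof. by rewrite divr_gt0// ltr_wpDr. Qed.

Let L : R := \sum_(i < 3) \sum_(e : bool)
  (N1 (cpt k abscissa height e i - bpt k abscissa i) +
   N1 (cpt k abscissa height e i.+1 - cpt k abscissa height e i) +
   N1 (bpt k abscissa i.+1 - cpt k abscissa height e i.+1)).

(** The number of steps is fixed before the poles and the residues are given, so that [Xmat] and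
    [Ymat] are given by one formula over a whole neighbourhood of parameters. *)
Lemma config_near beta : 0 <= beta -> exists n, forall s (B : 'I_3 -> M2), near_pole s ->
  \sum_j nm (B j) <= beta ->
  sorted_config s k abscissa height /\ good_config s B k abscissa height d beta n.
Proof.
move=> b0; have r0 : 0 < disc_radius d beta by rewrite divr_gt0//; lra.
pose n := Num.Def.archi_bound `|2 * L / disc_radius d beta|; exists n.+1 => s B hs hB.
have hn : 2 * L < n.+1%:R * disc_radius d beta.
  rewrite -ltr_pdivrMr//; apply: le_lt_trans (ler_norm _) _.
  by apply: lt_le_trans (archi_boundP (normr_ge0 _)) _; rewrite ler_nat.
have ok x : (forall j, d <= N1 (x - s j)) -> okd s B d beta x by [].
split; first exact: sorted_near.
move=> e i i3.
have [le1 le2 le3] : [/\ N1 (cpt k abscissa height e i - bpt k abscissa i) <= L,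
    N1 (cpt k abscissa height e i.+1 - cpt k abscissa height e i) <= L &
    N1 (bpt k abscissa i.+1 - cpt k abscissa height e i.+1) <= L].
  have h : N1 (cpt k abscissa height e i - bpt k abscissa i) +
     N1 (cpt k abscissa height e i.+1 - cpt k abscissa height e i) +
     N1 (bpt k abscissa i.+1 - cpt k abscissa height e i.+1) <= L.
    rewrite /L (bigD1 (Ordinal i3))//= (bigD1 e)//= -addrA lerDl addr_ge0//.
      by apply: sumr_ge0 => e' _; rewrite !addr_ge0 ?N1_ge0.
    by apply: sumr_ge0 => i' _; apply: sumr_ge0 => e' _; rewrite !addr_ge0 ?N1_ge0.
  have n1 := N1_ge0 (cpt k abscissa height e i - bpt k abscissa i).
  have n2 := N1_ge0 (cpt k abscissa height e i.+1 - cpt k abscissa height e i).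
  have n3 := N1_ge0 (bpt k abscissa i.+1 - cpt k abscissa height e i.+1).
  by split; lra.
split; split=> //; try by lra.
- move=> t ht; apply: ok => j; apply: phi_dist.
  rewrite phi_seg /bpt /cpt !phi_point subrr mulr0 addr0.
  exact: abscissa_far.
- move=> t ht; apply: ok => j; apply: Im_dist; have /andP[h1 h2] := Im_near j hs.
  rewrite Imz_seg /cpt !Im_point subrr mulr0 addr0 ler_normr.
  move: h1 h2 m4; move: (Imz (s j)) height => a b h1 h2 h3.
  by apply/orP; case: (e); [left|right]; lra.
- move=> t ht; apply: ok => j; apply: phi_dist.
  rewrite phi_seg /bpt /cpt !phi_point subrr mulr0 addr0.
  exact: abscissa_far.
Qed.

End Configuration.

(** * Linear conditions and the Gram determinant *)

Section Gram.
Variable R : realType.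
Notation C := R[i].
Notation M2 := 'M[C]_2.

Definition conj_lin (X : M2) : 'M[C]_(2 * 2) := lin_mx (mulmx (ctr X) \o mulmxr X).

Lemma conj_linE X g : mxvec g *m conj_lin X = mxvec (ctr X *m g *m X).
Proof. by rewrite mul_vec_lin /= mulmxA. Qed.

(** Each difference of two [conj_lin] measures the failure of one condition; summing its products
    with its adjoint gives a square matrix whose kernel is the common kernel. One determinant then
    replaces the minors of an overdetermined system. *)
Definition gram (X Y : nat -> M2) : 'M[C]_(2 * 2) :=
  \sum_(i < 3) (conj_lin (X i) - conj_lin (Y i)) *m ctr (conj_lin (X i) - conj_lin (Y i)).

Lemma row_sqr_ge0 n (v : 'rV[C]_n) : 0 <= Rez ((v *m ctr v) ord0 ord0) /\
  (Rez ((v *m ctr v) ord0 ord0) = 0 -> v = 0).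
Proof.
have -> : Rez ((v *m ctr v) ord0 ord0) = \sum_j (Rez (v ord0 j) ^+ 2 + Imz (v ord0 j) ^+ 2).
  rewrite mxE Rez_sum; apply: eq_bigr => j _; rewrite !mxE RezM RezJ ImzJ; ring.
have ge j : 0 <= Rez (v ord0 j) ^+ 2 + Imz (v ord0 j) ^+ 2 by rewrite addr_ge0 ?sqr_ge0.
split=> [|/eqP]; first by apply: sumr_ge0 => j _; exact: ge.
rewrite psumr_eq0 => [/allP h|j _]; last exact: ge.
apply/rowP => j; rewrite mxE; have := h j (mem_index_enum j).
by rewrite paddr_eq0 ?sqr_ge0// !sqrf_eq0 => /andP[/eqP a /eqP b]; exact: complex_eqP.
Qed.

Lemma ctr_sum m n (I : Type) (s : seq I) (A : I -> 'M[C]_(m, n)) :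
  ctr (\sum_(i <- s) A i) = \sum_(i <- s) ctr (A i).
Proof.
elim: s => [|i s IH]; first by rewrite !big_nil /ctr raddf0 trmx0.
by rewrite !big_cons ctrD IH.
Qed.

Lemma gram_herm X Y : ctr (gram X Y) = gram X Y.
Proof. by rewrite ctr_sum; apply: eq_bigr => i _; rewrite ctrM ctrK. Qed.

Lemma det_herm n (G : 'M[C]_n) : ctr G = G -> Imz (\det G) = 0.
Proof.
move=> h; have : conjc (\det G) = \det G by rewrite -[in RHS]h /ctr det_tr det_map_mx.
by case: (\det G) => x y [] /= e; lra.
Qed.

Lemma gram_kernel X Y (v : 'rV[C]_(2 * 2)) : v *m gram X Y = 0 ->
  forall i, (i < 3)%N -> v *m (conj_lin (X i) - conj_lin (Y i)) = 0.
Proof.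
move=> h i i3; pose w (j : 'I_3) := v *m (conj_lin (X j) - conj_lin (Y j)).
have : \sum_j Rez ((w j *m ctr (w j)) ord0 ord0) = 0.
  rewrite -Rez_sum -summxE (_ : \sum_j _ = v *m gram X Y *m ctr v); first by rewrite h mul0mx mxE.
  rewrite /gram mulmx_sumr mulmx_suml; apply: eq_bigr => j _.
  by rewrite /w ctrM !mulmxA.
move/eqP; rewrite psumr_eq0 => [/allP h2|j _]; last by case: (row_sqr_ge0 (w j)).
have := h2 (Ordinal i3) (mem_index_enum _) => /= /eqP.
by case: (row_sqr_ge0 (w (Ordinal i3))) => _ /[apply].
Qed.

Lemma gram_det X Y : (exists g : M2, [/\ Defs.hermitian g, g != 0 &
    forall i, (i < 3)%N -> ctr (X i) *m g *m X i = ctr (Y i) *m g *m Y i]) <->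
  Rez (\det (gram X Y)) = 0.
Proof.
split=> [[g [_ g0 hg]]|h].
  suff /eqP -> : \det (gram X Y) == 0 by [].
  apply/det0P; exists (mxvec g); first by rewrite mxvec_eq0.
  rewrite /gram mulmx_sumr big1// => i _; rewrite mulmxA mulmxBr !conj_linE hg// subrr mul0mx//.
(* The Gram matrix is Hermitian, so its determinant is real and the real part decides. *)
have /eqP/det0P[v v0 hv] : \det (gram X Y) = 0.
  by apply: complex_eqP => //; exact: det_herm (gram_herm X Y).
pose g := vec_mx v; have g0 : g != 0 by rewrite -mxvec_eq0 vec_mxK.
have hg i : (i < 3)%N -> ctr (X i) *m g *m X i = ctr (Y i) *m g *m Y i.
  move=> i3; have := gram_kernel hv i3; rewrite mulmxBr -[v]vec_mxK -/g !conj_linE => /eqP.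
  by rewrite subr_eq0 => /eqP /(can_inj mxvecK).
have hgc i : (i < 3)%N -> ctr (X i) *m ctr g *m X i = ctr (Y i) *m ctr g *m Y i.
  by move=> /hg /(congr1 (@ctr _ _ _)); rewrite !ctrM !ctrK !mulmxA.
(* The complex solutions are closed under adjoints, so either [g + ctr g] or ['i *: g] is a nonzero
   Hermitian solution. *)
have [e|n0] := eqVneq (g + ctr g) 0; last first.
  exists (g + ctr g); split=> // [|i i3].
    by rewrite /Defs.hermitian ctrD ctrK addrC.
  by rewrite !mulmxDr !mulmxDl hg// hgc.
exists ('i *: g); split=> [||i i3].
- rewrite /Defs.hermitian ctrZ; have -> : ctr g = - g by apply/eqP; rewrite -addr_eq0 addrC e.
  rewrite scalerN -scaleNr; congr (_ *: _); apply: complex_eqP => /=; lra.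
- by rewrite scaler_eq0 negb_or g0 andbT; apply/eqP => -[] /eqP; rewrite oner_eq0.
- by rewrite -!(scalemxAr, scalemxAl) hg.
Qed.

End Gram.

(** * The local equation and its analyticity *)

Section LocalEquation.
Variable R : realType.
Notation C := R[i].
Notation M2 := 'M[C]_2.
Notation Q := ((R * R) * R)%type.

Lemma lamof_AnCAt (p : Q) : AnCAt p (@lamof R).
Proof. by split; [exact: (AnAt_coord p ord0)|exact: (AnAt_coord p o1)]. Qed.

Lemma cabs_AnCAt (p : Q) (f : Q -> C) : AnCAt p f -> f p != 0 -> AnCAt p (fun q => (cabs (f q))%:C).
Proof.
move=> [a b] fp; apply: AnCAt_real.
have h : AnAt p (fun q => Rez (f q) ^+ 2 + Imz (f q) ^+ 2).
  by under eq_fun do rewrite !expr2; apply: AnAtD; exact: AnAtM.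
by apply: (AnAt_sqrt h); rewrite -sqrtr_gt0; exact: cabs_gt0.
Qed.

Lemma AnMAt22 (p : Q) (a b c d : Q -> C) : AnCAt p a -> AnCAt p b -> AnCAt p c -> AnCAt p d ->
  AnMAt p (fun q => mx22 (a q) (b q) (c q) (d q)).
Proof.
move=> ha hb hc hd i j; case: (ord2P i) => ->; case: (ord2P j) => ->;
  by under eq_fun do rewrite mx22E.
Qed.

Lemma Aex_AnMAt (p : Q) (i : 'I_4) : M04R p -> AnMAt p (fun q => Aex (lamof q) i).
Proof.
move=> [l0 l1]; have hl := lamof_AnCAt p.
have hk (a : C) := AnCAt_cst p a.
have h1l : AnCAt p (fun q => 1 - lamof q) by apply: AnCAtB.
have l1' : 1 - lamof p != 0 by rewrite subr_eq0 eq_sym.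
have hm := cabs_AnCAt hl l0; have hn := cabs_AnCAt h1l l1'.
have m0 : (cabs (lamof p))%:C != 0 :> C by rewrite (inj_eq (@complexI R)) gt_eqF// cabs_gt0.
have n0 : (cabs (1 - lamof p))%:C != 0 :> C by rewrite (inj_eq (@complexI R)) gt_eqF// cabs_gt0.
have hu : AnCAt p (fun q => uu (lamof q)).
  apply: AnCAtM; first exact: AnCAtD.
  have d0 : 1 + (cabs (lamof p))%:C + (cabs (1 - lamof p))%:C != 0 :> C.
    rewrite -[1](rmorph1 (real_complex R)) -!rmorphD (inj_eq (@complexI R)) gt_eqF//.
    by rewrite !addr_gt0// cabs_gt0.
  have h := AnCAtV (AnCAtD (AnCAtD (hk 1) hm) hn) d0.
  by apply: AnCAt_ext h; exists 1 => // q _; rewrite !rmorphD rmorph1.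
have huc := AnCAtJ hu; have hlc := AnCAtJ hl.
have hmV := AnCAtV hm m0; have hnV := AnCAtV hn n0.
have hmnV := AnCAtV (AnCAtM hm hn) (mulf_neq0 m0 n0).
rewrite /Aex; case: i => -[|[|[|i]]] i4 /=; apply: AnMAt22; try exact: hk.
- exact: (AnCAtM huc hmV).
- exact: hu.
- exact: (AnCAtM (AnCAtB hm hu) hnV).
- exact: (AnCAtM (AnCAtB hu hm) hnV).
- exact: (AnCAtM (AnCAtB huc (hk 1)) hnV).
- exact: (AnCAtM (AnCAtB (hk 1) huc) hnV).
- exact: (AnCAtM (AnCAtB hm (AnCAtM hu hlc)) hmnV).
- exact: (AnCAtM (AnCAtM (AnCAtN (AnCAtB hm (AnCAtM hu hlc))) hl) hmnV).
- exact: (AnCAtM (AnCAtB huc hlc) hmnV).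
- exact: (AnCAtM (AnCAtM (AnCAtN (AnCAtB huc hlc)) hl) hmnV).
Qed.

Lemma lamof_lip (p q : Q) (r : R) : ball p r q -> N1 (lamof q - lamof p) < 2 * r.
Proof. by move=> /ball3P[h1 h2 _]; rewrite /N1 RezD ImzD RezN ImzN /=; lra. Qed.

Lemma M04R_open (p : Q) : M04R p -> exists2 r, 0 < r & ball p r `<=` @M04R R.
Proof.
move=> [l0 l1]; have h0 := N1_gt0 l0.
have h1 : 0 < N1 (lamof p - 1) by apply: N1_gt0; rewrite subr_eq0.
exists (Num.min (N1 (lamof p)) (N1 (lamof p - 1)) / 2); first by rewrite divr_gt0// lt_min h0.
move=> q /lamof_lip; rewrite N1_distC mulrC divfK ?pnatr_eq0// lt_min => /andP[k0 k1].
by split; apply/eqP => e; [move: k0|move: k1]; rewrite e ?subr0 ltxx.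
Qed.

Lemma resid_AnMAt (p : Q) j : M04R p -> AnMAt p (fun q => resid (lamof q) q.2 j).
Proof.
move=> hp; have [r r0 hr] := M04R_open hp.
apply: (@AnMAt_ext _ _ _ _ (fun q => q.2%:C *: Aex (lamof q) (poleA j))).
  by exists r => // q /hr[? ?]; rewrite /resid Amat_Aex.
apply: AnMAtZ; last exact: Aex_AnMAt.
by apply: AnCAt_real; exact: (AnAt_coord p o2).
Qed.

Lemma pole_AnCAt (p : Q) j : AnCAt p (fun q => pole (lamof q) j).
Proof.
by case: (ord3P j) => ->; [exact: AnCAt_cst|exact: AnCAt_cst|exact: lamof_AnCAt].
Qed.

Lemma sort_poles (lam : C) : lam != 0 -> lam != 1 -> exists (k : R) (sg : 'I_3 -> 'I_3),
  [/\ injective sg, phi k (pole lam (sg o0)) < phi k (pole lam (sg o1)) &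
      phi k (pole lam (sg o1)) < phi k (pole lam (sg o2))].
Proof.
move=> l0 l1.
have [k [k0 k1]] : exists k, phi k lam != 0 /\ phi k lam != 1.
  have [y0|y0] := eqVneq (Imz lam) 0.
    exists 0; rewrite /phi mul0r addr0; split; [apply: contra l0|apply: contra l1] => /eqP e;
      by apply/eqP/complex_eqP.
  have [x0|x0] := boolP ((Rez lam != 0) && (Rez lam != 1)).
    by exists 0; rewrite /phi mul0r addr0; apply/andP.
  (* When the real part of [lam] is [0] or [1], this slope moves [phi lam] to [1/2] or [3/2]. *)
  exists (1 / (2 * Imz lam)).
  have -> : phi (1 / (2 * Imz lam)) lam = Rez lam + 1 / 2 by rewrite /phi; field.
  by move: x0; rewrite negb_and !negbK => /orP[] /eqP ->; split; apply/eqP; lra.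
pose mk (a b c : 'I_3) (j : 'I_3) := match val j with 0 => a | 1 => b | _ => c end.
have mk_inj a b c : a != b -> a != c -> b != c -> injective (mk a b c).
  move=> ab ac bc i j; rewrite /mk; case: (ord3P i) => ->; case: (ord3P j) => -> //= e;
    by move: ab ac bc; rewrite e eqxx.
have p0 : phi k (pole lam o0) = 0 by rewrite /phi /= mulr0 addr0.
have p1 : phi k (pole lam o1) = 1 by rewrite /phi /= mulr0 addr0.
have p2 : phi k (pole lam o2) = phi k lam by [].
exists k; have [h|h] := ltP (phi k lam) 0.
  by exists (mk o2 o0 o1); split; [exact: mk_inj|rewrite /mk /= p0 p2|rewrite /mk /= p0 p1].
have {}h : 0 < phi k lam by rewrite lt_neqAle eq_sym k0.
have [h'|h'] := ltP (phi k lam) 1.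
  by exists (mk o0 o2 o1); split; [exact: mk_inj|rewrite /mk /= p0 p2|rewrite /mk /= p2 p1].
have {}h' : 1 < phi k lam by rewrite lt_neqAle eq_sym k1.
by exists (mk o0 o1 o2); split; [exact: mk_inj|rewrite /mk /= p0 p1|rewrite /mk /= p2 p1].
Qed.

Section Permuted.
Variables (s : 'I_3 -> C) (B : 'I_3 -> M2) (sg : 'I_3 -> 'I_3).
Hypothesis sg_inj : injective sg.

Lemma nonpole_perm x : nonpole (fun j => s (sg j)) x <-> nonpole s x.
Proof.
split=> h j //; have := h (invF sg_inj j); rewrite f_invF//.
Qed.

Lemma Cm_perm x : Cm (fun j => s (sg j)) (fun j => B (sg j)) x = Cm s B x.
Proof. by rewrite /Cm [RHS](reindex_inj sg_inj). Qed.

Lemma ParC_perm h x : ParC (fun j => s (sg j)) (fun j => B (sg j)) h x <-> ParC s B h x.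
Proof. by split=> H c t l ct hc; have := H c t l ct hc; rewrite /dhl Cm_perm. Qed.

Lemma ParL_perm h x : ParL (fun j => s (sg j)) (fun j => B (sg j)) h x <-> ParL s B h x.
Proof. by split=> H v; have := H v; rewrite /dhl Cm_perm. Qed.

End Permuted.

(** The criterion wants the poles in increasing order of [phi], which the permutation [sg] provides;
    neither [nonpole] nor [Cm] depends on the order. *)
Lemma Zset_holonomy (q : Q) (sg : 'I_3 -> 'I_3) (k : R) (bt : nat -> R) T d beta n : M04R q ->
  injective sg ->
  let s j := pole (lamof q) (sg j) in let B j := resid (lamof q) q.2 (sg j) in
  sorted_config s k bt T -> good_config s B k bt T d beta n ->
  Zset q <-> exists g, [/\ Defs.hermitian g, g != 0 & holonomy_eq s B k bt T n g].
Proof.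
move=> hq sgi s B hsort hgood; have [l0 l1] := hq; split=> [[_ hp]|[g [gh g0 hg]]].
  have [h [hherm hpar [z [nz hz]]]] := slice_necessary l0 l1 hp.
  apply: (criterion_necessary hsort hgood (h := h)) => [x|x|].
  - by move=> /(nonpole_perm _ sgi); exact: hherm.
  - by move=> /(nonpole_perm _ sgi) nx; apply/(ParL_perm _ _ sgi); exact: hpar.
  - by exists z; split=> //; apply/(nonpole_perm _ sgi).
split=> //.
have [h [hherm hpar hb]] := criterion_sufficient hsort hgood gh hg.
apply: (slice_sufficient l0 l1 hherm).
  by move=> z nz; apply/(ParC_perm _ _ sgi); apply: hpar; apply/(nonpole_perm _ sgi).
exists (bpt k bt 0); rewrite hb; split=> //; apply/(nonpole_perm _ sgi).
have [g1 _ _] := hgood true 0%N isT.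
have := good_nonpole g1 (t := 0); rewrite lexx ler01 mul0r addr0; exact.
Qed.

(** The paths are frozen at [p] but remain good for every [q] in the ball, so analyticity of the
    single function [F] can be established at each [q] separately. *)
Lemma local_equation (p : Q) : M04R p -> exists2 r, 0 < r & ball p r `<=` @M04R R /\
  exists F : Q -> R, (forall q, ball p r q -> AnAt q F) /\
    forall q, ball p r q -> (Zset q <-> F q = 0).
Proof.
move=> hp; have [l0 l1] := hp; have [r1 r10 hr1] := M04R_open hp.
have [k [sg [sgi lt01 lt12]]] := sort_poles l0 l1.
pose s (q : Q) j := pole (lamof q) (sg j); pose B (q : Q) j := resid (lamof q) q.2 (sg j).
pose m := Num.min (1 / 4) (Num.min ((phi k (s p o1) - phi k (s p o0)) / 4)
   ((phi k (s p o2) - phi k (s p o1)) / 4)).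
have m0 : 0 < m by rewrite !lt_min !divr_gt0 ?subr_gt0//=.
have m4 : m <= 1 / 4 by rewrite ge_min lexx.
have g01 : phi k (s p o0) + 4 * m <= phi k (s p o1).
  have : m <= (phi k (s p o1) - phi k (s p o0)) / 4 by rewrite !ge_min lexx ?orbT.
  by move: (phi k _) (phi k _) => a b; lra.
have g12 : phi k (s p o1) + 4 * m <= phi k (s p o2).
  have : m <= (phi k (s p o2) - phi k (s p o1)) / 4 by rewrite !ge_min lexx ?orbT.
  by move: (phi k _) (phi k _) => a b; lra.
have [r2 r20 hr2] := @finite_radius R _ (fun l r => AnM p r (fun q => B q l) (nm (B p l) + 1))
  (fun l => AnMAt_norm (resid_AnMAt (sg l) hp) ltr01).
pose beta := \sum_l (nm (B p l) + 1).
have b0 : 0 <= beta by apply: sumr_ge0 => l _; rewrite addr_ge0 ?nm_ge0.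
have [n hn] := config_near m0 m4 g01 g12 b0.
pose r3 := m / (2 * (1 + `|k|)).
have r30 : 0 < r3 by rewrite divr_gt0// mulr_gt0// ltr_wpDr.
pose r := Num.min r1 (Num.min r2 r3).
have r0 : 0 < r by rewrite !lt_min r10 r20.
have near q : ball p r q -> forall j,
    `|phi k (s q j) - phi k (s p j)| < m /\ `|Imz (s q j) - Imz (s p j)| < m.
  move=> hq j.
  have hN : N1 (s q j - s p j) < m / (1 + `|k|).
    rewrite /s; have k1 : 0 < 1 + `|k| by rewrite ltr_wpDr.
    case: (ord3P (sg j)) => ->; [by rewrite subrr N1_0 divr_gt0|by rewrite subrr N1_0 divr_gt0|].
    apply: lt_le_trans (lamof_lip hq) _.
    rewrite (_ : m / (1 + `|k|) = 2 * r3); last by rewrite /r3; field; rewrite gt_eqF.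
    by rewrite ler_pM2l// !ge_min lexx !orbT.
  have k1 : 1 <= 1 + `|k| by rewrite lerDl.
  move: hN; rewrite ltr_pdivlMr ?(lt_le_trans ltr01 k1)// => hN; split.
    by apply: le_lt_trans (phi_lip _ _ _) _; rewrite mulrC.
  apply: le_lt_trans hN; rewrite -ImzN -ImzD; apply: le_trans (Imz_le _) _.
  by rewrite ler_peMr ?N1_ge0.
have cfg q : ball p r q -> sorted_config (s q) k (abscissa k m (s p)) (height (s p)) /\
   good_config (s q) (B q) k (abscissa k m (s p)) (height (s p)) (m / (1 + `|k|)) beta n.
  move=> hq; apply: hn; first exact: near.
  apply: ler_sum => l _.
  have hm : r <= r2 by rewrite !ge_min lexx !orbT.
  exact: (AnM_bound (ltW r0) (hr2 r l r0 hm) hq).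
have hM q : ball p r q -> M04R q.
  by move=> hq; apply: hr1; apply: le_ball hq; rewrite ge_min lexx.
exists r => //; split=> [q /hM//|].
exists (fun q => Rez (\det (gram
  (Xmat (s q) (B q) k (abscissa k m (s p)) (height (s p)) n)
  (Ymat (s q) (B q) k (abscissa k m (s p)) (height (s p)) n)))); split=> q hq.
  have [_ hg] := cfg q hq.
  suff /AnCAt_det[] : AnMAt q (fun q => gram
    (Xmat (s q) (B q) k (abscissa k m (s p)) (height (s p)) n)
    (Ymat (s q) (B q) k (abscissa k m (s p)) (height (s p)) n)) by [].
  have hs j : AnCAt q (fun q => s q j) by exact: pole_AnCAt.
  have hB j : AnMAt q (fun q => B q j) by apply: resid_AnMAt; exact: hM.
  apply: AnMAt_sum => i.
  have D : AnMAt q (fun q =>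
    conj_lin (Xmat (s q) (B q) k (abscissa k m (s p)) (height (s p)) n i) -
    conj_lin (Ymat (s q) (B q) k (abscissa k m (s p)) (height (s p)) n i)).
    by apply: AnMAtB; apply: AnMAt_lin_conj; [exact: (Xmat_AnMAt hs hB hg)|exact: (Ymat_AnMAt hs hB hg)].
  by apply: AnMAtM => //; exact: AnMAt_ctr.
have [hs hg] := cfg q hq.
apply: iff_trans (Zset_holonomy (hM q hq) sgi hs hg) _.
exact: gram_det.
Qed.

End LocalEquation.

(** * Density and measure *)

Section Lines.
Variable R : realType.
Notation Q := ((R * R) * R)%type.

Definition axis (e : 'I_3) (p : Q) (t : R) : Q :=
  if val e is 0%N then ((t, p.1.2), p.2) else if val e is 1%N then ((p.1.1, t), p.2) else (p.1, t).
Definition coord (e : 'I_3) (p : Q) : R :=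
  if val e is 0%N then p.1.1 else if val e is 1%N then p.1.2 else p.2.

Lemma axis_coord e p : axis e p (coord e p) = p.
Proof. by case: p => [[x y] a]; case: (ord3P e) => ->. Qed.

Lemma axis_axis e p t t' : axis e (axis e p t) t' = axis e p t'.
Proof. by case: (ord3P e) => ->. Qed.

Lemma coord_axis e p t : coord e (axis e p t) = t.
Proof. by case: (ord3P e) => ->. Qed.

Lemma ball_axis e p t t' r : 0 < r -> `|t' - t| < r -> ball (axis e p t) r (axis e p t').
Proof. by move=> r0 h; apply/ball3P; case: (ord3P e) => -> /=; rewrite ?subrr ?normr0. Qed.

Lemma sum_only0 N (P : pred 'I_N.+1) (F : 'I_N.+1 -> R) : P ord0 ->
  (forall k : 'I_N.+1, (0 < k)%N -> F k = 0) -> \sum_(k | P k) F k = F ord0.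
Proof.
move=> P0 F0; rewrite (bigD1 ord0)//= big1 ?addr0// => k /andP[_ k0].
by apply: F0; rewrite lt0n; apply: contra k0 => /eqP e; apply/eqP/val_inj.
Qed.

(** A coordinate line keeps only the coefficients with two zero indices, so the weighted bound is
    inherited. *)
Lemma An_axis e p r f M : 0 < r -> An p r f M -> exists c : nat -> R,
  (forall N, \sum_(i < N) `|c i| * r ^+ i <= M) /\
  (forall u, `|u| < r -> (\sum_(i < N) c i * u ^+ i) @[N --> \oo] --> f (axis e p (coord e p + u))).
Proof.
move=> r0 [c [hM hc]].
have line0 (g : nat -> nat -> nat -> R) N : (forall i j k, (0 < j + k)%N -> g i j k = 0) ->
    tsum g N = \sum_(i < N.+1) g i 0%N 0%N.
  move=> g0; rewrite /tsum; apply: eq_bigr => i _; rewrite sum_only0 => //= [|j j0].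
    rewrite sum_only0 //= => [|k k0]; last by rewrite g0.
    by rewrite !addn0 -ltnS.
  by rewrite big1// => k _; rewrite g0// addn_gt0 j0.
have line1 (g : nat -> nat -> nat -> R) N : (forall i j k, (0 < i + k)%N -> g i j k = 0) ->
    tsum g N = \sum_(i < N.+1) g 0%N i 0%N.
  move=> g0; rewrite /tsum sum_only0 => //= [|j j0].
    apply: eq_bigr => i _; rewrite sum_only0 //= => [|k k0]; last by rewrite g0.
    by rewrite addn0 add0n -ltnS.
  by rewrite big1// => k _; rewrite big1// => l _; rewrite g0// addn_gt0 j0.
have line2 (g : nat -> nat -> nat -> R) N : (forall i j k, (0 < i + j)%N -> g i j k = 0) ->
    tsum g N = \sum_(i < N.+1) g 0%N 0%N i.
  move=> g0; rewrite /tsum sum_only0 => //= [|j j0].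
    rewrite sum_only0 => //= [|j j0]; last by rewrite big1// => l _; rewrite g0.
    by apply: eq_bigl => i /=; rewrite -ltnS add0n ltn_ord.
  by rewrite big1// => k _; rewrite big1// => l _; rewrite g0// addn_gt0 j0.
pose c1 i := if val e is 0%N then c i 0%N 0%N else if val e is 1%N then c 0%N i 0%N else c 0%N 0%N i.
exists c1; split=> [N|u ur].
  have : \sum_(i < N.+1) `|c1 i| * r ^+ i <= M.
    apply: le_trans (hM N).
    have w0 i j k : 0 <= `|c i j k| * r ^+ (i + j + k) by rewrite mulr_ge0 ?exprn_ge0// ltW.
    have le (P : nat -> nat -> nat -> bool) : tsum (fun i j k => if P i j k then `|c i j k| * r ^+ (i + j + k) else 0) N <=
       tsum (fun i j k => `|c i j k| * r ^+ (i + j + k)) N.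
      by apply: ler_tsum => i j k; case: ifP.
    rewrite /c1; case: (ord3P e) => -> /=.
    - apply: le_trans (le (fun i j k => j + k == 0)%N); rewrite line0 => [|i j k]; last by case: (j + k)%N.
      by apply: ler_sum => i _; rewrite !addn0.
    - apply: le_trans (le (fun i j k => i + k == 0)%N); rewrite line1 => [|i j k]; last by case: (i + k)%N.
      by apply: ler_sum => i _; rewrite addn0.
    - apply: le_trans (le (fun i j k => i + j == 0)%N); rewrite line2 => [|i j k]; last by case: (i + j)%N.
      by apply: ler_sum => i _.
  apply: le_trans; rewrite big_ord_recr /= lerDl mulr_ge0 ?exprn_ge0// ltW//.
have hb : ball p r (axis e p (coord e p + u)).
  by rewrite -[p in ball p](axis_coord e p); apply: ball_axis => //; rewrite addrC addKr.
have E N : psum c p (axis e p (coord e p + u)) N = \sum_(i < N.+1) c1 i * u ^+ i.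
  rewrite (_ : psum _ _ _ _ = tsum (pterm c p (axis e p (coord e p + u))) N)// /c1 /coord /axis.
  have z a b : (0 < a + b)%N -> (0 : R) ^+ a * 0 ^+ b = 0.
    by rewrite !expr0n; case: a => [|a]; case: b => [|b]; rewrite ?mulr0 ?mul0r.
  case: (ord3P e) => -> /=.
  - rewrite line0 => [|i j k h].
      by apply: eq_bigr => i _; rewrite /pterm /= !expr0 !mulr1 addrC addKr.
    by rewrite /pterm /= !subrr -mulrA z// mulr0.
  - rewrite line1 => [|i j k h].
      by apply: eq_bigr => i _; rewrite /pterm /= !expr0 !mulr1 addrC addKr.
    by rewrite /pterm /= !subrr -!mulrA [_ * 0 ^+ k]mulrC [0 ^+ i * _]mulrA z// mul0r mulr0.
  - rewrite line2 => [|i j k h].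
      by apply: eq_bigr => i _; rewrite /pterm /= !expr0 !mulr1 addrC addKr.
    by rewrite /pterm /= !subrr -[X in X * _]mulrA z// mulr0 mul0r.
rewrite -(cvg_shiftS (fun N => \sum_(i < N) c1 i * u ^+ i)).
by under eq_fun do rewrite -E; exact: hc.
Qed.

Definition isolated (D : R -> Prop) (t0 : R) :=
  exists2 e, 0 < e & forall t, `|t - t0| < e -> t != t0 -> ~ D t.

(** If some coefficient is nonzero, the first such term, of degree [m], dominates the tail, which is
    at most a constant times [|u| ^ (m + 1)]. *)
Lemma power_series_zeros (g : R -> R) (c : nat -> R) r M : 0 < r ->
  (forall N, \sum_(i < N) `|c i| * r ^+ i <= M) ->
  (forall u, `|u| < r -> (\sum_(i < N) c i * u ^+ i) @[N --> \oo] --> g u) ->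
  (exists2 e, 0 < e & forall u, `|u| < e -> g u = 0) \/
  (exists2 e, 0 < e & forall u, `|u| < e -> u != 0 -> g u != 0).
Proof.
move=> r0 hM hg.
have [h|/existsNP[m0 hm0]] := pselect (forall i, c i = 0).
  left; exists r => // u ur; apply: cvgn_unique (hg u ur) _.
  under eq_fun do (rewrite big1; last by move=> i _; rewrite h mul0r).
  exact: cvg_cst.
right.
have ex : exists i, c i != 0 by exists m0; apply/eqP.
pose m := ex_minn ex; have [cm hm] : c m != 0 /\ forall i, (i < m)%N -> c i = 0.
  rewrite /m; case: ex_minnP => k ck hk; split=> // i ik.
  by apply/eqP/negPn/negP => /hk; rewrite leqNgt ik.
have M0 : 0 <= M by have := hM 0%N; rewrite big_ord0.
have cm0 : 0 < `|c m| by rewrite normr_gt0.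
have rm : 0 < r ^+ m.+1 by rewrite exprn_gt0.
exists (Num.min r (`|c m| * r ^+ m.+1 / (2 * (M + 1)))).
  by rewrite lt_min r0 divr_gt0 ?mulr_gt0//; lra.
move=> u; rewrite lt_min => /andP[ur us] u0.
have u0' : 0 < `|u| by rewrite normr_gt0.
have bound N : `|\sum_(i < m.+1 + N) c i * u ^+ i - c m * u ^+ m| <= `|u| ^+ m.+1 / r ^+ m.+1 * M.
  rewrite big_split_ord /= big_ord_recr /= big1 ?add0r; last by move=> i _; rewrite hm ?mul0r.
  rewrite addrAC subrr add0r; apply: le_trans (ler_norm_sum _ _ _) _.
  apply: (@le_trans _ _ (\sum_(i < N) `|u| ^+ m.+1 / r ^+ m.+1 * (`|c (m.+1 + i)%N| * r ^+ (m.+1 + i)))).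
    apply: ler_sum => i _; rewrite normrM normrX !exprD.
    rewrite (_ : _ / _ * _ = `|c (m.+1 + i)%N| * (`|u| ^+ m.+1 * r ^+ i)); last by field; rewrite gt_eqF.
    do 2 (apply: ler_wpM2l; rewrite ?exprn_ge0//).
    by rewrite lerXn2r ?nnegrE// ltW.
  rewrite -mulr_sumr; apply: ler_wpM2l; first by rewrite divr_ge0 ?exprn_ge0// ltW.
  apply: le_trans (hM (m.+1 + N)%N); rewrite big_split_ord /= lerDr sumr_ge0// => i _.
  by rewrite mulr_ge0// exprn_ge0// ltW.
have lim : `|g u - c m * u ^+ m| <= `|u| ^+ m.+1 / r ^+ m.+1 * M.
  apply: cvgn_normr_le bound.
  apply: cvgB; last exact: cvg_cst.
  have := hg u ur; rewrite -(cvg_shiftn m.+1 (fun N => \sum_(i < N) c i * u ^+ i)).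
  by under eq_fun do rewrite addnC.
apply/eqP => g0; move: lim; rewrite g0 sub0r normrN normrM normrX exprS.
have um : 0 < `|u| ^+ m by rewrite exprn_gt0.
have us' : `|u| * (2 * (M + 1)) < `|c m| * r ^+ m.+1 by rewrite -ltr_pdivlMr//; lra.
rewrite (_ : _ / _ * M = (`|u| * M / r ^+ m.+1) * `|u| ^+ m); last by ring.
rewrite ler_pM2r// => hle; rewrite (ler_pdivlMr _ _ rm) in hle.
by apply: lt00; have := le_lt_trans hle; have := mulr_ge0 (ltW u0') M0; lra.
Qed.

End Lines.

Section Density.
Variable R : realType.
Notation Q := ((R * R) * R)%type.
Implicit Types (p q : Q) (e : 'I_3).

Lemma AnAt_axis_zeros e p (F : Q -> R) : AnAt p F ->
  (exists2 d, 0 < d & forall t, `|t - coord e p| < d -> F (axis e p t) = 0) \/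
  (exists2 d, 0 < d & forall t, `|t - coord e p| < d -> t != coord e p -> F (axis e p t) != 0).
Proof.
move=> [r r0 [M hF]]; have [c [h1 h2]] := An_axis e r0 hF.
have [[d d0 h]|[d d0 h]] := power_series_zeros r0 h1 h2; [left|right]; exists d => // t.
  by move=> /h; rewrite addrC subrK.
by move=> /h; rewrite subr_eq0 addrC subrK; apply.
Qed.

Lemma AnAt_neq0 p (F : Q -> R) : AnAt p F -> F p != 0 ->
  exists2 r, 0 < r & forall q, ball p r q -> F q != 0.
Proof.
move=> hF Fp; have hG := AnAtB (AnAt_cst p 1) (AnAtM (AnAt_cst p (F p)^-1) hF).
have [r r0 hr] := AnAt_norm hG (ltac:(lra) : 0 < 1 / 2 :> R).
exists r => // q hq; apply/eqP => Fq.
have := An_bound (ltW r0) (hr r (ltW r0) (lexx r)) hq.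
by rewrite Fq mulr0 subr0 mulVf// subrr normr0 normr1; lra.
Qed.

Lemma Zset_closed p : M04R p -> ~ Zset p -> exists2 r, 0 < r & forall q, ball p r q -> ~ Zset q.
Proof.
move=> hp hZ; have [r r0 [_ [F [hF hFZ]]]] := local_equation hp.
have pp : ball p r p by exact: ballxx.
have Fp : F p != 0 by apply/eqP => /(hFZ p pp).
have [r' r'0 hr'] := AnAt_neq0 (hF p pp) Fp.
exists (Num.min r r'); first by rewrite lt_min r0.
move=> q hq /hFZ h; have /eqP[] : F q != 0 by apply: hr'; apply: le_ball hq; rewrite ge_min lexx orbT.
by apply: h; apply: le_ball hq; rewrite ge_min lexx.
Qed.

Lemma line_dichotomy e p t0 : M04R (axis e p t0) ->
  (exists2 d, 0 < d & forall t, `|t - t0| < d -> Zset (axis e p t)) \/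
  isolated (fun t => Zset (axis e p t)) t0.
Proof.
move=> hp; have [r r0 [_ [F [hF hFZ]]]] := local_equation hp.
have hb t : `|t - t0| < r -> ball (axis e p t0) r (axis e p t) by exact: ball_axis.
have := AnAt_axis_zeros e (hF _ (ballxx _ r0)); rewrite coord_axis.
case=> -[d d0 h]; [left|right]; (exists (Num.min r d); first by rewrite lt_min r0);
  move=> t; rewrite lt_min => /andP[tr td].
  by apply/(hFZ _ (hb t tr)); have := h t td; rewrite axis_axis.
by move=> tt /(hFZ _ (hb t tr)); have := h t td tt; rewrite axis_axis => /eqP.
Qed.

(* Along a coordinate line contained in M04R the parameters near which the line stays in Z form
   a clopen set. *)
Lemma line_isolated e p t1 : (forall t, M04R (axis e p t)) -> ~ Zset (axis e p t1) ->
  forall t0, isolated (fun t => Zset (axis e p t)) t0.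
Proof.
move=> hM ht1 t0; have [[d d0 hd]|//] := line_dichotomy (hM t0).
pose A : set R := [set t0 | exists2 d, 0 < d & forall t, `|t - t0| < d -> Zset (axis e p t)].
have hc : connected [set: R] by apply/connected_intervalP.
suff AT : A = [set: R].
  have [a a0 ha] : A t1 by rewrite AT.
  by case: ht1; apply: ha; rewrite subrr normr0.
apply: hc.
- by exists t0; exists d.
- exists A; last by rewrite setTI.
  rewrite openE => t [a a0 ha]; apply/nbhs_ballP; exists (a / 2); first by rewrite /= divr_gt0.
  move=> u ut; exists (a / 2); first by rewrite divr_gt0.
  move=> w wu; apply: ha; rewrite (_ : w - t = (w - u) - (t - u)); last by ring.
  by apply: le_lt_trans (ler_normB _ _) _; have : `|t - u| < a / 2 by []; lra.
- exists A; last by rewrite setTI.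
  rewrite -openC openE => t At; have [//|[a a0 ha]] := line_dichotomy (hM t).
  apply/nbhs_ballP; exists a => //= u ut [b b0 hb].
  have ut' : `|u - t| < a by rewrite distrC.
  have [ute|utn] := eqVneq u t; last first.
    by apply: (ha u ut' utn); apply: hb; rewrite subrr normr0.
  by apply: At; exists b => //; rewrite -ute.
Qed.

(** Besides leaving [D], the point avoids one prescribed value [u]; this is how the imaginary part
    of [lam] is made nonzero. *)
Lemma isolated_avoid (D : R -> Prop) t0 u d : isolated D t0 -> 0 < d ->
  exists t, [/\ `|t - t0| < d, t != u & ~ D t].
Proof.
move=> [a a0 ha] d0; pose m := Num.min a d; have m0 : 0 < m by rewrite lt_min a0.
have ma : m <= a by rewrite ge_min lexx.
have md : m <= d by rewrite ge_min lexx orbT.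
have ok t : 0 < t < m -> `|t0 + t - t0| < d /\ ~ D (t0 + t).
  move=> /andP[t0' tm]; rewrite addrC addKr gtr0_norm//; split; first by lra.
  by apply: ha; rewrite ?(addrC t0) ?addrK ?gtr0_norm//; lra.
have [e|ne] := eqVneq (t0 + m / 2) u.
  have [h1 h2] := ok (m / 3) ltac:(lra).
  exists (t0 + m / 3); split=> //; apply/eqP; lra.
by have [h1 h2] := ok (m / 2) ltac:(lra); exists (t0 + m / 2).
Qed.

Lemma lamof_neq (x y a : R) : (x != 0) && (x != 1) || (y != 0) -> M04R ((x, y), a).
Proof.
move=> h; split; apply: contraTneq h => -[-> ->]; by rewrite !eqxx ?andbF.
Qed.

(** The coordinate lines have to stay in [M04R]. The imaginary part moves first, along a line whose
    real part [x0] is neither [0] nor [1], and becomes nonzero; after that the real part and then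
    [a] can run over all real numbers. *)
Lemma Zset_dense p r : M04R p -> 0 < r -> exists2 q, ball p r q & ~ Zset q.
Proof.
case: p => [[x y] a] hp r0; have [x0 [x00 x01 hx]] := nonmember R.
have hl y' : M04R ((x0, y'), 3 / 2) by apply: lamof_neq; rewrite x00 x01.
have I1 := line_isolated (e := o1) (p := ((x0, 0), 3 / 2)) hl hx y.
have [y' [yy y'0 hy']] := isolated_avoid 0 I1 r0.
have hl2 x' : M04R ((x', y'), 3 / 2) by apply: lamof_neq; rewrite y'0 orbT.
have I2 := line_isolated (e := o0) (p := ((x0, y'), 3 / 2)) hl2 hy' x.
have [x' [xx _ hx']] := isolated_avoid 0 I2 r0.
have hl3 a' : M04R ((x', y'), a') by apply: lamof_neq; rewrite y'0 orbT.
have I3 := line_isolated (e := o2) (p := ((x', y'), 3 / 2)) hl3 hx' a.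
have [a' [aa _ ha']] := isolated_avoid 0 I3 r0.
by exists ((x', y'), a') => //; apply/ball3P.
Qed.

End Density.

(** * Countable sections and measure zero *)

Section NullSets.
Variable R : realType.
Notation Q := ((R * R) * R)%type.
Local Open Scope ereal_scope.

Lemma null_product d1 d2 (T1 : measurableType d1) (T2 : measurableType d2)
    (m1 : {measure set T1 -> \bar R}) (m2 : {sigma_finite_measure set T2 -> \bar R})
    (A : set (T1 * T2)) (N : set T1) :
  measurable A -> m1.-negligible N -> (forall x, ~ N x -> m2 (xsection A x) = 0) ->
  (m1 \x m2) A = 0.
Proof.
move=> mA nN h; rewrite /product_measure1.
rewrite (@ge0_ae_eq_integral _ _ _ m1 setT _ (cst 0)) ?integral_cst ?mul0e//.
- exact: measurable_fun_xsection.
- apply: negligibleS nN => x /= hx; apply: contrapT => Nx; apply: hx => _; exact: h.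
Qed.

(** Around each point of [D] there is a rational interval that contains no other point of [D], so
    pairs of rationals enumerate [D]. *)
Lemma isolated_countable (D : set R) : (forall t, isolated D t) -> countable D.
Proof.
move=> h; pose f (ab : rat * rat) : R := xget 0%R (D `&` `]ratr ab.1, ratr ab.2[).
have sub : D `<=` [set f ab | ab in [set: rat * rat]].
  move=> t Dt; have [e e0 he] := h t.
  have [a] := rat_in_itvoo (ltac:(lra) : (t - e < t)%R).
  have [b] := rat_in_itvoo (ltac:(lra) : (t < t + e)%R).
  rewrite !in_itv /= => /andP[b1 b2] /andP[a1 a2]; exists (a, b) => //.
  have : (D `&` `]ratr a, ratr b[) (f (a, b)).
    by apply: (@xgetI _ 0%R _ t); split=> //=; rewrite in_itv /= a2.
  move=> [Df]; rewrite /= in_itv /= => /andP[f1 f2].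
  apply/eqP; apply: contrapT => /negP ne; apply: (he _ _ ne Df).
  by rewrite ltr_norml; apply/andP; split; lra.
apply: sub_countable (subset_card_le sub) _.
exact: sub_countable (card_image_le _ _) (countableP _).
Qed.

(** Measurability for the product sigma-algebra comes from writing the set as a countable union of
    boxes with rational center and radius; [W c] is empty unless the box fits inside [U]. *)
Lemma box_open_measurable (U : set Q) :
  (forall p, U p -> exists2 r : R, (0 < r)%R & ball p r `<=` U) -> measurable U.
Proof.
move=> hU.
pose box (c : rat * rat * rat * rat) : set Q :=
  ball (((ratr c.1.1.1, ratr c.1.1.2), ratr c.1.2) : Q) (ratr c.2).
pose W c : set Q := [set q | box c q /\ box c `<=` U].
have mbox c : measurable (box c).
  rewrite (_ : box c = (ball (ratr c.1.1.1 : R) (ratr c.2) `*` ball (ratr c.1.1.2 : R) (ratr c.2)) `*`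
     ball (ratr c.1.2 : R) (ratr c.2)).
    by apply: measurableX; [apply: measurableX|]; apply: measurable_realfun.open_measurable; exact: ball_open.
  by apply/seteqP; split=> [q [[? ?] ?]|q [[? ?] ?]].
have -> : U = \bigcup_c W c.
  apply/seteqP; split=> [p Up|p [n _ [? /(_ p)]]]; last exact.
  have [r r0 hr] := hU p Up.
  have [d] := rat_in_itvoo (ltac:(lra) : (0 < r / 2)%R).
  rewrite in_itv /= => /andP[d0 d1].
  have near (x : R) : exists a : rat, (`|x - ratr a| < ratr d)%R.
    have [a] := rat_in_itvoo (ltac:(lra) : (x - ratr d < x + ratr d)%R).
    by rewrite in_itv /= => /andP[a1 a2]; exists a; rewrite ltr_norml; apply/andP; split; lra.
  have [a ha] := near p.1.1; have [b hb] := near p.1.2; have [c hc] := near p.2.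
  exists (a, b, c, d) => //; split; first exact/ball3P.
  move=> q /ball3P[/= q1 q2 q3]; apply: hr; apply/ball3P.
  have tri (x y z : R) : (`|x - z| < ratr d -> `|y - z| < ratr d -> `|x - y| < r)%R.
    move=> h1 h2; rewrite (_ : x - y = (x - z) - (y - z))%R; last by ring.
    by apply: le_lt_trans (ler_normB _ _) _; lra.
  by split; [exact: tri q1 ha|exact: tri q2 hb|exact: tri q3 hc].
apply: countable_bigcupT_measurable => [|c]; first exact: countableP.
have [hc|hc] := pselect (box c `<=` U).
  by rewrite (_ : W c = box c)//; apply/seteqP; split=> [q []|q].
by rewrite (_ : W c = set0)//; apply/seteqP; split=> [q []|q].
Qed.

(** [Z] is relatively closed in the open set [M04R], hence a difference of two open sets. *)
Lemma Zset_measurable : measurable (@Zset R).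
Proof.
rewrite (_ : @Zset R = @M04R R `\` [set q | M04R q /\ ~ Zset q]).
  apply: measurableD; apply: box_open_measurable => p.
    exact: M04R_open.
  move=> [hp hZ]; have [r r0 hr] := M04R_open hp; have [r' r'0 hr'] := Zset_closed hp hZ.
  exists (Num.min r r'); first by rewrite lt_min r0.
  move=> q hq; split; [apply: hr|apply: hr']; apply: le_ball hq; rewrite ge_min lexx ?orbT//.
apply/seteqP; split=> [q hq|q [hq]]; first by split; [case: hq|case].
by apply: contra_notP => h; split.
Qed.

(** Fubini twice: for almost every [x] the line in direction [y] at [a = 3/2] leaves [Z] somewhere,
    so the section [E] is null; for [lam] outside [E] the same holds for the line in direction [a].
    Sections with only isolated points are countable and thus null. *)
Lemma Zset_negligible :
  ((@lebesgue_measure R \x @lebesgue_measure R) \x @lebesgue_measure R).-negligible (@Zset R).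
Proof.
have [x0 [x00 x01 hx]] := nonmember R.
have hl y : M04R ((x0, y), (3 / 2)%R) by apply: lamof_neq; rewrite x00 x01.
have I1 := line_isolated (e := o1) (p := ((x0, 0%R), (3 / 2)%R)) hl hx 0%R.
have [y1 [_ y10 hy1]] := isolated_avoid 0%R I1 ltr01.
have hl2 x : M04R ((x, y1), (3 / 2)%R) by apply: lamof_neq; rewrite y10 orbT.
have I2 := line_isolated (e := o0) (p := ((x0, y1), (3 / 2)%R)) hl2 hy1.
pose E : set (R * R) := ysection (@Zset R) (3 / 2)%R.
have mE : measurable E by apply: measurable_ysection; exact: Zset_measurable.
(* The values [0] and [1] are discarded as well, so that for the remaining [x] the whole line in
   direction [y] lies in [M04R]. *)
pose N : set R := [set x | Zset ((x, y1), (3 / 2)%R)] `|` ([set 0%R] `|` [set 1%R]).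
have nN : (@lebesgue_measure R).-negligible N.
  have neg1 (D : set R) : countable D -> (@lebesgue_measure R).-negligible D.
    move=> cD; exists D; split=> //; last exact: countable_lebesgue_measure0.
    exact: (countable_measurable (fun t => measurable_set1 t)).
  apply: negligibleU; first exact/neg1/isolated_countable.
  by apply: negligibleU; apply: neg1; exact: countable1.
have E0 : (@lebesgue_measure R \x @lebesgue_measure R) E = 0.
  have := @null_product _ _ _ _ (@lebesgue_measure R) (@lebesgue_measure R) E N mE nN.
  apply => x /not_orP[hZ /not_orP[/eqP xn0 /eqP xn1]].
  apply: countable_lebesgue_measure0.
  have hl3 y : M04R ((x, y), (3 / 2)%R) by apply: lamof_neq; rewrite xn0 xn1.
  rewrite (_ : xsection E x = [set y | Zset ((x, y), (3 / 2)%R)]).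
    exact: isolated_countable (line_isolated (e := o1) (p := ((x, y1), (3 / 2)%R)) hl3 hZ).
  by apply/funext => y; apply/propext; rewrite /E /xsection /ysection /= inE /= inE.
exists (@Zset R); split=> //; first exact: Zset_measurable.
have nE : (@lebesgue_measure R \x @lebesgue_measure R).-negligible E by exists E; split.
have := @null_product _ _ _ _ [the measure _ _ of (@lebesgue_measure R \x @lebesgue_measure R)%E] (@lebesgue_measure R) (@Zset R) E Zset_measurable nE.
apply => -[x y] hE; apply: countable_lebesgue_measure0.
have [hxy|hxy] := boolP ((x != 0%R) && (x != 1%R) || (y != 0%R)).
  have hl3 a : M04R ((x, y), a) by exact: lamof_neq.
  have hZ : ~ Zset ((x, y), (3 / 2)%R) by move=> h; apply: hE; rewrite /E /ysection /= inE.
  rewrite (_ : xsection _ _ = [set a | Zset ((x, y), a)]).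
    exact: isolated_countable (line_isolated (e := o2) (p := ((x, y), (3 / 2)%R)) hl3 hZ).
  apply/funext => a; apply/propext; rewrite /xsection [X in X <-> _]/= in_setE.
  exact: iff_refl.
(* Here [lam] is [0] or [1], and [Z] has no point above it. *)
rewrite (_ : xsection _ _ = set0); first exact: countable0.
apply/seteqP; split=> a; last by move=> [].
rewrite /xsection [X in X -> _]/= in_setE => -[[l0 l1] _].
move: hxy; rewrite negb_or negb_and !negbK => /andP[hx' /eqP y0].
case/orP: hx' => /eqP x'; [move: l0|move: l1]; by rewrite /lamof /= x' y0 eqxx.
Qed.

End NullSets.

Lemma AnAt_analytic (R : realType) (f : (R * R) * R -> R) p : AnAt p f -> analytic_at f p.
Proof.
move=> [r r0 [M [c [hM hc]]]]; exists r => //; exists c => q hq; split; first exact: hc.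
exists M => N; apply: le_trans (hM N).
by do 3 (apply: ler_sum => ? _); exact: (pterm_le _ _ _ _ (ltW r0) hq).
Qed.

Theorem theorem1 (R : realType) :
  (* Z is a proper analytic subset of M_{0,4} x R *)
  (forall p : (R * R) * R, M04R p ->
     exists2 r : R, 0 < r &
       ball p r `<=` @M04R R /\
       exists (k : nat) (f : 'I_k -> (R * R) * R -> R),
         (0 < k)%N /\
         (forall i, analytic_on (ball p r) (f i)) /\
         (forall i, exists q, ball p r q /\ f i q != 0) /\
         (forall q, ball p r q -> (Zset q <-> forall i, f i q = 0))) /\
  (* in particular Z is closed (in M_{0,4} x R) *)
  (forall p : (R * R) * R, M04R p -> ~ Zset p ->
     exists2 r : R, 0 < r & forall q, ball p r q -> ~ Zset q) /\
  (* and has Lebesgue measure zero *)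
  (((@lebesgue_measure R \x @lebesgue_measure R) \x @lebesgue_measure R)%E
     .-negligible (@Zset R)).
Proof.
split; last by split; [exact: Zset_closed|exact: Zset_negligible].
move=> p hp; have [r r0 [hr [F [hF hFZ]]]] := local_equation hp.
exists r => //; split=> //; exists 1%N, (fun=> F); split=> //; split.
  by move=> _ q hq; apply: AnAt_analytic; exact: hF.
split=> [_|q hq].
  have [q hq hZ] := Zset_dense hp r0.
  by exists q; split=> //; apply/eqP => /(hFZ q hq).
apply: iff_trans (hFZ q hq) _; split=> [h _|]; first exact: h.
by apply; exact: ord0.
Qed.
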